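(* Let $S_g$ be a closed oriented surface of genus $g\ge 2$, let $\Gamma_g=\pi_1(S_g)$, and let $\rho:\Gamma_g\to \mathrm{SL}(2,\mathbb{C})$ be a representation that admits a $\rho$-equivariant fitting immersion $u:\widetilde{S_g}\to \mathcal{G}$, where $\mathcal{G}$ is the space of (unoriented) geodesics of hyperbolic space $\mathbb{H}^3$. Then $\rho$ is quasi-Fuchsian.
   Context: $\widetilde{S_g}$ is the universal cover of $S_g$. A representation $\rho:\Gamma_g\to\mathrm{SL}(2,\mathbb{C})$ is quasi-Fuchsian if it is a quasi-isometric embedding (equivalently, orbit maps $\Gamma_g\to\mathbb{H}^3$ are quasi-isometric embeddings). Fitting immersions: a smooth immersion $u:S\to\mathcal{G}$ of a surface $S$ is fitting if the corresponding geodesics (together with their endpoints) locally define a smooth fibration of $\mathbb{H}^3\cup\partial\mathbb{H}^3$. In infinitesimal terms: let $\mathcal{H}$ be the real $4$-dimensional vector space of Hermitian forms on $\mathbb{C}^2$. A plane $P\subset\mathcal{H}$ is mixed if it contains no non-zero positive semi-definite form. Let $\mathrm{Gr}_2^{\mathrm{mix}}(\mathcal{H})$ be the space of mixed planes; it is identified with $\mathcal{G}$ by sending $P$ to the geodesic given by the annihilator of $P$ in the projective Klein model of $\mathbb{H}^3$ inside $\mathbb{P}(\mathcal{H}^* )$ (the two endpoints in $\mathbb{CP}^1$ of this geodesic are the common isotropic lines of the forms in $P$). With $T_P\mathrm{Gr}_2(\mathcal{H})=\mathrm{Hom}(P,\mathcal{H}/P)$, a tangent vector $\mathrm{v}$ is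 fitting if its image contains a class $[q]\in \mathcal{H}/P$ of some positive definite $q\in\mathcal{H}$; the immersion $u$ is fitting if $\mathrm{d}u(w)$ is fitting for every non-zero tangent vector $w$. *)

(* Defs.v *)
From Stdlib Require Import Relation_Operators.
From HB Require Import structures.
From mathcomp Require Import all_boot all_order all_algebra all_fingroup.
From mathcomp Require Import sesquilinear spectral complex.
From mathcomp Require Import all_classical all_reals all_analysis.

Set Implicit Arguments.
Unset Strict Implicit.
Unset Printing Implicit Defensive.

Import Order.TTheory GRing.Theory Num.Theory.
Import numFieldNormedType.Exports.

Local Open Scope classical_set_scope.
Local Open Scope complex_scope.
Local Open Scope sesquilinear_scope.
Local Open Scope ring_scope.

(* On an open set U, f is C^(k+1) iff it is differentiable and all its
   directional derivatives are C^k. *)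
Fixpoint Ck_on (R : realType) (V W : normedModType R) (k : nat) (U : set V)
    (f : V -> W) : Prop :=
  match k with
  | 0 => {in U, continuous f}
  | k'.+1 => (forall x, U x -> differentiable f x) /\
             (forall v : V, Ck_on k' U (fun x => 'D_v f x))
  end.

Definition smooth_on (R : realType) (V W : normedModType R) (U : set V)
    (f : V -> W) : Prop := forall k, Ck_on k U f.

(* chart_map and chart_inv are total functions, meaningful only on chart_dom
   and on its image. *)
Record chart (R : realType) (T : topologicalType) := Chart {
  chart_dom : set T;
  chart_map : T -> 'rV[R]_2;
  chart_inv : 'rV[R]_2 -> T;
  chart_dom_open : open chart_dom;
  chart_img_open : open (chart_map @` chart_dom);
  chart_mapK : {in chart_dom, cancel chart_map chart_inv};
  chart_map_cts : {in chart_dom, continuous chart_map};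
  chart_inv_cts : {in chart_map @` chart_dom, continuous chart_inv} }.

Definition chart_img (R : realType) (T : topologicalType) (c : chart R T) :
  set 'rV[R]_2 := chart_map c @` chart_dom c.

Definition oriented_atlas (R : realType) (T : topologicalType)
    (A : set (chart R T)) : Prop :=
  (forall x, exists2 c, A c & chart_dom c x) /\
  (forall c d, A c -> A d ->
     let overlap := chart_map c @` (chart_dom c `&` chart_dom d) in
     let transition := chart_map d \o chart_inv c in
     smooth_on overlap transition /\
     (forall y, overlap y -> 0 < \det (jacobian transition y))).

(* The 4g-gon is the closed unit disc; edge number k (0 <= k < 4g) is the arc
   of the points polygon_boundary g (k + s), 0 <= s <= 1. *)
Definition polygon (R : realType) : set 'rV[R]_2 :=
  [set z | z 0 0 ^+ 2 + z 0 1 ^+ 2 <= 1].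

Definition polygon_boundary (R : realType) (g : nat) (t : R) : 'rV[R]_2 :=
  let theta := 2 * pi * t / (4 * g)%:R in
  \row_(j < 2) if j == 0 then cos theta else sin theta.

(* The gluing word [a_1,b_1]...[a_g,b_g]: for each k < g, edge 4k is glued to
   edge 4k+2 and edge 4k+1 to edge 4k+3, both reversing the direction. *)
Definition edge_glue (R : realType) (g : nat) (x y : 'rV[R]_2) : Prop :=
  exists (k b : nat) (s : R),
    [/\ (k < g)%N, (b < 2)%N, 0 <= s <= 1,
        x = polygon_boundary g ((4 * k + b)%:R + s) &
        y = polygon_boundary g ((4 * k + b + 3)%:R - s)].

(* A continuous surjection from the (compact) polygon onto a Hausdorff space is
   a quotient map, so this says that S is homeomorphic to the glued 4g-gon. *)
Definition has_genus (R : realType) (g : nat) (S : topologicalType) : Prop :=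
  exists f : 'rV[R]_2 -> S,
    [/\ {within @polygon R, continuous f},
        f @` @polygon R = setT &
        forall x y, polygon x -> polygon y ->
          (f x = f y <-> clos_refl_sym_trans _ (@edge_glue R g) x y)].

Definition closed_oriented_surface (R : realType) (g : nat)
    (S : topologicalType) (A : set (chart R S)) : Prop :=
  [/\ hausdorff_space S, compact [set: S], connected [set: S],
      oriented_atlas A & has_genus R g S].

(* Paths are total functions on R, meaningful only on [0, 1]. *)
Definition is_path (R : realType) (T : topologicalType) (x y : T)
    (c : R -> T) : Prop :=
  [/\ {within `[0, 1], continuous c}, c 0 = x & c 1 = y].

Definition path_homotopic (R : realType) (T : topologicalType) (x y : T)
    (c d : R -> T) : Prop :=
  exists F : R * R -> T,
    [/\ {within `[0, 1] `*` `[0, 1], continuous F},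
        forall t, 0 <= t <= 1 -> F (0, t) = c t /\ F (1, t) = d t &
        forall s, 0 <= s <= 1 -> F (s, 0) = x /\ F (s, 1) = y].

Definition path_concat (R : realType) (T : topologicalType) (c d : R -> T) :
  R -> T := fun t => if t <= 2^-1 then c (2 * t) else d (2 * t - 1).

(* Gamma is the fundamental group of (T, x), cls sending a loop to its class;
   the values of cls on functions that are not loops at x are irrelevant. *)
Definition is_fundamental_group (R : realType) (T : topologicalType) (x : T)
    (Gamma : groupType) (cls : (R -> T) -> Gamma) : Prop :=
  [/\ forall gamma, exists2 c, is_path x x c & cls c = gamma,
      forall c d, is_path x x c -> is_path x x d ->
        (cls c = cls d <-> path_homotopic x x c d) &
      forall c d, is_path x x c -> is_path x x d ->
        cls (path_concat c d) = (cls c * cls d)%g].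

Definition simply_connected (R : realType) (T : topologicalType) : Prop :=
  (forall x y : T, exists c : R -> T, is_path x y c) /\
  (forall (x : T) (c : R -> T), is_path x x c ->
     path_homotopic x x c (fun=> x)).

Definition covering_map (X S : topologicalType) (p : X -> S) : Prop :=
  [/\ continuous p, p @` setT = setT &
      forall s, exists (U : set S) (sheets : set (set X)),
        [/\ open U /\ U s,
            trivIset sheets id,
            p @^-1` U = \bigcup_(V in sheets) V &
            forall V, sheets V -> open V /\
              exists sec : S -> X,
                [/\ {in U, continuous sec},
                    forall t, U t -> V (sec t) /\ p (sec t) = t &
                    forall x, V x -> sec (p x) = x]]].

Definition universal_cover (R : realType) (X S : topologicalType)
    (p : X -> S) : Prop := covering_map p /\ simply_connected R X.

(* The smooth structure of a covering space: charts of the base composed with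
   the covering map. *)
Definition lifted_atlas (R : realType) (X S : topologicalType) (p : X -> S)
    (A : set (chart R S)) : set (chart R X) :=
  [set phi | exists2 c, A c &
     forall x, chart_dom phi x ->
       chart_dom c (p x) /\ chart_map phi x = chart_map c (p x)].

(* The action of the fundamental group of (S, p x0) on the universal cover by
   deck transformations: the class of a loop moves x0 to the end of the lift
   of that loop starting at x0. *)
Definition deck_action (R : realType) (X S : topologicalType) (p : X -> S)
    (x0 : X) (Gamma : groupType) (cls : (R -> S) -> Gamma)
    (act : Gamma -> X -> X) : Prop :=
  [/\ forall x, act 1%g x = x,
      forall gamma delta x, act (gamma * delta)%g x = act gamma (act delta x),
      forall gamma, continuous (act gamma),
      forall gamma x, p (act gamma x) = p x &
      forall (y : X) (c : R -> X), is_path x0 y c -> p y = p x0 ->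
        act (cls (p \o c)) x0 = y].

Definition pos_def (R : realType) (M : 'M[R[i]]_2) : Prop :=
  forall v : 'cV[R[i]]_2, v != 0 -> 0 < (v ^t* *m M *m v) 0 0.

Definition pos_semidef (R : realType) (M : 'M[R[i]]_2) : Prop :=
  forall v : 'cV[R[i]]_2, 0 <= (v ^t* *m M *m v) 0 0.

(* The real vector space of Hermitian forms on C^2 is 'rV[R]_4; herm q is the
   Gram matrix of q, i.e. q(v) = v^* (herm q) v. *)
Definition herm (R : realType) (q : 'rV[R]_4) : 'M[R[i]]_2 :=
  (block_mx ((q 0 0)%:C)%:M      (q 0 1 +i* q 0 2)%:M
            (q 0 1 -i* q 0 2)%:M ((q 0 3)%:C)%:M : 'M[R[i]]_(1 + 1)).

Lemma herm_hermitian (R : realType) (M : 'M[R[i]]_2) :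
  M \is hermsymmx <-> exists q, M = herm q.
Proof.
have val01 : (@rshift 1 1 0 : 'I_2) = 1 by apply/val_inj.
have val00 : (@lshift 1 1 0 : 'I_2) = 0 by apply/val_inj.
have two (i : 'I_2) : i = 0 \/ i = 1.
  by case: i => -[|[|//]] lt; [left|right]; apply/val_inj.
have hermE (q : 'rV[R]_4) : [/\ herm q 0 0 = (q 0 0)%:C,
    herm q 0 1 = q 0 1 +i* q 0 2, herm q 1 0 = q 0 1 -i* q 0 2 &
    herm q 1 1 = (q 0 3)%:C].
  split.
  - by rewrite -{1 2}val00; apply: etrans (block_mxEul _ _ _ _ _ _) _;
       rewrite mxE.
  - by rewrite -{1}val00 -val01; apply: etrans (block_mxEur _ _ _ _ _ _) _;
       rewrite mxE.
  - by rewrite -{1}val01 -val00; apply: etrans (block_mxEdl _ _ _ _ _ _) _;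
       rewrite mxE.
  - by rewrite -val01; apply: etrans (block_mxEdr _ _ _ _ _ _) _;
       rewrite mxE.
split=> [/is_hermitianmxP MH|[q ->]].
  have MHij i j : M i j = (M j i)^*.
    by rewrite {1}MH expr0 scale1r !mxE.
  exists (\row_(k < 4) [:: complex.Re (M 0 0); complex.Re (M 0 1);
                           complex.Im (M 0 1); complex.Re (M 1 1)]`_k).
  set q := \row_(_ < _) _.
  have [e00 e01 e10 e11] := hermE q.
  apply/matrixP => i j.
  have [] := two i; have [] := two j => -> ->;
    rewrite ?(e00, e01, e10, e11) !mxE /=.
  - have := MHij 0 0; case: (M 0 0) => a b [] /eqP.
    by rewrite -addr_eq0 -mulr2n mulrn_eq0 /= => /eqP ->.
  - by case: (M 0 1).
  - by rewrite MHij; case: (M 0 1).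
  - have := MHij 1 1; case: (M 1 1) => a b [] /eqP.
    by rewrite -addr_eq0 -mulr2n mulrn_eq0 /= => /eqP ->.
have [e00 e01 e10 e11] := hermE q.
apply/is_hermitianmxP; rewrite expr0 scale1r; apply/matrixP => i j.
transitivity (conjc (herm q j i)); last by rewrite !mxE.
have [] := two i; have [] := two j => -> ->;
by rewrite ?(e00, e01, e10, e11) /= ?oppr0 ?opprK.
Qed.

(* Klein model: h : 'M[R[i]]_2 acts on forms by q |-> \tr (h *m herm q), so
   that v *m v ^t* is evaluation at v. A point of P(H^* ) is represented by
   its positive definite representative of determinant 1. *)
Definition H3 (R : realType) : set 'M[R[i]]_2 :=
  [set h | pos_def h /\ \det h = 1].

(* cosh (hyp_dist h k) = tr (h^-1 k) / 2 *)
Definition hyp_dist (R : realType) (h k : 'M[R[i]]_2) : R :=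
  let c := complex.Re (\tr (invmx h *m k)) / 2 in
  ln (c + Num.sqrt (c ^+ 2 - 1)).

Definition H3_act (R : realType) (m h : 'M[R[i]]_2) : 'M[R[i]]_2 :=
  m *m h *m m ^t*.

(* The space of geodesics of H^3, identified with Gr_2^mix(H). *)
Record mixed_plane (R : realType) := MixedPlane {
  plane :> {vspace 'rV[R]_4};
  mixed_plane_dim : \dim plane = 2%N;
  mixed_planeP : forall q, q \in plane -> pos_semidef (herm q) -> q = 0 }.

(* The points of H^3 on the geodesic given by the annihilator of P. *)
Definition geodesic (R : realType) (P : mixed_plane R) : set 'M[R[i]]_2 :=
  [set h | @H3 R h /\ forall q, q \in plane P -> \tr (h *m herm q) = 0].

Definition gr_smooth_on (R : realType) (D : set 'rV[R]_2)
    (P : 'rV[R]_2 -> mixed_plane R) : Prop :=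
  forall y, D y -> exists (U : set 'rV[R]_2) (q1 q2 : 'rV[R]_2 -> 'rV[R]_4),
    [/\ open U /\ U y, smooth_on U q1, smooth_on U q2 &
        forall z, U z -> plane (P z) = <<[:: q1 z; q2 z]>>%VS].

(* The graph of the differential dP_y(w), an element of
   T_(P y) Gr_2(H) = Hom(P y, H / P y): it sends q to the class of r when r is,
   modulo P y, the derivative along w of a local section of P taking the value
   q at y. *)
Definition gr_diff (R : realType) (P : 'rV[R]_2 -> mixed_plane R)
    (y w : 'rV[R]_2) (q r : 'rV[R]_4) : Prop :=
  exists (U : set 'rV[R]_2) (s : 'rV[R]_2 -> 'rV[R]_4),
    [/\ open U /\ U y, smooth_on U s, forall z, U z -> s z \in plane (P z),
        s y = q & 'D_w s y - r \in plane (P y)].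

Definition smooth_to_geodesics (R : realType) (T : topologicalType)
    (A : set (chart R T)) (u : T -> mixed_plane R) : Prop :=
  forall phi, A phi -> gr_smooth_on (chart_img phi) (u \o chart_inv phi).

Definition immersion_to_geodesics (R : realType) (T : topologicalType)
    (A : set (chart R T)) (u : T -> mixed_plane R) : Prop :=
  smooth_to_geodesics A u /\
  forall phi, A phi -> forall y w, chart_img phi y -> w != 0 ->
    exists q r, gr_diff (u \o chart_inv phi) y w q r /\
                r \notin plane (u (chart_inv phi y)).

Definition fitting_immersion (R : realType) (T : topologicalType)
    (A : set (chart R T)) (u : T -> mixed_plane R) : Prop :=
  immersion_to_geodesics A u /\
  forall phi, A phi -> forall y w, chart_img phi y -> w != 0 ->
    exists q r, gr_diff (u \o chart_inv phi) y w q r /\ pos_def (herm r).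

Definition SL2_representation (R : realType) (Gamma : groupType)
    (rho : Gamma -> 'M[R[i]]_2) : Prop :=
  [/\ forall gamma, \det (rho gamma) = 1,
      rho 1%g = 1%:M &
      forall gamma delta, rho (gamma * delta)%g = rho gamma *m rho delta].

Definition equivariant (R : realType) (X : Type) (Gamma : groupType)
    (act : Gamma -> X -> X) (rho : Gamma -> 'M[R[i]]_2)
    (u : X -> mixed_plane R) : Prop :=
  forall gamma x,
    geodesic (u (act gamma x)) = H3_act (rho gamma) @` geodesic (u x).

Definition words (Gamma : groupType) (s : seq Gamma) (gamma : Gamma) :
  set (seq Gamma) :=
  [set w : seq Gamma |
    (forall a : Gamma, a \in w -> a \in s \/ (a^-1)%g \in s) /\
    (\prod_(a <- w) a)%g = gamma].

Definition generates (Gamma : groupType) (s : seq Gamma) : Prop :=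
  forall gamma, words s gamma !=set0.

Definition word_dist (R : realType) (Gamma : groupType) (s : seq Gamma)
    (gamma delta : Gamma) : R :=
  inf [set (size w)%:R | w in words s (gamma^-1 * delta)%g].

Definition quasi_isometric_embedding (R : realType) (X Y : Type)
    (dX : X -> X -> R) (dY : Y -> Y -> R) (f : X -> Y) : Prop :=
  exists K C : R, [/\ 1 <= K, 0 <= C &
    forall x y, K^-1 * dX x y - C <= dY (f x) (f y) <= K * dX x y + C].

Definition quasi_fuchsian (R : realType) (Gamma : groupType)
    (rho : Gamma -> 'M[R[i]]_2) : Prop :=
  exists s : seq Gamma, generates s /\
    forall o, @H3 R o ->
      quasi_isometric_embedding (@word_dist R Gamma s) (@hyp_dist R)
        (fun gamma => H3_act (rho gamma) o).

(* Main.v *)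
(** Identify a geodesic of H^3 with the plane P of forms vanishing on it, and let
    E be the set of pairs (x, h) where h is a positive definite form on the
    geodesic u(x).  Fitting says that, for every non-zero tangent vector w, some
    derivative of a section of u along w is positive definite, hence positive
    on every semi-definite h orthogonal to u(x), endpoints at infinity included.
    By the implicit function theorem the developing map (x, h) |-> h is then a
    local homeomorphism, also at the endpoints; since the closed geodesics over
    the compact surface form a compact set modulo Gamma, it has local sections
    on balls of uniform size for the order between forms
    (1 - e) h < k < (1 + e) h, which is invariant under SL(2, C).
    The cone of positive definite forms is convex, so these sections glue to a
    global section L, which by unique lifting along the connected cover X
    inverts the developing map.  The segment from h to rho(gamma) h is covered by
    O(log |rho(gamma)|) such balls; its image by L joins x to gamma x and moves
    by a bounded amount in Gamma at each step.  Hence the word length of gamma is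
    at most linear in log |rho(gamma)|, that is, in the hyperbolic displacement;
    the other inequality is submultiplicativity of the norm. *)

From HB Require Import structures.
Require Import Defs.
From mathcomp Require Import all_boot all_order all_algebra all_fingroup.
From mathcomp Require Import sesquilinear spectral complex.
From mathcomp Require Import all_classical all_reals all_analysis.
From mathcomp Require Import ring lra.

Import Order.TTheory GRing.Theory Num.Theory.
Import numFieldNormedType.Exports.

Local Open Scope classical_set_scope.
Local Open Scope ring_scope.

(** * Sections of a locally injective relation *)

(** The obstacle is completeness: a local homeomorphism may have inverse branches of no uniform
    size, and [Gamma] is cocompact on [X] but not along the geodesics, whose fibers in [E] are open
    cones. The size is therefore sought where compactness is available: forms are scaled to trace 1,
    so that a closed geodesic becomes a compact slice whose endpoints are forms of rank one, and the
    implicit function theorem is applied at those endpoints too. An order interval around a form of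
    trace 1 has Euclidean size at most [3 e] however close the form is to infinity, so it fits into
    the Euclidean ball on which solutions exist. Positive forms are not normalised to determinant 1:
    in the cone, order intervals are convex, so that any two of them meet in a connected set, which
    is what gluing needs, and scaling is one more symmetry. The gluing advances through intervals
    [r^-1 h0 < h < r h0], with [r] growing by a fixed ratio. [E] is handled as a relation, without a
    topology of its own; the same gluing lemma then also lifts paths to the cover. *)

Definition locally_injective {X Y : topologicalType} (E : set (X * Y)) : Prop :=
  forall x y, E (x, y) -> exists (U : set X) (V : set Y),
    [/\ nbhs x U, nbhs y V &
        forall y', V y' -> forall x1 x2, U x1 -> U x2 ->
          E (x1, y') -> E (x2, y') -> x1 = x2].

(** The coincidence set is open by local injectivity, closed because [X] is Hausdorff, and [D] is
    connected. The base map [b] is arbitrary, so that the lemma serves for lifts of paths, for deck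
    transformations as lifts of [p], and for sections, where [b] is the identity. *)
Lemma lift_unique (X Y Z : topologicalType) (E : set (X * Y)) (D : set Z)
    (b : Z -> Y) (f g : Z -> X) (z0 : Z) :
  hausdorff_space X -> locally_injective E -> connected D ->
  {within D, continuous b} -> {within D, continuous f} ->
  {within D, continuous g} ->
  (forall z, D z -> E (f z, b z)) -> (forall z, D z -> E (g z, b z)) ->
  D z0 -> f z0 = g z0 -> forall z, D z -> f z = g z.
Proof.
move=> hX iE cD cb cf cg Ef Eg Dz0 fg0.
pose U : set (subspace D) := [set z | D z /\ f z = g z].
suff UD : U = D by move=> z; rewrite -UD => -[].
move/clopen_connectedP : cD; apply; last 2 first.
- by move=> z [].
- by exists z0.
split.
  rewrite openE => z [Dz fgz]; rewrite /interior.
  have [A [B [Ax By inj]]] := iE _ _ (Ef _ Dz).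
  have DD : nbhs (z : subspace D) D.
    by case: (nbhs_subspaceP _ z) => // _; exact: withinT.
  have gA : nbhs (g z) A by rewrite -fgz.
  near=> z'; have Dz' : D z' by near: z'.
  split=> //; apply: (inj (b z')); rewrite /=.
  - by near: z'; exact: cb By.
  - by near: z'; exact: cf Ax.
  - by near: z'; exact: cg gA.
  - exact: Ef.
  - exact: Eg.
rewrite -[U]setCK; apply: open_closedC.
rewrite openE => z nUz; rewrite /interior.
have [Dz|nDz] := pselect (D z); last first.
  by case: (nbhs_subspaceP _ z) => // _ ? ->.
have nfg : f z != g z by apply/eqP => fg; apply: nUz.
move: hX; rewrite open_hausdorff => /(_ _ _ nfg)[[A B]] /= [fA gB] [oA oB AB0].
near=> z' => -[Dz' fg].
have Afz : A (f z').
  by near: z'; apply: cf; apply: open_nbhs_nbhs; split => //; rewrite -in_setE.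
have Bgz : B (g z').
  by near: z'; apply: cg; apply: open_nbhs_nbhs; split => //; rewrite -in_setE.
by suff : set0 (f z') by []; rewrite -(eqP AB0); split=> //; rewrite fg.
Unshelve. all: by end_near. Qed.

(** Continuity is asked at the points of [D] in the ambient topology, so that functions glued from
    sections on open pieces are again sections. *)
Definition is_section {X Y : topologicalType} (E : set (X * Y)) (D : set Y)
    (s : Y -> X) : Prop :=
  forall y, D y -> E (s y, y) /\ {for y, continuous s}.

Lemma is_section_within (X Y : topologicalType) (E : set (X * Y)) (D D' : set Y)
    (s : Y -> X) :
  D' `<=` D -> is_section E D s -> {within D', continuous s}.
Proof.
move=> D'D sE; apply: continuous_in_subspaceT => y.
by rewrite in_setE => /D'D /sE [].
Qed.

Lemma section_unique (X Y : topologicalType) (E : set (X * Y))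
    (D1 D2 : set Y) (s1 s2 : Y -> X) (y0 : Y) :
  hausdorff_space X -> locally_injective E ->
  is_section E D1 s1 -> is_section E D2 s2 ->
  connected (D1 `&` D2) -> (D1 `&` D2) y0 -> s1 y0 = s2 y0 ->
  forall y, (D1 `&` D2) y -> s1 y = s2 y.
Proof.
move=> hX iE h1 h2 cD Dy0 s12.
apply: (lift_unique _ _ _ E (D1 `&` D2) id s1 s2 y0) => //.
- by apply: continuous_subspaceT => ?; exact: cvg_id.
- by apply: is_section_within h1; exact: subIsetl.
- by apply: is_section_within h2; exact: subIsetr.
- by move=> z [/h1[]].
- by move=> z [_ /h2[]].
Qed.

(** The value at a point of [C'] is read from a local section on [N y], where [y] is in [C] and
    [M y] contains the point. The smaller sets [M] make this independent of [y]: if [M y1] and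
    [M y2] meet, then [y1] is in [N y2], so both local sections take the value [f y1] at [y1] and
    agree on the connected intersection of [N y1] and [N y2]. *)
Lemma section_extend (X Y : topologicalType) (E : set (X * Y)) (P : set Y)
    (M N : Y -> set Y) (C C' : set Y) (f : Y -> X) :
  hausdorff_space X -> locally_injective E ->
  (forall y, P y -> [/\ open (M y), M y y, M y `<=` N y & N y y]) ->
  (forall x y, E (x, y) -> exists2 s, is_section E (N y) s & s y = x) ->
  (forall y y1 y2, P y1 -> P y2 -> M y1 y -> M y2 y -> N y2 y1) ->
  (forall y y', P y -> P y' -> connected (N y `&` N y')) ->
  (forall y, P y -> connected (C `&` N y)) ->
  C `<=` P -> C `<=` C' -> open C' ->
  (forall y', C' y' -> exists2 y, C y & M y y') ->
  is_section E C f ->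
  exists2 f', is_section E C' f' & forall y, C y -> f' y = f y.
Proof.
move=> hX iE hM hN hsym hNN hCN CP CC' oC' hC' hf.
have /choice[s hs] (y : Y) : exists s : Y -> X,
    C y -> is_section E (N y) s /\ s y = f y.
  have [Cy|nCy] := pselect (C y); last by exists f.
  by have [s ? ?] := hN _ _ (hf _ Cy).1; exists s.
have /choice[r hr] (y' : Y) : exists y, C' y' -> C y /\ M y y'.
  have [Cy|nCy] := pselect (C' y'); last by exists y'.
  by have [y ? ?] := hC' _ Cy; exists y.
have key y1 y2 y : C y1 -> C y2 -> M y1 y -> M y2 y -> s y1 y = s y2 y.
  move=> C1 C2 M1 M2; have [P1 P2] : P y1 /\ P y2 by split; exact: CP.
  have [S1 e1] := hs _ C1; have [S2 e2] := hs _ C2.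
  have N21 : N y2 y1 by exact: hsym M1 M2.
  have [_ _ sub1 N11] := hM _ P1; have [_ _ sub2 N22] := hM _ P2.
  (* Connectedness of the intersection of [C] and [N y2] carries the equality of [f] and [s y2] from
     [y2] to [y1]. *)
  have e : f y1 = s y2 y1.
    by apply: (section_unique _ _ _ _ _ _ _ y2 hX iE hf S2 (hCN _ P2)).
  apply: (section_unique _ _ _ _ _ _ _ y1 hX iE S1 S2 (hNN _ _ P1 P2)) => //.
    by rewrite e1 e.
  by split; [exact: sub1|exact: sub2].
exists (fun y => s (r y) y).
  move=> y C'y; have [Cr Mr] := hr _ C'y.
  have [oM _ sub _] := hM _ (CP _ Cr).
  have [S _] := hs _ Cr; have [Ey cy] := S _ (sub _ Mr).
  split=> //; rewrite /continuous_at.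
  apply: cvg_trans cy; apply: near_eq_cvg; near=> z.
  have C'z : C' z by near: z; exact: open_nbhs_nbhs.
  have Mz : M (r y) z by near: z; exact: open_nbhs_nbhs.
  by have [Crz Mrz] := hr _ C'z; exact: key.
move=> y Cy; have [Cr Mr] := hr _ (CC' _ Cy).
have [_ Myy _ _] := hM _ (CP _ Cy).
by rewrite (key _ y) //; have [] := hs _ Cy.
Unshelve. all: by end_near. Qed.

Lemma section_exhaust (X Y : topologicalType) (E : set (X * Y)) (P : set Y)
    (M N : Y -> set Y) (C : nat -> set Y) (x0 : X) (y0 : Y) :
  hausdorff_space X -> locally_injective E ->
  (forall y, P y -> [/\ open (M y), M y y, M y `<=` N y & N y y]) ->
  (forall x y, E (x, y) -> exists2 s, is_section E (N y) s & s y = x) ->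
  (forall y y1 y2, P y1 -> P y2 -> M y1 y -> M y2 y -> N y2 y1) ->
  (forall y y', P y -> P y' -> connected (N y `&` N y')) ->
  (forall n y, P y -> connected (C n `&` N y)) ->
  (forall n, C n `<=` P) -> (forall n, C n `<=` C n.+1) ->
  (forall n, open (C n)) ->
  (forall n y', C n.+1 y' -> exists2 y, C n y & M y y') ->
  E (x0, y0) -> C 0 y0 -> C 0 `<=` N y0 -> (P `<=` \bigcup_n C n) ->
  exists2 f, is_section E P f & f y0 = x0.
Proof.
move=> hX iE hM hN hsym hNN hCN CP CC oC hC E0 C00 C0N PC.
have [s0 S0 s00] := hN _ _ E0.
(* The extension is made total, returning its argument when this is not a section, so that it can be
   iterated. *)
have /choice[G hG] (nf : nat * (Y -> X)) : exists f' : Y -> X,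
    is_section E (C nf.1) nf.2 ->
    is_section E (C nf.1.+1) f' /\ forall y, C nf.1 y -> f' y = nf.2 y.
  case: nf => n f /=.
  have [Sf|nS] := pselect (is_section E (C n) f); last by exists f.
  have [f' ? ?] := section_extend _ _ E P M N (C n) (C n.+1) f hX iE hM hN hsym
    hNN (hCN n) (CP n) (CC n) (oC n.+1) (hC n) Sf.
  by exists f'.
pose fs := fix fs n := if n is m.+1 then G (m, fs m) else s0.
have Sfs n : is_section E (C n) (fs n).
  elim: n => [|n IH] /=; first by move=> y /C0N /S0.
  by have [] := hG (n, fs n) IH.
have fsS n y : C n y -> fs n.+1 y = fs n y.
  by move=> Cy; have [_ /(_ y Cy)] := hG (n, fs n) (Sfs n).
have fsD n k y : C n y -> fs (k + n)%N y = fs n y /\ C (k + n)%N y.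
  move=> Cy; elim: k => [//|k [IH1 IH2]]; split; last exact: CC.
  by rewrite addSn fsS.
have fsE n m y : C n y -> C m y -> fs n y = fs m y.
  move=> /(fsD n m)[<- _] /(fsD m n)[<- _]; by rewrite addnC.
have /choice[i hi] (y : Y) : exists n, P y -> C n y.
  have [Py|nP] := pselect (P y); last by exists 0%N.
  by have [n _ ?] := PC _ Py; exists n.
exists (fun y => fs (i y) y); last first.
  by rewrite (fsE _ 0%N) //; apply: hi; exact: (CP 0%N).
move=> y Py; have Cy := hi _ Py; have [Ey cy] := Sfs _ _ Cy; split=> //.
rewrite /continuous_at; apply: cvg_trans cy; apply: near_eq_cvg; near=> z.
have Cz : C (i y) z by near: z; exact: open_nbhs_nbhs.
by rewrite (fsE _ (i y)) //; apply: hi; exact: CP Cz.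
Unshelve. all: by end_near. Qed.

Lemma convex_connected (R : realType) (V : normedModType R) (D : set V) :
  (forall x y t, D x -> D y -> 0 <= t <= 1 -> D (x + t *: (y - x))) ->
  connected D.
Proof.
move=> cD; have [->|/set0P[z Dz]] := eqVneq D set0; first exact: connected0.
have -> : D = \bigcup_(y in D) ((fun t : R => z + t *: (y - z)) @` `[0, 1]).
  apply/seteqP; split=> [y Dy|y [w Dw [t]]].
    exists y => //; exists 1; first by rewrite /= in_itv /= ler01 lexx.
    by rewrite scale1r addrC subrK.
  by rewrite /= in_itv /= => t01 <-; exact: cD.
apply: bigcup_connected.
  exists z => y Dy; exists 0; first by rewrite /= in_itv /= lexx ler01.
  by rewrite scale0r addr0.
move=> y Dy; apply: connected_continuous_connected; first exact: segment_connected.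
apply: continuous_subspaceT => t.
by apply: cvgD; [exact: cvg_cst|apply: cvgZr_tmp; exact: cvg_id].
Qed.

(** * Lifting paths to a covering space *)

Lemma ball_convex (R : realType) (V : normedModType R) (c x y : V) (e t : R) :
  ball c e x -> ball c e y -> 0 <= t <= 1 -> ball c e (x + t *: (y - x)).
Proof.
rewrite -!ball_normE /= => xe ye /andP[t0 t1].
have -> : c - (x + t *: (y - x)) = (1 - t) *: (c - x) + t *: (c - y).
  rewrite scalerBl scale1r -addrA [- _ + _]addrC -scalerBr.
  have -> : c - y - (c - x) = - (y - x) by rewrite opprB addrC subrKA opprB.
  by rewrite scalerN opprD addrA.
apply: (le_lt_trans (ler_normD _ _)); rewrite !normrZ !ger0_norm ?subr_ge0//.
have [->|t_neq0] := eqVneq t 0; first by rewrite subr0 mul1r mul0r addr0.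
have tp : 0 < t by rewrite lt_neqAle eq_sym t_neq0.
have : t * `|c - y| < t * e by rewrite ltr_pM2l.
have : (1 - t) * `|c - x| <= (1 - t) * e by rewrite ler_wpM2l ?subr_ge0// ltW.
lra.
Qed.

Lemma ball_connected (R : realType) (V : normedModType R) (c : V) (e : R) :
  connected (ball c e).
Proof. by apply: convex_connected => x y t; exact: ball_convex. Qed.

Lemma ballI_connected (R : realType) (V : normedModType R) (c d : V) (e f : R) :
  connected (ball c e `&` ball d f).
Proof.
apply: convex_connected => x y t [? ?] [? ?] ?.
by split; exact: ball_convex.
Qed.

Definition graph_of {X Y : Type} (p : X -> Y) : set (X * Y) :=
  [set z | p z.1 = z.2].

Lemma covering_locally_injective (X S : topologicalType) (p : X -> S) :
  covering_map p -> locally_injective (graph_of p).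
Proof.
move=> [pc _ cov] x y; rewrite /graph_of /= => <-.
have [U [sheets [[oU Us] _ pU hV]]] := cov (p x).
have : (p @^-1` U) x by [].
rewrite pU => -[V sV Vx]; have [oV [sec [_ _ secK]]] := hV _ sV.
exists V, setT; split; first exact: open_nbhs_nbhs.
  exact: filterT.
move=> y' _ x1 x2 V1 V2; rewrite /graph_of /= => e1 e2.
by rewrite -(secK _ V1) -(secK _ V2) e1 e2.
Qed.

Lemma covering_hausdorff (X S : topologicalType) (p : X -> S) :
  covering_map p -> hausdorff_space S -> hausdorff_space X.
Proof.
move=> [pc _ cov]; rewrite !open_hausdorff => hS x y xy.
have [pxy|pxy] := eqVneq (p x) (p y).
  have [U [sheets [[oU Us] tI pU hV]]] := cov (p x).
  have : (p @^-1` U) x by [].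
  have : (p @^-1` U) y by rewrite /preimage /= -pxy.
  rewrite pU => -[W sW Wy] [V sV Vx].
  have [oV [sec [_ _ secK]]] := hV _ sV; have [oW _] := hV _ sW.
  exists (V, W); rewrite ?in_setE; split => //=; apply/eqP.
  have [//|/set0P ne] := eqVneq (V `&` W) set0.
  have VW := tI _ _ sV sW ne; rewrite -VW in Wy.
  by case/eqP: xy; rewrite -(secK _ Vx) -(secK _ Wy) pxy.
have [[A B]] := hS _ _ pxy; rewrite !in_setE /= => -[Ax By] [oA oB AB].
exists (p @^-1` A, p @^-1` B); first by rewrite /= !in_setE.
split=> /=; [by apply: open_comp => // ? _; exact: pc..|].
apply/eqP; rewrite -subset0 => z [Az Bz].
by have : (A `&` B) (p z) by []; rewrite AB.
Qed.

(** Composing with this retraction onto [[0, 1]] turns a path into a continuous function on the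
    whole line. *)
Definition clamp {R : realType} (t : R) : R := Num.max 0 (Num.min 1 t).

Lemma clamp_itv (R : realType) (t : R) : 0 <= clamp t <= 1.
Proof. by rewrite /clamp le_max lexx ge_max ler01 ge_min lexx. Qed.

Lemma clamp_id (R : realType) (t : R) : 0 <= t <= 1 -> clamp t = t.
Proof. by move=> /andP[t0 t1]; rewrite /clamp min_r// max_r. Qed.

Lemma clamp_lip (R : realType) (s t : R) : `|clamp s - clamp t| <= `|s - t|.
Proof.
have h1 := ler_norm (s - t); have := ler_norm (t - s).
rewrite distrC /clamp !maxEle !minEle => h2.
case: (leP 1 s) => ?; case: (leP 1 t) => ? /=; rewrite ?ler01 /=;
  case: (leP 0 s) => ?; case: (leP 0 t) => ? /=;
  rewrite ler_norml; apply/andP; split; lra.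
Qed.

Lemma clamp_continuous (R : realType) : continuous (@clamp R).
Proof.
move=> t; apply/cvgrPdist_lt => e e0; near=> s.
apply: (le_lt_trans (clamp_lip _ _ _)).
by near: s; apply: cvgr_dist_lt.
Unshelve. all: by end_near. Qed.

Lemma clamp_path_continuous (R : realType) (T : topologicalType) (c : R -> T) :
  {within `[0, 1], continuous c} -> continuous (c \o clamp).
Proof.
move=> /subspace_continuousP cc t.
have ct : `[0, 1]%classic (clamp t) by rewrite /= in_itv /=; exact: clamp_itv.
move=> A /(cc _ ct) hA; have hctA := clamp_continuous _ t _ hA.
change (nbhs t ((c \o clamp) @^-1` A)); refine (@filterS _ (nbhs t) _ _ _ _ hctA) => s; apply.
by rewrite /= in_itv /=; exact: clamp_itv.
Qed.

(** A lift is a section over the line of the relation [p x = c t]. The size [e] of the intervals is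
    a Lebesgue number for the cover of [[0, 1]] by preimages of trivialised open sets; it is valid
    on the whole line because [c] factors through [clamp]. *)
Lemma path_lift (R : realType) (X S : topologicalType) (p : X -> S)
    (c : R -> S) (x : X) :
  covering_map p -> hausdorff_space X -> continuous c ->
  (forall t, c (clamp t) = c t) -> p x = c 0 ->
  exists f : R -> X, [/\ continuous f, f 0 = x & forall t, p (f t) = c t].
Proof.
move=> covp hX cc cK px.
have iE := covering_locally_injective _ _ _ covp.
pose E : set (X * R) := [set z | p z.1 = c z.2].
have iE' : locally_injective E.
  move=> x1 t; rewrite /E /= => e; have [U [V [nU nV inj]]] := iE x1 (c t) e.
  exists U, (c @^-1` V); split=> //; first exact: cc.
  by move=> t' /= Vt' x2 x3 U2 U3 e2 e3; exact: (inj (c t')).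
case: covp => pc _ cov.
pose Q (e : R) (t : R) := exists U : set S,
  (forall t', `|t - t'| < e -> U (c t')) /\
  forall x, U (p x) -> exists sec : S -> X,
    [/\ {in U, continuous sec}, forall s, U s -> p (sec s) = s, open U &
        sec (p x) = x].
have [e [e0 He]] : exists e : R, 0 < e /\ forall t, Q e t.
  have /compact_near_coveringP/near_covering_withinP cpt := @segment_compact R 0 1.
  have h : \forall e \near 0^'+, `[0, 1]%classic `<=` [set t | Q e t].
    apply: cpt => t _.
    have [U [sheets [[oU Us] tI pU hV]]] := cov (c t).
    have /nbhs_ballP[d d0 Hd] : nbhs t (c @^-1` U).
      by apply: cc; exact: open_nbhs_nbhs.
    have d20 : 0 < d / 2 by rewrite divr_gt0.
    exists (ball t (d / 2), [set e | e < d / 2]).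
      by split; [exact: nbhsx_ballx|exact: nbhs_right_lt].
    move=> [t1 e1] /= [tt1 e1d] _; exists U; split.
      move=> t' t1t'; apply: Hd; rewrite -ball_normE /= in tt1 *.
      rewrite -(subrKA t1); apply: (le_lt_trans (ler_normD _ _)); lra.
    move=> y Uy; have : (p @^-1` U) y by [].
    rewrite pU => -[V sV Vy]; have [oV [sec [csec secV secK]]] := hV _ sV.
    by exists sec; split=> // [s /secV[]|]; last exact: secK.
  have : \forall e \near (0:R)^'+, 0 < e /\ `[0, 1]%classic `<=` [set t | Q e t].
    by apply: filterI => //; exact: nbhs_right_gt.
  case/filter_ex => e [e0 He]; exists e; split=> // t.
  have /He[U [U1 U2]] : `[0, 1]%classic (clamp t).
    by rewrite /= in_itv /=; exact: clamp_itv.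
  exists U; split=> // t' tt'; rewrite -cK; apply: U1.
  exact: le_lt_trans (clamp_lip _ _ _) tt'.
pose N (t : R) := ball t e; pose M (t : R) := ball t (e / 2).
(* The increment [e / 4] is less than the radius [e / 2] of [M]: scaling a point of [C n.+1] by
   [r n / r n.+1] brings it into [C n] and moves it by less than [e / 4]. *)
pose r n : R := e / 2 + n%:R * (e / 4).
have r0 n : 0 < r n by rewrite /r ltr_wpDr ?divr_gt0// mulr_ge0// divr_ge0// ltW.
pose C n := ball (0 : R) (r n).
have [f Sf f0] : exists2 f, is_section E setT f & f 0 = x.
  have e20 : 0 < e / 2 by rewrite divr_gt0.
  apply: (section_exhaust _ _ E setT M N C x 0 hX iE').
  - move=> y _; split; [exact: ball_open|exact: ballxx| |exact: ballxx].
    by apply: le_ball; lra.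
  - move=> y t; rewrite /E /= => py.
    have [U [U1 U2]] := He t.
    have [|sec [csec secp oU secK]] := U2 y.
      by rewrite py; apply: U1; rewrite subrr normr0.
    exists (sec \o c); last by rewrite /= -py.
    move=> t'; rewrite /N -ball_normE /= => tt'; have Ut' := U1 _ tt'.
    rewrite /E /=; split; first exact: secp.
    by apply: continuous_comp; [exact: cc|apply: csec; rewrite in_setE].
  - move=> y y1 y2 _ _; rewrite /M /N -!ball_normE /= => h1 h2.
    rewrite -(subrKA y); apply: (le_lt_trans (ler_normD _ _)).
    rewrite [`|y - y1|]distrC; lra.
  - by move=> y y' _ _; exact: (@ballI_connected R R^o).
  - by move=> n y _; exact: (@ballI_connected R R^o).
  - by [].
  - by move=> n; apply: le_ball; rewrite /r -natr1; lra.
  - by move=> n; exact: ball_open.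
  - move=> n y; rewrite /C -!ball_normE /= !sub0r !normrN => yr.
    have rr : r n.+1 = r n + e / 4 by rewrite /r -natr1; lra.
    have rp : r n.+1 != 0 by rewrite gt_eqF.
    exists (y * (r n / r n.+1)).
      rewrite ?sub0r ?normrN normrM (ger0_norm (x := _ / _)); last first.
        by rewrite divr_ge0// ltW.
      rewrite mulrA ltr_pdivrMr// mulrC ltr_pM2l//.
    rewrite /M -ball_normE /=.
    have -> : y * (r n / r n.+1) - y = - (y * (e / 4 / r n.+1)).
      have -> : e / 4 = r n.+1 - r n by rewrite rr; lra.
      by field.
    rewrite normrN normrM (ger0_norm (x := _ / _)); last first.
      by rewrite divr_ge0// ?ltW// divr_gt0.
    rewrite mulrA ltr_pdivrMr//.
    have := normr_ge0 y; have := r0 n.+1; nra.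
  - exact: px.
  - exact: ballxx.
  - by apply: le_ball; rewrite /r mul0r addr0; lra.
  - move=> t _.
    have [n hn] : exists n : nat, `|t| / (e / 4) < n%:R.
      exists (Num.truncn (`|t| / (e / 4))).+1.
      by rewrite truncnS_gt.
    exists n => //; rewrite /C -ball_normE /= sub0r normrN /r.
    by rewrite ltr_pdivrMr in hn; lra.
by exists f; split=> // [t|t]; have [] := Sf t I.
Qed.

(** * Charts and deck transformations *)

Lemma chart_ball (R : realType) (T : topologicalType) (phi : chart R T)
    (x : T) (W : set T) :
  chart_dom phi x -> nbhs x W ->
  exists2 r : R, 0 < r & forall y, ball (chart_map phi x) r y ->
    chart_img phi y /\ W (chart_inv phi y).
Proof.
move=> dx nW.
have ix : chart_img phi (chart_map phi x) by exists x.
have ci := chart_inv_cts (c := phi).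
have : \forall y \near chart_map phi x, chart_img phi y /\ W (chart_inv phi y).
  near=> y; split; near: y.
    by apply: open_nbhs_nbhs; split => //; exact: chart_img_open.
  apply: ci; first by rewrite in_setE.
  by rewrite (chart_mapK (c := phi)) ?in_setE.
by move=> /nbhs_ballP[r r0 h]; exists r => // y; exact: h.
Unshelve. all: by end_near. Qed.

Lemma chart_inv_nbhs (R : realType) (T : topologicalType) (phi : chart R T)
    (x : T) (B : set 'rV[R]_2) :
  chart_dom phi x -> nbhs (chart_map phi x) B ->
  nbhs x (chart_inv phi @` B).
Proof.
move=> dx nB; near=> z.
have dz : chart_dom phi z.
  by near: z; apply: open_nbhs_nbhs; split => //; exact: chart_dom_open.
exists (chart_map phi z); last by rewrite (chart_mapK (c := phi)) ?in_setE.
by near: z; apply: (chart_map_cts (c := phi)); rewrite ?in_setE.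
Unshelve. all: by end_near. Qed.

Lemma chart_inv_within (R : realType) (T : topologicalType) (phi : chart R T)
    (B : set 'rV[R]_2) :
  B `<=` chart_img phi -> {within B, continuous (chart_inv phi)}.
Proof.
move=> Bi; apply: continuous_in_subspaceT => y; rewrite in_setE => /Bi iy.
by apply: (chart_inv_cts (c := phi)); rewrite in_setE.
Qed.

Lemma chart_connected_nbhs (R : realType) (T : topologicalType)
    (phi : chart R T) (x : T) (W : set T) :
  chart_dom phi x -> nbhs x W ->
  exists U, [/\ nbhs x U, connected U & U `<=` W].
Proof.
move=> dx nW; have [r r0 hr] := chart_ball _ _ _ _ _ dx nW.
exists (chart_inv phi @` ball (chart_map phi x) r); split.
- by apply: chart_inv_nbhs => //; exact: nbhsx_ballx.
- apply: connected_continuous_connected; first exact: ball_connected.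
  by apply: chart_inv_within => y /hr[].
- by move=> _ [y /hr[_ ?] <-].
Qed.

Lemma chart_compact_nbhs (R : realType) (T : topologicalType)
    (phi : chart R T) (x : T) :
  chart_dom phi x -> exists U, nbhs x U /\ compact U.
Proof.
move=> dx; have [r r0 hr] := chart_ball _ _ _ _ _ dx filterT.
pose B := closed_ball (chart_map phi x) (r / 2).
have r20 : 0 < r / 2 by rewrite divr_gt0.
have Bb : B `<=` ball (chart_map phi x) r.
  by apply: closed_ball_subset => //; lra.
exists (chart_inv phi @` B); split.
  by apply: chart_inv_nbhs => //; apply: filterS (nbhsx_ballx _ _ r20); exact: subset_closed_ball.
apply: continuous_compact; first by apply: chart_inv_within => y /Bb/hr[].
apply: bounded_closed_compact; last exact: closed_ball_closed.
exists (`|chart_map phi x| + r); split; first exact: num_real.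
move=> M hM y /Bb; rewrite -ball_normE /= => yr.
apply: le_trans (ltW hM); rewrite -[y](subrK (chart_map phi x)).
rewrite addrC; apply: (le_trans (ler_normD _ _)).
by rewrite lerD2l distrC ltW.
Qed.

(** A chart of [S] at [p x] is restricted to the sheet through [x], where [sec] is a continuous
    inverse of [p]. *)
Lemma lifted_chart_at (R : realType) (X S : topologicalType) (p : X -> S)
    (A : set (chart R S)) (x : X) :
  covering_map p -> oriented_atlas A ->
  exists2 phi, lifted_atlas p A phi & chart_dom phi x.
Proof.
move=> [pc _ cov] [atl _].
have [c Ac cx] := atl (p x).
have [U [sheets [[oU Ux] _ pU hV]]] := cov (p x).
have : (p @^-1` U) x by [].
rewrite pU => -[V sV Vx]; have [oV [sec [csec secV secK]]] := hV _ sV.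
have VU y : V y -> U (p y).
  by move=> Vy; suff : (p @^-1` U) y by []; rewrite pU; exists V.
pose D : set X := V `&` p @^-1` chart_dom c.
pose f := chart_map c \o p; pose g := sec \o chart_inv c.
have imE : f @` D = chart_img c `&` (chart_inv c @^-1` U).
  apply/seteqP; split=> [_ [y [Vy dy] <-]|_ [[s ds <-] /= Us]].
    split; first by exists (p y).
    by rewrite /= (chart_mapK (c := c)) ?in_setE//; exact: VU.
  rewrite (chart_mapK (c := c)) ?in_setE// in Us.
  have [Vs ps] := secV _ Us; exists (sec s); last by rewrite /f /= ps.
  by split=> //; rewrite /preimage /= ps.
have oD : open D.
  apply: openI => //; apply: open_comp => [? _|]; first exact: pc.
  exact: chart_dom_open.
have oI : open (f @` D).
  rewrite imE openE => y [iy Uy]; rewrite /interior.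
  near=> z; split; near: z.
    by apply: open_nbhs_nbhs; split => //; exact: chart_img_open.
  apply: (chart_inv_cts (c := c)); first by rewrite in_setE.
  exact: open_nbhs_nbhs.
have fK : {in D, cancel f g}.
  move=> y; rewrite in_setE => -[Vy dy].
  by rewrite /f /g /= (chart_mapK (c := c)) ?in_setE// secK.
have fc : {in D, continuous f}.
  move=> y; rewrite in_setE => -[Vy dy]; apply: continuous_comp; first exact: pc.
  by apply: (chart_map_cts (c := c)); rewrite in_setE.
have gc : {in f @` D, continuous g}.
  move=> y; rewrite imE in_setE => -[iy Uy]; apply: continuous_comp.
    by apply: (chart_inv_cts (c := c)); rewrite in_setE.
  by apply: csec; rewrite in_setE.
exists (Chart oD oI fK fc gc) => //.
by exists c => // y [].
Unshelve. all: by end_near. Qed.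

Lemma clampB (R : realType) (t : R) : clamp (1 - t) = 1 - clamp t.
Proof.
rewrite /clamp !maxEle !minEle.
case: (leP 1 t) => ? /=; rewrite ?ler01 /=;
  case: (leP 1 (1 - t)) => ? /=; rewrite ?ler01 /=;
  case: (leP 0 t) => ? /=; case: (leP 0 (1 - t)) => ? /=; lra.
Qed.

Lemma path_clamp (R : realType) (T : topologicalType) (x y : T) (c : R -> T) :
  is_path x y c -> [/\ continuous (c \o clamp), (c \o clamp) 0 = x &
    (c \o clamp) 1 = y].
Proof.
move=> [cc c0 c1]; split; first exact: clamp_path_continuous.
  by rewrite /= clamp_id // lexx ler01.
by rewrite /= clamp_id // lexx ler01.
Qed.

Lemma simply_connected_connected (R : realType) (X : topologicalType) :
  simply_connected R X -> connected [set: X].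
Proof.
move=> [pc _]; have [x0|nX] := pselect (exists x : X, True); last first.
  suff -> : [set: X] = set0 by exact: connected0.
  by apply/seteqP; split=> // x _; apply: nX; exists x.
case: x0 => x0 _.
have /choice[c hc] (y : X) : exists c : R -> X, is_path x0 y c by exact: pc.
have -> : [set: X] = \bigcup_(y in [set: X]) (c y @` `[0, 1]).
  apply/seteqP; split=> // y _; exists y => //; have [_ _ e] := hc y.
  by exists 1 => //; rewrite /= in_itv /= lexx ler01.
apply: bigcup_connected.
  exists x0 => y _; have [_ e _] := hc y.
  by exists 0 => //; rewrite /= in_itv /= lexx ler01.
move=> y _; have [cy _ _] := hc y.
by apply: connected_continuous_connected => //; exact: segment_connected.
Qed.

Lemma setT_connected (R : realType) : connected [set: R].
Proof. by apply: (@convex_connected R R^o). Qed.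

(** [gamma] is the class of a loop whose lift from [x0] ends at [act gamma x0 = x0]. This lift is a
    loop in a simply connected space; projecting its contraction shows that [gamma] is the class of
    the constant loop, which is idempotent and hence trivial. *)
Lemma deck_free_base (R : realType) (X S : topologicalType) (p : X -> S)
    (x0 : X) (Gamma : groupType) (cls : (R -> S) -> Gamma)
    (act : Gamma -> X -> X) (gamma : Gamma) :
  hausdorff_space S -> universal_cover R p -> is_fundamental_group (p x0) cls ->
  deck_action p x0 cls act -> act gamma x0 = x0 -> gamma = 1%g.
Proof.
move=> hS [covp [_ sc]] [surj clsE clsM] [_ _ _ _ lift] fix0.
have pc : continuous p by case: covp.
have [c pathc cg] := surj gamma; rewrite -cg in fix0 *.
have [cc c0 c1] := path_clamp _ _ _ _ _ pathc.
have [f [fc f0 pf]] : exists f : R -> X,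
    [/\ continuous f, f 0 = x0 & forall t, p (f t) = (c \o clamp) t].
  apply: path_lift => //; first exact: (covering_hausdorff _ _ _ covp hS).
  by move=> t /=; rewrite clamp_id ?clamp_itv.
have pathf : is_path x0 (f 1) f.
  by split=> //; exact: continuous_subspaceT.
have pf1 : p (f 1) = p x0 by rewrite pf.
have pathpf : is_path (p x0) (p x0) (p \o f).
  split; [|by rewrite /= f0|by rewrite /= pf1].
  apply: continuous_subspaceT => t; apply: continuous_comp; first exact: fc.
  exact: pc.
have clspf : cls (p \o f) = cls c.
  apply/clsE => //; exists (fun z => (c \o clamp) z.2); split.
  - apply: continuous_subspaceT => z.
    by apply: (@continuous_comp _ _ _ snd (c \o clamp)); [exact: cvg_snd|exact: cc].
  - by move=> t t01; rewrite /= pf /= clamp_id.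
  - by move=> s _; rewrite c0 c1.
have f1 : f 1 = x0.
  by rewrite -(lift _ _ pathf pf1) clspf.
have [F [Fc F1 F2]] : path_homotopic x0 x0 f (fun=> x0).
  by apply: sc; rewrite -[X in is_path _ X]f1.
have pathk : is_path (p x0) (p x0) (fun _ : R => p x0).
  by split=> //; apply: continuous_subspaceT => ?; exact: cvg_cst.
have -> : cls c = cls (fun=> p x0).
  rewrite -clspf; apply/clsE => //; exists (p \o F); split.
  - move/subspace_continuousP : Fc => Fc; apply/subspace_continuousP => z Az.
    by apply: (cvg_comp _ _ (Fc z Az)); exact: pc.
  - by move=> t /F1[/= -> ->].
  - by move=> s /F2[/= -> ->].
have e := clsM _ _ pathk pathk.
have kk : path_concat (fun=> p x0) (fun=> p x0) = (fun=> p x0) :> (R -> S).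
  by apply/funext => t; rewrite /path_concat; case: ifP.
by apply: (mulgI (cls (fun=> p x0))); rewrite mulg1 -e kk.
Qed.

(** [deck_action] locates only the orbit of [x0]. A path from [x0] to [x] is projected, reversed and
    lifted from [x']; the end of this lift lies over [p x0], so it is [act gamma x0] for some
    [gamma]. The translate by [gamma] of the first path and the reverse of the lift are then lifts
    of one path with the same origin, and they end at [act gamma x] and [x']. *)
Lemma deck_transitive (R : realType) (X S : topologicalType) (p : X -> S)
    (x0 : X) (Gamma : groupType) (cls : (R -> S) -> Gamma)
    (act : Gamma -> X -> X) (x x' : X) :
  hausdorff_space S -> universal_cover R p ->
  deck_action p x0 cls act -> p x = p x' -> exists gamma, act gamma x = x'.
Proof.
move=> hS [covp [pathX _]] [_ _ actc pact lift] pxx'.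
have hX := covering_hausdorff _ _ _ covp hS.
have pc : continuous p by case: covp.
have [c pathc] := pathX x0 x.
have [cc c0 c1] := path_clamp _ _ _ _ _ pathc.
set cl := c \o clamp in cc c0 c1.
pose d : R -> S := fun t => p (cl (1 - t)).
have rc : continuous (fun t : R => 1 - t).
  by move=> t; apply: cvgB; [exact: cvg_cst|exact: cvg_id].
have [f [fc f0 pf]] : exists f : R -> X,
    [/\ continuous f, f 0 = x' & forall t, p (f t) = d t].
  apply: path_lift => //.
  - move=> t; apply: (@continuous_comp _ _ _ (fun t : R => 1 - t) (p \o cl)).
      exact: rc.
    by apply: continuous_comp; [exact: cc|exact: pc].
  - by move=> t; rewrite /d /cl /= !clampB clamp_id // clamp_itv.
  - by rewrite /d subr0 c1.
have [e pathe] := pathX x0 (f 1).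
have pf1 : p (f 1) = p x0 by rewrite pf /d subrr c0.
pose gamma := cls (p \o e); have gx0 : act gamma x0 = f 1 by exact: lift.
exists gamma; rewrite -c1 -f0 -[X in f X](subrr 1).
have iE := covering_locally_injective _ _ _ covp.
apply: (lift_unique _ _ _ _ [set: R] (p \o cl) (act gamma \o cl)
  (fun t => f (1 - t)) 0 hX iE) => //.
- exact: setT_connected.
- apply: continuous_subspaceT => t; apply: continuous_comp; first exact: cc.
  exact: pc.
- apply: continuous_subspaceT => t; apply: continuous_comp; first exact: cc.
  exact: actc.
- apply: continuous_subspaceT => t.
  by apply: (@continuous_comp _ _ _ (fun t : R => 1 - t) f);
    [exact: rc|exact: fc].
- by move=> t _; rewrite /graph_of /= pact.
- by move=> t _; rewrite /graph_of /= pf /d subKr.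
- by rewrite /= c0 subr0.
Qed.

(** [act gamma] and the identity both lift [p] and agree at [x], hence also at [x0]. *)
Lemma deck_free (R : realType) (X S : topologicalType) (p : X -> S)
    (x0 : X) (Gamma : groupType) (cls : (R -> S) -> Gamma)
    (act : Gamma -> X -> X) (gamma : Gamma) (x : X) :
  hausdorff_space S -> universal_cover R p -> is_fundamental_group (p x0) cls ->
  deck_action p x0 cls act -> act gamma x = x -> gamma = 1%g.
Proof.
move=> hS hp hG hact fix_x; have [covp sc] := hp.
have hX := covering_hausdorff _ _ _ covp hS.
have pc : continuous p by case: covp.
have iE := covering_locally_injective _ _ _ covp.
have [act1 actM actc pact _] := hact.
apply: (deck_free_base _ _ _ _ _ _ _ _ _ hS hp hG hact).
apply: (lift_unique _ _ _ _ [set: X] p (act gamma) id x hX iE) => //.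
- exact: simply_connected_connected sc.
- exact: continuous_subspaceT.
- by apply: continuous_subspaceT; exact: actc.
- by apply: continuous_subspaceT => ?; exact: cvg_id.
- by move=> z _; rewrite /graph_of /= pact.
Qed.

(** Over distinct points of [S], disjoint neighbourhoods leave no [gamma] at all. Otherwise take the
    sheet [V] of [y'] and a connected [U] around [y] over the same trivialised set: any [gamma] that
    moves a point of [U] into [V] coincides on [U] with [sec \o p]. Two such elements agree at [y],
    and freeness makes them equal. *)
Lemma deck_separated (R : realType) (X S : topologicalType) (p : X -> S)
    (A : set (chart R S))
    (x0 : X) (Gamma : groupType) (cls : (R -> S) -> Gamma)
    (act : Gamma -> X -> X) (y y' : X) :
  hausdorff_space S -> oriented_atlas A ->
  universal_cover R p -> is_fundamental_group (p x0) cls ->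
  deck_action p x0 cls act ->
  exists U U', [/\ nbhs y U, nbhs y' U' &
    forall gamma delta z w, U z -> U w -> U' (act gamma z) ->
      U' (act delta w) -> gamma = delta].
Proof.
move=> hS hA hp hG hact; have [covp sc] := hp.
have hX := covering_hausdorff _ _ _ covp hS.
have pc : continuous p by case: covp.
have iE := covering_locally_injective _ _ _ covp.
have [act1 actM actc pact _] := hact.
have [pyy|pyy] := eqVneq (p y) (p y'); last first.
  move: (hS); rewrite open_hausdorff => /(_ _ _ pyy)[[U U']].
  rewrite !in_setE /= => -[Uy Uy'] [oU oU' UU'].
  exists (p @^-1` U), (p @^-1` U'); split.
  - by apply: pc; exact: open_nbhs_nbhs.
  - by apply: pc; exact: open_nbhs_nbhs.
  - move=> g d z w Uz _; rewrite /preimage /= pact => U'z _.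
    by have : (U `&` U') (p z) by []; rewrite UU'.
have [_ _ cov] := covp.
have [T [sheets [[oT Ty'] _ pT hV]]] := cov (p y').
have : (p @^-1` T) y' by [].
rewrite pT => -[V sV Vy]; have [oV [sec [csec secV secK]]] := hV _ sV.
have [phi _ dphi] := lifted_chart_at _ _ _ _ _ y covp hA.
have [|U [nU cU UT]] := chart_connected_nbhs _ _ phi y (p @^-1` T) dphi.
  by apply: pc; rewrite pyy; exact: open_nbhs_nbhs.
exists U, V; split=> //; first exact: open_nbhs_nbhs.
have key g z : U z -> V (act g z) -> act g y = sec (p y).
  move=> Uz Vgz.
  apply: (lift_unique _ _ _ _ U p (act g) (sec \o p) z hX iE) => //.
  - exact: continuous_subspaceT.
  - by apply: continuous_subspaceT; exact: actc.
  - apply: continuous_in_subspaceT => u; rewrite in_setE => /UT Tu.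
    by apply: continuous_comp; [exact: pc|apply: csec; rewrite in_setE].
  - by move=> u _; rewrite /graph_of /= pact.
  - by move=> u /UT Tu; rewrite /graph_of /=; have [] := secV _ Tu.
  - by rewrite /= -(pact g) secK.
  - exact: nbhs_singleton.
move=> g d z w Uz Uw Vz Vw.
have e : act g y = act d y by rewrite (key g z) // (key d w).
apply: (mulgI d^-1%g); rewrite mulVg.
apply: (deck_free _ _ _ _ _ _ _ _ _ y hS hp hG hact).
by rewrite actM e -actM mulVg act1.
Qed.

Lemma deck_proper (R : realType) (X S : topologicalType) (p : X -> S)
    (A : set (chart R S))
    (x0 : X) (Gamma : groupType) (cls : (R -> S) -> Gamma)
    (act : Gamma -> X -> X) (K : set X) :
  hausdorff_space S -> oriented_atlas A ->
  universal_cover R p -> is_fundamental_group (p x0) cls ->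
  deck_action p x0 cls act -> compact K ->
  exists F : seq Gamma, forall gamma x, K x -> K (act gamma x) -> gamma \in F.
Proof.
move=> hS hA hp hG hact cK.
have [act1 actM actc pact _] := hact.
have /compact_near_coveringP cKK := compact_setX cK cK.
(* A property of lists holds near [Fl] when it holds for all lists containing a fixed one; this
   filter takes the place of the extraction of a finite subcover. *)
pose Fl : set_system (seq Gamma) :=
  filter_from setT (fun B0 : seq Gamma => [set B : seq Gamma | {subset B0 <= B}]).
have FF : Filter Fl.
  apply: filter_from_filter; first by exists [::].
  move=> B0 B1 _ _; exists (B0 ++ B1) => // B sB.
  by split=> g gB; apply: sB; rewrite mem_cat gB ?orbT.
pose P (B : seq Gamma) (z : X * X) := forall g, act g z.1 = z.2 -> g \in B.
have [B0 _ hB] : \near Fl, (K `*` K) `<=` P Fl.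
  apply: cKK => -[y y'] _.
  have [U [U' [nU nU' sep]]] :=
    deck_separated _ _ _ _ _ _ _ _ _ y y' hS hA hp hG hact.
  have [[g [z Uz U'gz]]|ne] :=
      pselect (exists g, exists2 z, U z & U' (act g z)).
    exists (U `*` U', [set B : seq Gamma | {subset [:: g] <= B}]).
      by split; [exists (U, U')|exists [:: g]].
    move=> [[w w'] B] /= [[Uw U'w'] sB] d /= dw; apply: sB.
    rewrite inE; apply/eqP; apply: (sep d g w z) => //.
    by rewrite dw.
  exists (U `*` U', [set B : seq Gamma | {subset [::] <= B}]).
    by split; [exists (U, U')|exists [::]].
  move=> [[w w'] B] /= [[Uw U'w'] _] d /= dw; exfalso; apply: ne.
  by exists d, w => //; rewrite dw.
by exists B0 => g x Kx Kgx; apply: (hB B0 _ (x, act g x)).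
Qed.

Lemma covering_near (X S : topologicalType) (p : X -> S) (x : X) (W : set X) :
  covering_map p -> nbhs x W ->
  \forall s \near p x, exists2 x', p x' = s & W x'.
Proof.
move=> [pc _ cov] nW.
have [T [sheets [[oT Tx] _ pT hV]]] := cov (p x).
have : (p @^-1` T) x by [].
rewrite pT => -[V sV Vx]; have [oV [sec [csec secV secK]]] := hV _ sV.
near=> s; have Ts : T s by near: s; exact: open_nbhs_nbhs.
exists (sec s); first by have [] := secV _ Ts.
near: s; apply: csec; rewrite ?in_setE // secK //.
Unshelve. all: by end_near. Qed.

Lemma compact_lift (R : realType) (X S : topologicalType) (p : X -> S)
    (A : set (chart R S)) (x0 : X) :
  compact [set: S] -> oriented_atlas A -> covering_map p ->
  exists K : set X, [/\ compact K, K x0 &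
    forall s, exists2 x, p x = s & nbhs x K].
Proof.
move=> /compact_near_coveringP cS hA covp.
(* The same device, with the sets that contain a fixed compact set. *)
pose Fl : set_system (set X) :=
  filter_from compact (fun K0 : set X => [set K : set X | K0 `<=` K]).
have FF : Filter Fl.
  apply: filter_from_filter; first by exists set0; exact: compact0.
  move=> K0 K1 c0 c1; exists (K0 `|` K1); first exact: compactU.
  by move=> K sK; split=> x Kx; apply: sK; [left|right].
pose P (K : set X) (s : S) := exists2 x, p x = s & nbhs x K.
have [K0 cK0 hK] : \near Fl, [set: S] `<=` P Fl.
  apply: cS => s _; have [_ surj _] := covp.
  have [x _ px] : (p @` setT) s by rewrite surj.
  have [phi _ dphi] := lifted_chart_at _ _ _ _ _ x covp hA.
  have [U [nU cU]] := chart_compact_nbhs _ _ phi x dphi.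
  have near_s := covering_near _ _ _ _ _ covp (nbhs_interior nU).
  rewrite px in near_s.
  exists ([set s | exists2 x', p x' = s & U^° x'], [set K : set X | U `<=` K]).
    by split=> //; exists U.
  move=> [s' K] /= [[x' px' Ux'] UK]; exists x' => //.
  exact: filterS Ux'.
exists (K0 `|` [set x0]); split.
- by apply: compactU => //; exact: compact_set1.
- by right.
- by move=> s; apply: hK => //; exact: subsetUl.
Qed.

(** The combinatorial part of the Schwarz-Milnor argument. If [g] brings both [c m] and [c m.+1]
    into [K], and [beta] brings [c m.+1] into [K], then [beta * g^-1] is in [F], so each step costs
    one letter; one more letter is spent at [x0]. *)
Lemma chain_word (X : Type) (Gamma : groupType) (act : Gamma -> X -> X)
    (K : set X) (F : seq Gamma) (x0 : X) (c : nat -> X) (m : nat)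
    (beta : Gamma) :
  (forall x, act 1%g x = x) ->
  (forall g d x, act (g * d)%g x = act g (act d x)) ->
  (forall g x, K x -> K (act g x) -> g \in F) ->
  K x0 -> c 0 = x0 ->
  (forall i, exists g, K (act g (c i)) /\ K (act g (c i.+1))) ->
  K (act beta (c m)) ->
  exists2 w, words F (beta^-1)%g w & (size w <= m.+1)%N.
Proof.
move=> act1 actM hF K0 c0 hc.
elim: m beta => [|m IH] beta Kb.
  exists [:: (beta^-1)%g] => //; split; last by rewrite big_seq1.
  move=> a; rewrite inE => /eqP ->; right; rewrite invgK.
  by rewrite c0 in Kb; exact: hF Kb.
have [g [Kg Kg1]] := hc m; have [w [wF wg] sw] := IH _ Kg.
exists (rcons w (g * beta^-1)%g); last by rewrite size_rcons.
split; last by rewrite big_rcons /= wg mulKg.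
move=> a; rewrite mem_rcons inE => /orP[/eqP ->|/wF//]; right.
by apply: (hF _ (act g (c m.+1))) => //; rewrite -actM invMg invgK mulgKV.
Qed.

(** * Hermitian forms on C^2 in real coordinates *)

Local Open Scope complex_scope.
Local Open Scope sesquilinear_scope.

Lemma herm_entries (R : realType) (q : 'rV[R]_4) :
  [/\ herm q 0 0 = (q 0 0)%:C, herm q 0 1 = q 0 1 +i* q 0 2,
      herm q 1 0 = q 0 1 -i* q 0 2 & herm q 1 1 = (q 0 3)%:C].
Proof.
have val01 : (@rshift 1 1 0 : 'I_2) = 1 by apply/val_inj.
have val00 : (@lshift 1 1 0 : 'I_2) = 0 by apply/val_inj.
split.
- by rewrite -{1 2}val00; apply: etrans (block_mxEul _ _ _ _ _ _) _; rewrite mxE.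
- by rewrite -{1}val00 -val01; apply: etrans (block_mxEur _ _ _ _ _ _) _;
    rewrite mxE.
- by rewrite -{1}val01 -val00; apply: etrans (block_mxEdl _ _ _ _ _ _) _;
    rewrite mxE.
- by rewrite -val01; apply: etrans (block_mxEdr _ _ _ _ _ _) _; rewrite mxE.
Qed.

Lemma sum2 (V : nmodType) (f : 'I_2 -> V) : \sum_i f i = f 0 + f 1.
Proof. by rewrite !big_ord_recl big_ord0 addr0; congr (_ + f _); apply/val_inj. Qed.

Lemma matrix2P (T : Type) (M N : 'M[T]_2) :
  M 0 0 = N 0 0 -> M 0 1 = N 0 1 -> M 1 0 = N 1 0 -> M 1 1 = N 1 1 -> M = N.
Proof.
move=> e00 e01 e10 e11; apply/matrixP => i j.
have two (k : 'I_2) : k = 0 \/ k = 1.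
  by case: k => -[|[|//]] lt; [left|right]; apply/val_inj.
by have [->|->] := two i; have [->|->] := two j.
Qed.

Lemma det2 (K : comPzRingType) (M : 'M[K]_2) :
  \det M = M 0 0 * M 1 1 - M 0 1 * M 1 0.
Proof.
rewrite (expand_det_row _ 0) sum2 /cofactor !det_mx11 !mxE /= expr0 mul1r.
rewrite expr1 mulN1r mulrN.
by congr (_ * M _ _ - _ * M _ _); apply/val_inj.
Qed.

Definition trpair {R : realType} (h q : 'rV[R]_4) : R :=
  h 0 0 * q 0 0 + h 0 3 * q 0 3 + 2 * (h 0 1 * q 0 1 + h 0 2 * q 0 2).

Definition hdet {R : realType} (h : 'rV[R]_4) : R :=
  h 0 0 * h 0 3 - h 0 1 ^+ 2 - h 0 2 ^+ 2.

Definition pos_cone {R : realType} : set 'rV[R]_4 :=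
  [set h : 'rV[R]_4 | 0 < h 0 0 /\ 0 < hdet h].

Definition psd_cone {R : realType} : set 'rV[R]_4 :=
  [set h : 'rV[R]_4 | [/\ 0 <= h 0 0, 0 <= h 0 3 & 0 <= hdet h]].

Lemma trpair_tr (R : realType) (h q : 'rV[R]_4) :
  \tr (herm h *m herm q) = (trpair h q)%:C.
Proof.
rewrite /mxtrace sum2 !mxE !sum2.
have [-> -> -> ->] := herm_entries _ h; have [-> -> -> ->] := herm_entries _ q.
by rewrite /trpair; simpc; congr (_ +i* _); ring.
Qed.

Lemma hdet_det (R : realType) (h : 'rV[R]_4) : \det (herm h) = (hdet h)%:C.
Proof.
rewrite det2; have [-> -> -> ->] := herm_entries _ h.
by rewrite /hdet; simpc; congr (_ +i* _); ring.
Qed.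

(** The value of the form at the vector with coordinates [a + ib] and [c + id]. *)
Definition hval {R : realType} (q : 'rV[R]_4) (a b c d : R) : R :=
  q 0 0 * (a ^+ 2 + b ^+ 2) + q 0 3 * (c ^+ 2 + d ^+ 2) +
  2 * (q 0 1 * (a * c + b * d) + q 0 2 * (b * c - a * d)).

Lemma quad_val (R : realType) (M : 'M[R[i]]_2) (v : 'cV[R[i]]_2) :
  (v ^t* *m M *m v) 0 0 =
  ((v 0 0)^* * M 0 0 + (v 1 0)^* * M 1 0) * v 0 0 +
  ((v 0 0)^* * M 0 1 + (v 1 0)^* * M 1 1) * v 1 0.
Proof. by rewrite !mxE sum2 !mxE !sum2 !mxE. Qed.

Lemma herm_val (R : realType) (q : 'rV[R]_4) (v : 'cV[R[i]]_2) :
  (v ^t* *m herm q *m v) 0 0 =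
  (hval q (complex.Re (v 0 0)) (complex.Im (v 0 0))
          (complex.Re (v 1 0)) (complex.Im (v 1 0)))%:C.
Proof.
rewrite quad_val; have [-> -> -> ->] := herm_entries _ q.
case: (v 0 0) => a b; case: (v 1 0) => c d /=.
by rewrite /hval; simpc; congr (_ +i* _); ring.
Qed.

Definition cvec {R : realType} (x y : R[i]) : 'cV[R[i]]_2 :=
  \col_i if i == 0 then x else y.

(** Sylvester's criterion. The first basis vector gives [q 0 0], the second test vector gives
    [q 0 0 * hdet q]; conversely, [q 0 0] times the form is a sum of two squares and of [hdet q]
    times the squared modulus of the second coordinate. *)
Lemma pos_defP (R : realType) (q : 'rV[R]_4) :
  pos_def (herm q) <-> pos_cone q.
Proof.
split=> [h|[q0 dq] v v0].
  have h1 a b c d : (a, b, c, d) != (0, 0, 0, 0) -> 0 < hval q a b c d.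
    move=> nz; have := h (cvec (a +i* b) (c +i* d)).
    rewrite herm_val !mxE /= ltcR; apply; apply: contraNneq nz => /matrixP e.
    have := e 0 0; have := e 1 0; rewrite !mxE /= => -[-> ->] [-> ->].
    by rewrite eqxx.
  have q0 : 0 < q 0 0.
    have /h1 : (1, 0, 0, 0) != (0, 0, 0, 0) :> R * R * R * R.
      by rewrite !xpair_eqE oner_eq0.
    by rewrite /hval; lra.
  split=> //.
  have /h1 : (- q 0 1, - q 0 2, q 0 0, 0) != (0, 0, 0, 0) :> R * R * R * R.
    by rewrite !xpair_eqE (gt_eqF q0) !andbF.
  have -> : hval q (- q 0 1) (- q 0 2) (q 0 0) 0 = q 0 0 * hdet q.
    by rewrite /hval /hdet; ring.
  by rewrite pmulr_rgt0.
rewrite herm_val ltcR.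
have : (v 0 0 != 0) || (v 1 0 != 0).
  rewrite -negb_and; apply: contraNN v0 => /andP[/eqP e0 /eqP e1].
  apply/eqP/matrixP => i j; rewrite (ord1 j) !mxE.
  case: i => -[|[|//]] lt; [rewrite -[RHS]e0|rewrite -[RHS]e1];
    by congr (v _ _); apply/val_inj.
case: (v 0 0) => a b; case: (v 1 0) => c d; rewrite !eq_complex /= => nz.
rewrite -(pmulr_rgt0 _ q0).
have -> : q 0 0 * hval q a b c d =
  (q 0 0 * a + q 0 1 * c - q 0 2 * d) ^+ 2 +
  (q 0 0 * b + q 0 1 * d + q 0 2 * c) ^+ 2 + hdet q * (c ^+ 2 + d ^+ 2).
  by rewrite /hval /hdet; ring.
have [/eqP|cd] := eqVneq (c ^+ 2 + d ^+ 2) 0; last first.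
  apply: ltr_wpDl; first by rewrite addr_ge0 ?sqr_ge0.
  by rewrite mulr_gt0 // lt_neqAle eq_sym cd addr_ge0 ?sqr_ge0.
rewrite paddr_eq0 ?sqr_ge0// !sqrf_eq0 => /andP[/eqP c0 /eqP d0].
rewrite c0 d0 eqxx orbF in nz *.
rewrite !mulr0 !addr0 subr0 expr0n /= !addr0 mulr0 addr0 !exprMn -mulrDr.
rewrite mulr_gt0 ?exprn_gt0//.
rewrite lt_neqAle addr_ge0 ?sqr_ge0// andbT eq_sym paddr_eq0 ?sqr_ge0//.
by rewrite !sqrf_eq0.
Qed.

Lemma psd_pos_semidef (R : realType) (q : 'rV[R]_4) :
  psd_cone q -> pos_semidef (herm q).
Proof.
move=> [q0 q3 dq] v; rewrite herm_val lecR.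
case: (v 0 0) => a b; case: (v 1 0) => c d /=.
have [q00|q00] := eqVneq (q 0 0) 0.
  have /eqP : q 0 1 ^+ 2 + q 0 2 ^+ 2 = 0.
    apply/eqP; rewrite eq_le addr_ge0 ?sqr_ge0// andbT.
    by move: dq; rewrite /hdet q00; lra.
  rewrite paddr_eq0 ?sqr_ge0// !sqrf_eq0 => /andP[/eqP q1 /eqP q2].
  rewrite /hval q00 q1 q2 !mul0r addr0 mulr0 addr0 add0r.
  by rewrite mulr_ge0// addr_ge0 ?sqr_ge0.
have qp : 0 < q 0 0 by rewrite lt_neqAle eq_sym q00.
rewrite -(pmulr_rge0 _ qp).
have -> : q 0 0 * hval q a b c d =
  (q 0 0 * a + q 0 1 * c - q 0 2 * d) ^+ 2 +
  (q 0 0 * b + q 0 1 * d + q 0 2 * c) ^+ 2 + hdet q * (c ^+ 2 + d ^+ 2).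
  by rewrite /hval /hdet; ring.
apply: addr_ge0; first by apply: addr_ge0; exact: sqr_ge0.
by apply: mulr_ge0 => //; apply: addr_ge0; exact: sqr_ge0.
Qed.

(** * Coordinates of Hermitian matrices and the action of SL(2, C) on them *)

Definition unherm {R : realType} (M : 'M[R[i]]_2) : 'rV[R]_4 :=
  \row_k [:: complex.Re (M 0 0); complex.Re (M 0 1);
             complex.Im (M 0 1); complex.Re (M 1 1)]`_k.

Lemma hermK (R : realType) : cancel (@herm R) unherm.
Proof.
move=> q; apply/rowP => k; rewrite mxE.
have [-> -> _ ->] := herm_entries _ q.
by case: k => -[|[|[|[|//]]]] lt /=; congr (q _ _); apply/val_inj.
Qed.

Lemma unhermE (R : realType) (M : 'M[R[i]]_2) :
  [/\ unherm M 0 0 = complex.Re (M 0 0), unherm M 0 1 = complex.Re (M 0 1),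
      unherm M 0 2 = complex.Im (M 0 1) & unherm M 0 3 = complex.Re (M 1 1)].
Proof. by split; rewrite mxE. Qed.

Lemma unhermK (R : realType) (M : 'M[R[i]]_2) :
  M = M ^t* -> herm (unherm M) = M.
Proof.
move=> MH; have [e0 e1 e2 e3] := unhermE _ M.
have [h00 h01 h10 h11] := herm_entries _ (unherm M).
have MHij i j : M i j = (M j i)^* by rewrite {1}MH !mxE.
apply: matrix2P; rewrite ?h00 ?h01 ?h10 ?h11 ?e0 ?e1 ?e2 ?e3.
- have := MHij 0 0; case: (M 0 0) => a b [] /eqP.
  by rewrite -addr_eq0 -mulr2n mulrn_eq0 /= => /eqP ->.
- by case: (M 0 1).
- by rewrite [RHS]MHij; case: (M 0 1).
- have := MHij 1 1; case: (M 1 1) => a b [] /eqP.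
  by rewrite -addr_eq0 -mulr2n mulrn_eq0 /= => /eqP ->.
Qed.

(** Positive complex numbers are real; reality of the form at [(1, 0)], [(0, 1)], [(1, 1)] and
    [(1, i)] gives Hermitian symmetry by polarisation. *)
Lemma pos_def_hermitian (R : realType) (M : 'M[R[i]]_2) :
  pos_def M -> M = M ^t*.
Proof.
move=> pM.
have val x y : (cvec x y ^t* *m M *m cvec x y) 0 0 =
  (x^* * M 0 0 + y^* * M 1 0) * x + (x^* * M 0 1 + y^* * M 1 1) * y.
  by rewrite quad_val !mxE.
have re (x y : R[i]) : (x, y) != (0, 0) ->
    complex.Im ((x^* * M 0 0 + y^* * M 1 0) * x +
                (x^* * M 0 1 + y^* * M 1 1) * y) = 0.
  move=> nz; rewrite -val; have := pM (cvec x y).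
  rewrite ltcE => /(_ _)/andP[|/eqP //].
  apply: contraNneq nz => /matrixP e.
  by have := e 0 0; have := e 1 0; rewrite !mxE /= => -> ->.
have := re 1 0; have := re 0 1; have := re 1 1; have := re 1 'i.
rewrite !xpair_eqE oner_eq0 /= !andbF => /(_ isT) + /(_ isT) + /(_ isT) + /(_ isT).
move=> h4 h3 h2 h1.
have e00 : M 0 0 = (M 0 0)^*.
  move: h1; case: (M 0 0) => a b; case: (M 0 1) => c d; case: (M 1 0) => e f.
  case: (M 1 1) => g h /=; simpc => /= ?; congr (_ +i* _); lra.
have e11 : M 1 1 = (M 1 1)^*.
  move: h2; case: (M 0 0) => a b; case: (M 0 1) => c d; case: (M 1 0) => e f.
  case: (M 1 1) => g h /=; simpc => /= ?; congr (_ +i* _); lra.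
have e01 : M 0 1 = (M 1 0)^*.
  move: h1 h2 h3 h4; case: (M 0 0) => a b; case: (M 0 1) => c d.
  case: (M 1 0) => e f; case: (M 1 1) => g h /=; simpc => /= ? ? ? ?.
  congr (_ +i* _); lra.
apply: matrix2P; rewrite !mxE //.
by rewrite e01 conjCK.
Qed.

Lemma pos_def_cone (R : realType) (M : 'M[R[i]]_2) :
  pos_def M -> exists2 k, pos_cone k & M = herm k.
Proof.
move=> pM; have e := unhermK _ _ (pos_def_hermitian _ _ pM).
by exists (unherm M); rewrite ?e //; apply/pos_defP; rewrite e.
Qed.

Definition herm_act {R : realType} (m : 'M[R[i]]_2) (k : 'rV[R]_4) : 'rV[R]_4 :=
  unherm (H3_act m (herm k)).

Lemma herm_hermitian_eq (R : realType) (k : 'rV[R]_4) : herm k = (herm k) ^t*.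
Proof.
have : herm k \is hermsymmx by apply/herm_hermitian; exists k.
by move/is_hermitianmxP; rewrite expr0 scale1r.
Qed.

Lemma herm_actE (R : realType) (m : 'M[R[i]]_2) (k : 'rV[R]_4) :
  herm (herm_act m k) = H3_act m (herm k).
Proof.
apply: unhermK; rewrite /H3_act.
rewrite !trmx_mul !map_mxM trmxCK mulmxA.
by rewrite -herm_hermitian_eq.
Qed.

Lemma herm_linear (R : realType) (a : R) (k l : 'rV[R]_4) :
  herm (a *: k + l) = (a%:C) *: herm k + herm l.
Proof.
have [h00 h01 h10 h11] := herm_entries _ k.
have [l00 l01 l10 l11] := herm_entries _ l.
have [m00 m01 m10 m11] := herm_entries _ (a *: k + l).
have E (K : pzRingType) m n (c : K) (M N : 'M[K]_(m, n)) i j :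
  (c *: M + N) i j = c * M i j + N i j by rewrite !mxE.
apply: matrix2P; rewrite E ?h00 ?h01 ?h10 ?h11 ?l00 ?l01 ?l10 ?l11
  ?m00 ?m01 ?m10 ?m11 !E; simpc; congr (_ +i* _); ring.
Qed.

Lemma unherm_linear (R : realType) (a : R) (M N : 'M[R[i]]_2) :
  unherm ((a%:C) *: M + N) = a *: unherm M + unherm N.
Proof.
apply/rowP => k; rewrite !mxE.
case: (M 0 0) (M 0 1) (M 1 1) (N 0 0) (N 0 1) (N 1 1) => ? ? [? ?] [? ?] [? ?] [? ?] [? ?].
by case: k => -[|[|[|[|//]]]] lt /=; simpc => /=; ring.
Qed.

Lemma herm_act_linear (R : realType) (m : 'M[R[i]]_2) (a : R) (k l : 'rV[R]_4) :
  herm_act m (a *: k + l) = a *: herm_act m k + herm_act m l.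
Proof.
rewrite /herm_act /H3_act herm_linear mulmxDr mulmxDl -scalemxAr -scalemxAl.
exact: unherm_linear.
Qed.

Lemma herm_act1 (R : realType) (k : 'rV[R]_4) : herm_act 1%:M k = k.
Proof. by rewrite /herm_act /H3_act trmx1 map_mx1 mul1mx mulmx1 hermK. Qed.

Lemma herm_actM (R : realType) (m n : 'M[R[i]]_2) (k : 'rV[R]_4) :
  herm_act (m *m n) k = herm_act m (herm_act n k).
Proof.
rewrite {2}/herm_act herm_actE /herm_act /H3_act trmx_mul map_mxM.
by rewrite !mulmxA.
Qed.

Lemma herm_act_hdet (R : realType) (m : 'M[R[i]]_2) (k : 'rV[R]_4) :
  \det m = 1 -> hdet (herm_act m k) = hdet k.
Proof.
move=> dm; apply: (@complexI R).
rewrite -!hdet_det herm_actE /H3_act !det_mulmx dm mul1r.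
by rewrite det_map_mx det_tr dm rmorph1 mulr1.
Qed.

Lemma herm_act_pos (R : realType) (m : 'M[R[i]]_2) (k : 'rV[R]_4) :
  \det m = 1 -> pos_cone k -> pos_cone (herm_act m k).
Proof.
move=> dm /pos_defP pk; apply/pos_defP => v v0.
rewrite herm_actE /H3_act.
have -> : v ^t* *m (m *m herm k *m m ^t*) *m v =
    (m ^t* *m v) ^t* *m herm k *m (m ^t* *m v).
  by rewrite trmx_mul map_mxM trmxCK !mulmxA.
apply: pk; apply: contraNneq v0 => e.
have um : m ^t* \in unitmx.
  by rewrite unitmxE det_map_mx det_tr dm rmorph1 unitr1.
by rewrite -[v](mulKmx um) e mulmx0.
Qed.

Local Close Scope sesquilinear_scope.
Local Close Scope complex_scope.

(** * Strict differentiability and an implicit function theorem *)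

Lemma rv_coord_le (R : realType) n (v : 'rV[R]_n) i : `|v 0 i| <= `|v|.
Proof.
rewrite [leRHS]/Num.Def.normr /= mx_normrE.
exact: (le_bigmax _ (fun ij : 'I_1 * 'I_n => `|v ij.1 ij.2|) (0, i)).
Qed.

Lemma rv_norm_le (R : realType) n (v : 'rV[R]_n) (e : R) :
  0 <= e -> (forall i, `|v 0 i| <= e) -> `|v| <= e.
Proof.
move=> e0 h; rewrite [leLHS]/Num.Def.normr /= mx_normrE (bigmax_le _ e0) //.
by move=> [i j] _ /=; rewrite (ord1 i).
Qed.

Lemma banach_ball (R : realType) (V : completeNormedModType R) (G : V -> V)
    (y0 : V) (r : R) :
  0 < r -> (forall y, `|y0 - y| <= r -> `|y0 - G y| <= r) ->
  (forall y y', `|y0 - y| <= r -> `|y0 - y'| <= r ->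
    `|G y - G y'| <= 2^-1 * `|y - y'|) ->
  exists2 y, `|y0 - y| <= r & G y = y.
Proof.
move=> r0 hG hL; pose U := closed_ball y0 r.
have UE y : U y = (`|y0 - y| <= r) by rewrite /U closed_ballE.
have GU : set_fun U U G by move=> y; rewrite /mkset !UE; exact: hG.
pose f : {fun U >-> U} := mkfun GU.
have h0 : 0 <= (2^-1 : R) by rewrite invr_ge0.
have [||| y Uy fy] := banach_fixed_point (f := f).
- exists (NngNum h0); split=> /=; first by rewrite invf_lt1 // ltr1n.
  by move=> [y y'] /= [Uy Uy']; apply: hL; rewrite -UE.
- exact: closed_ball_closed.
- by exists y0; rewrite UE subrr normr0 ltW.
by exists y; rewrite -?UE //; exact/esym.
Qed.

Lemma derive_rV2 (R : realType) n (q : 'rV[R]_2 -> 'rV[R]_n) (z w : 'rV[R]_2) :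
  differentiable q z ->
  'D_w q z = w 0 0 *: 'D_(delta_mx 0 0) q z + w 0 1 *: 'D_(delta_mx 0 1) q z.
Proof.
move=> dq; rewrite !deriveE //.
have -> : w = w 0 0 *: delta_mx 0 0 + w 0 1 *: delta_mx 0 1.
  rewrite {1}(row_sum_delta w) !big_ord_recl big_ord0 addr0.
  by congr (_ + w _ _ *: delta_mx _ _); apply/val_inj.
by rewrite linearD !linearZ /= !mxE /= !mulr1 !mulr0 addr0 add0r.
Qed.

Lemma norm_lin2_le (R : realType) (V : normedModType R) (a b : R)
    (x x' y y' : V) :
  `|a *: x + b *: y - (a *: x' + b *: y')| <=
  `|a| * `|x - x'| + `|b| * `|y - y'|.
Proof.
rewrite opprD addrACA -!scalerBr; apply: (le_trans (ler_normD _ _)).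
by rewrite !normrZ.
Qed.

(** The mean value theorem on the segment from [y'] to [y], coordinate by coordinate since the norm
    is a supremum. On the ball each of the two partial derivatives varies by less than [e / 2]. *)
Lemma strict_differentiable (R : realType) n (q : 'rV[R]_2 -> 'rV[R]_n)
    (y0 : 'rV[R]_2) (e : R) :
  (\forall z \near y0, differentiable q z) ->
  (forall v, {for y0, continuous (fun z => 'D_v q z)}) ->
  0 < e -> exists2 r : R, 0 < r & forall y y', ball y0 r y -> ball y0 r y' ->
    `|q y - q y' - 'D_(y - y') q y0| <= e * `|y - y'|.
Proof.
move=> dq cq e0.
pose e1 := delta_mx 0 0 : 'rV[R]_2; pose e2 := delta_mx 0 1 : 'rV[R]_2.
have e20 : 0 < e / 2 by rewrite divr_gt0.
have : \forall z \near y0, [/\ differentiable q z,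
    `|'D_e1 q y0 - 'D_e1 q z| < e / 2 & `|'D_e2 q y0 - 'D_e2 q z| < e / 2].
  have /cvgrPdist_lt/(_ _ e20) c1 := cq e1.
  have /cvgrPdist_lt/(_ _ e20) c2 := cq e2.
  by apply: filterS3 dq c1 c2 => z dz h1 h2; exact: (And3 dz h1 h2).
move=> /nbhs_ballP[r r0 hr]; exists r => // y y' By By'.
set v := y - y'.
have seg (t : R) : 0 <= t <= 1 -> ball y0 r (t *: v + y').
  by move=> t01; rewrite addrC; exact: ball_convex.
have d0 : differentiable q y0 by have [] := hr _ (ballxx y0 r0).
have key z : ball y0 r z -> `|'D_v q z - 'D_v q y0| <= e * `|v|.
  move=> Bz; have [dz h1 h2] := hr _ Bz.
  rewrite (derive_rV2 _ _ _ z v dz) (derive_rV2 _ _ _ y0 v d0).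
  apply: (le_trans (norm_lin2_le _ _ _ _ _ _ _ _)).
  have v0 := rv_coord_le _ _ v 0; have v1 := rv_coord_le _ _ v 1.
  rewrite distrC in h1; rewrite distrC in h2.
  have b1 := ler_pM (normr_ge0 _) (normr_ge0 _) v0 (ltW h1).
  have b2 := ler_pM (normr_ge0 _) (normr_ge0 _) v1 (ltW h2).
  apply: (le_trans (lerD b1 b2)); rewrite -mulrDr -splitr mulrC.
  exact: lexx.
apply: rv_norm_le; first by rewrite mulr_ge0 // ltW.
move=> k.
pose g (t : R) : R := q (t *: v + y') 0 k.
have dg (t : R) : 0 <= t <= 1 -> is_derive t 1 g ('D_v q (t *: v + y') 0 k).
  move=> t01; have Bt := seg _ t01; have [dt _ _] := hr _ Bt.
  have dQ : derivable q (t *: v + y') v by exact: diff_derivable.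
  have /derivable_mxP/(_ 0 k) dk := dQ.
  have E : (fun h => h^-1 *: ((g \o shift t) (h *: 1) - g t)) =
           (fun h => h^-1 *: (((fun z => q z 0 k) \o shift (t *: v + y')) (h *: v)
               - q (t *: v + y') 0 k)).
    apply/funext => h; rewrite /g /shift /=; congr (_ *: (q _ _ _ - _)).
    by rewrite scalerDl addrA [h *: 1]mulr1.
  split; first by rewrite /derivable E.
  by rewrite [in RHS](derive_mx dQ) mxE /derive E.
have [||c /andP[c0 c1] gE] := MVT (f := g) (df := fun t => 'D_v q (t *: v + y') 0 k) (a := 0) (b := 1) ltr01.
- by move=> t /andP[t0 t1]; apply: dg; apply/andP; split; exact: ltW.
- apply: derivable_within_continuous => t t01.
  by apply: ex_derive; apply: dg; move: t01; rewrite in_itv.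
move: gE; rewrite /g scale1r scale0r add0r subr0 mulr1 subrK => gE.
rewrite !mxE gE; apply: le_trans (key (c *: v + y') _).
  by have := rv_coord_le _ _ ('D_v q (c *: v + y') - 'D_v q y0) k; rewrite !mxE.
by apply: seg; rewrite (ltW c0) (ltW c1).
Unshelve. all: by end_near. Qed.

(** Provides the complete normed module structure on row vectors on which [banach_ball] is used. *)
HB.instance Definition _ (R : realType) (m n : nat) := Complete.on 'M[R]_(m, n).

Lemma trpairDl (R : realType) (h k q : 'rV[R]_4) :
  trpair (h + k) q = trpair h q + trpair k q.
Proof. by rewrite /trpair !mxE; ring. Qed.

Lemma trpairBl (R : realType) (h k q : 'rV[R]_4) :
  trpair (h - k) q = trpair h q - trpair k q.
Proof. by rewrite /trpair !mxE; ring. Qed.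

Lemma trpairDr (R : realType) (h k q : 'rV[R]_4) :
  trpair q (h + k) = trpair q h + trpair q k.
Proof. by rewrite /trpair !mxE; ring. Qed.

Lemma trpairBr (R : realType) (h k q : 'rV[R]_4) :
  trpair q (h - k) = trpair q h - trpair q k.
Proof. by rewrite /trpair !mxE; ring. Qed.

Lemma trpairZl (R : realType) (a : R) (h q : 'rV[R]_4) :
  trpair (a *: h) q = a * trpair h q.
Proof. by rewrite /trpair !mxE; ring. Qed.

Lemma trpairZr (R : realType) (a : R) (h q : 'rV[R]_4) :
  trpair q (a *: h) = a * trpair q h.
Proof. by rewrite /trpair !mxE; ring. Qed.

(** Two diagonal terms and twice two off-diagonal ones: this [6] is the source of the constants [12]
    and [24] in [implicit_solution]. *)
Lemma trpair_le (R : realType) (h q : 'rV[R]_4) :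
  `|trpair h q| <= 6 * `|h| * `|q|.
Proof.
have b i : `|h 0 i * q 0 i| <= `|h| * `|q|.
  by rewrite normrM ler_pM // rv_coord_le.
rewrite /trpair; have := b 0; have := b 1; have := b 2; have := b 3.
rewrite !ler_norml; move: (h 0 0 * _) (h 0 1 * _) (h 0 2 * _) (h 0 3 * _).
move=> a0 a1 a2 a3 /andP[? ?] /andP[? ?] /andP[? ?] /andP[? ?].
by apply/andP; split; lra.
Qed.

Lemma mulmx2_le (R : realType) (B : 'M[R]_2) :
  exists2 c : R, 0 < c & forall v : 'rV[R]_2, `|v *m B| <= c * `|v|.
Proof.
pose s := `|B 0 0| + `|B 0 1| + `|B 1 0| + `|B 1 1|.
exists (1 + s); first by rewrite ltr_pwDl // !addr_ge0.
move=> v; apply: rv_norm_le; first by rewrite mulr_ge0 // addr_ge0 // !addr_ge0.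
move=> j; rewrite mxE sum2; apply: (le_trans (ler_normD _ _)); rewrite !normrM.
have h0 : `|v 0 0| <= `|v| by exact: rv_coord_le.
have h1 : `|v 0 1| <= `|v| by exact: rv_coord_le.
have Bs : `|B 0 j| + `|B 1 j| <= s.
  have [->|->] : j = 0 \/ j = 1.
    by case: j => -[|[|//]] lt; [left|right]; apply/val_inj.
  - by rewrite /s; have := normr_ge0 (B 0 1); have := normr_ge0 (B 1 1); lra.
  - by rewrite /s; have := normr_ge0 (B 0 0); have := normr_ge0 (B 1 0); lra.
apply: (@le_trans _ _ (`|v| * `|B 0 j| + `|v| * `|B 1 j|)).
  by apply: lerD; apply: ler_wpM2r.
rewrite -mulrDr mulrC ler_wpM2r //; lra.
Qed.

(** [D] is a bare function, its linearity being expressed by its values on the basis. Strictness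
    controls differences of any two values near [y0], as a contraction estimate requires. *)
Definition strict_derivative {R : realType} (q : 'rV[R]_2 -> 'rV[R]_4)
    (y0 : 'rV[R]_2) (D : 'rV[R]_2 -> 'rV[R]_4) : Prop :=
  (forall w, D w = w 0 0 *: D (delta_mx 0 0) + w 0 1 *: D (delta_mx 0 1)) /\
  forall e : R, 0 < e -> exists2 r : R, 0 < r & forall y y',
    ball y0 r y -> ball y0 r y' ->
    `|q y - q y' - D (y - y')| <= e * `|y - y'|.

Lemma strict_derivative_bound (R : realType) (q D : 'rV[R]_2 -> 'rV[R]_4) y0 :
  strict_derivative q y0 D ->
  exists2 C, 0 < C & forall w, `|D w| <= C * `|w|.
Proof.
move=> [lin _]; set D1 := D (delta_mx 0 0) in lin; set D2 := D _ in lin.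
exists (1 + (`|D1| + `|D2|)); first by rewrite ltr_pwDl // addr_ge0.
move=> w; rewrite lin; apply: (le_trans (ler_normD _ _)); rewrite !normrZ.
have b1 := ler_wpM2r (normr_ge0 D1) (rv_coord_le _ _ w 0).
have b2 := ler_wpM2r (normr_ge0 D2) (rv_coord_le _ _ w 1).
by apply: (le_trans (lerD b1 b2)); rewrite -mulrDr mulrC ler_wpM2r // lerDr.
Qed.

(** Newton's iteration with the derivative frozen at [(y0, h0)], the last hypothesis being the
    invertibility of this derivative. For all [h] near [h0], the map [G h] contracts the same closed
    ball of radius [eta] by the factor 1/2. The existence of solutions will give local sections,
    their uniqueness on the whole ball will give local injectivity. *)
Lemma implicit_solution (R : realType) (q1 q2 : 'rV[R]_2 -> 'rV[R]_4)
    (D1 D2 : 'rV[R]_2 -> 'rV[R]_4)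
    (y0 : 'rV[R]_2) (h0 : 'rV[R]_4) (rho : R) :
  0 < rho -> strict_derivative q1 y0 D1 -> strict_derivative q2 y0 D2 ->
  trpair h0 (q1 y0) = 0 -> trpair h0 (q2 y0) = 0 ->
  (forall w, trpair h0 (D1 w) = 0 -> trpair h0 (D2 w) = 0 -> w = 0) ->
  exists (eta d : R) (psi : 'rV[R]_4 -> 'rV[R]_2), [/\ 0 < eta <= rho, 0 < d,
    forall h, ball h0 d h -> [/\ `|y0 - psi h| <= eta,
      trpair h (q1 (psi h)) = 0, trpair h (q2 (psi h)) = 0 &
      {for h, continuous psi}] &
    forall h y, ball h0 d h -> `|y0 - y| <= eta ->
      trpair h (q1 y) = 0 -> trpair h (q2 y) = 0 -> y = psi h].
Proof.
move=> rho0 sd1 sd2 F1 F2 inj.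
pose F y h : 'rV[R]_2 :=
  \row_j (if j == 0 then trpair h (q1 y) else trpair h (q2 y)).
have F00 : F y0 h0 = 0 by apply/rowP => j; rewrite !mxE F1 F2; case: ifP.
have FP y h : F y h = 0 <-> trpair h (q1 y) = 0 /\ trpair h (q2 y) = 0.
  split=> [e|[e1 e2]]; last by apply/rowP => j; rewrite !mxE e1 e2; case: ifP.
  by split; [have /rowP/(_ 0) := e|have /rowP/(_ 1) := e]; rewrite !mxE.
pose L (w : 'rV[R]_2) : 'rV[R]_2 := \row_j
  (if j == 0 then trpair h0 (D1 w) else trpair h0 (D2 w)).
pose A : 'M[R]_2 := \matrix_(i, j) L (delta_mx 0 i) 0 j.
have AL w : w *m A = L w.
  apply/rowP => j; rewrite mxE sum2 !mxE.
  by rewrite (sd1.1 w) (sd2.1 w) !trpairDr !trpairZr; case: ifP.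
have uA : A \in unitmx.
  rewrite -row_free_unit; apply: inj_row_free => w; rewrite AL => /rowP Lw.
  by apply: inj; [have := Lw 0|have := Lw 1]; rewrite !mxE.
have [c c0 hc] := mulmx2_le _ (invmx A).
have [C1 C10 hC1] := strict_derivative_bound _ _ _ _ sd1.
have [C2 C20 hC2] := strict_derivative_bound _ _ _ _ sd2.
(* Since [c] bounds the inverse of [A], an error [e] on the derivative yields the factor
   [c * e = 1/2]. Half of [e] is spent through [e1] on the nonlinearity of [q1] and [q2], the other
   half through [d] on the replacement of [h] by [h0]. *)
pose e := (2 * c)^-1; have e0 : 0 < e by rewrite invr_gt0 mulr_gt0.
pose H := `|h0| + 1; have H0 : 0 < H by rewrite ltr_wpDl.
pose e1 := e / (12 * H); have e10 : 0 < e1 by rewrite divr_gt0 // mulr_gt0.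
have [r1 r10 hr1] := sd1.2 _ e10.
have [r2 r20 hr2] := sd2.2 _ e10.
pose eta := Num.min rho (Num.min (r1 / 2) (r2 / 2)).
have eta0 : 0 < eta by rewrite !lt_min rho0 !divr_gt0.
have etarho : eta <= rho by rewrite ge_min lexx.
have eta1 : eta < r1.
  by apply: (@le_lt_trans _ _ (r1 / 2)); [rewrite !ge_min lexx orbT|lra].
have eta2 : eta < r2.
  by apply: (@le_lt_trans _ _ (r2 / 2)); [rewrite !ge_min lexx !orbT|lra].
pose Q := 1 + `|q1 y0| + `|q2 y0|.
have Q0 : 0 < Q by rewrite /Q -addrA ltr_pwDl // addr_ge0.
pose C := C1 + C2; have C0 : 0 < C by rewrite addr_gt0.
have C1C : C1 <= C by rewrite lerDl ltW.
have C2C : C2 <= C by rewrite lerDr ltW.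
(* By the last bound [G h] moves [y0] by at most [eta / 4]; with the factor 1/2 the ball of radius
   [eta] is stable. *)
pose d := Num.min 1 (Num.min (e / (12 * C)) (eta / (24 * c * Q))).
have d0 : 0 < d by rewrite !lt_min ltr01 !divr_gt0 // !mulr_gt0.
have dle1 : d <= 1 by rewrite ge_min lexx.
have dle2 : d * (12 * C) <= e.
  by rewrite -ler_pdivlMr ?mulr_gt0 // !ge_min lexx !orbT.
have dle3 : d * (24 * c * Q) <= eta.
  by rewrite -ler_pdivlMr ?mulr_gt0 // !ge_min lexx !orbT.
have strict h y y' : ball h0 d h -> `|y0 - y| <= eta -> `|y0 - y'| <= eta ->
    `|F y h - F y' h - (y - y') *m A| <= e * `|y - y'|.
  rewrite -ball_normE /= => hd By By'.
  have hH : `|h| <= H.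
    rewrite -[h](subrK h0) addrC; apply: (le_trans (ler_normD _ _)).
    by rewrite lerD2l distrC (le_trans (ltW hd)).
  have comp (q D : 'rV[R]_2 -> 'rV[R]_4) (Cq : R) : Cq <= C ->
      `|q y - q y' - D (y - y')| <= e1 * `|y - y'| ->
      (forall w, `|D w| <= Cq * `|w|) ->
      `|trpair h (q y) - trpair h (q y') - trpair h0 (D (y - y'))| <=
        e * `|y - y'|.
    move=> CqC hq hCq; set w := y - y' in hq *.
    have -> : trpair h (q y) - trpair h (q y') - trpair h0 (D w) =
        trpair h (q y - q y' - D w) + trpair (h - h0) (D w).
      by rewrite !trpairBr trpairBl; ring.
    apply: (le_trans (ler_normD _ _)).
    have b1 := trpair_le _ h (q y - q y' - D w).
    have b2 := trpair_le _ (h - h0) (D w).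
    have b3 : `|h| * `|q y - q y' - D w| <= H * (e1 * `|w|) by rewrite ler_pM.
    have b4 : `|h - h0| * `|D w| <= d * (C * `|w|).
      rewrite ler_pM //; first by rewrite distrC ltW.
      by apply: (le_trans (hCq w)); rewrite ler_wpM2r.
    have b5 : H * (e1 * `|w|) = e / 12 * `|w|.
      by rewrite /e1; field; rewrite gt_eqF.
    have b6 : d * (C * `|w|) <= e / 12 * `|w|.
      by rewrite mulrA ler_wpM2r //; lra.
    rewrite -!mulrA in b1 b2; lra.
  apply: rv_norm_le; first by rewrite mulr_ge0 // ltW.
  move=> j; rewrite AL !mxE.
  have B (r : R) z : eta < r -> `|y0 - z| <= eta -> ball y0 r z.
    by move=> er hz; rewrite -ball_normE /=; exact: le_lt_trans er.
  case: ifP => _.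
    by apply: (comp q1 D1 C1 C1C) => //; apply: hr1; exact: B.
  by apply: (comp q2 D2 C2 C2C) => //; apply: hr2; exact: B.
pose G h y := y - F y h *m invmx A.
have GF h y : G h y = y <-> F y h = 0.
  rewrite /G; split=> [/eqP|->]; last by rewrite mul0mx subr0.
  rewrite -subr_eq0 addrC addrA addNr sub0r oppr_eq0 => /eqP e'.
  by rewrite -[F y h](mulmxKV uA) e' mul0mx.
have contr h y y' : ball h0 d h -> `|y0 - y| <= eta -> `|y0 - y'| <= eta ->
    `|G h y - G h y'| <= 2^-1 * `|y - y'|.
  move=> Bh By By'.
  have -> : G h y - G h y' = - ((F y h - F y' h - (y - y') *m A) *m invmx A).
    rewrite mulmxBl (mulmxBl (F y h)) mulmxK // /G.
    by rewrite [RHS]opprB !opprD !opprK addrACA.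
  rewrite normrN; apply: (le_trans (hc _)).
  have := strict _ _ _ Bh By By'.
  set a := `|_ - _ - _|; set b := `|y - y'| => hab.
  have -> : 2^-1 * b = c * (e * b) by rewrite /e; field; rewrite gt_eqF.
  by rewrite ler_pM2l.
have self h y : ball h0 d h -> `|y0 - y| <= eta -> `|y0 - G h y| <= eta.
  move=> Bh By; have y00 : `|y0 - y0| <= eta by rewrite subrr normr0 ltW.
  rewrite -(subrKA (G h y0)); apply: (le_trans (ler_normD _ _)).
  have h1 := contr _ _ _ Bh y00 By.
  have -> : y0 - G h y0 = F y0 h *m invmx A by rewrite /G subKr.
  have h2 := hc (F y0 h).
  have h3 : `|F y0 h| <= 6 * (d * Q).
    have comp q : `|q| <= Q -> trpair h0 q = 0 -> `|trpair h q| <= 6 * (d * Q).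
      move=> qQ e'; rewrite -[trpair h q]subr0 -e' -trpairBl.
      apply: (le_trans (trpair_le _ _ _)); rewrite -mulrA ler_pM2l //.
      rewrite ler_pM //; rewrite -ball_normE /= in Bh.
      by rewrite distrC ltW.
    apply: rv_norm_le; first by rewrite !mulr_ge0 // ltW.
    move=> j; rewrite mxE; case: ifP => _; apply: comp => //.
      by rewrite /Q addrAC lerDr addr_ge0.
    by rewrite /Q lerDr addr_ge0.
  have h4 : c * `|F y0 h| <= c * (6 * (d * Q)) by rewrite ler_pM2l.
  have h5 : c * (6 * (d * Q)) <= eta / 4.
    have -> : c * (6 * (d * Q)) = d * (24 * c * Q) / 4 by field.
    by rewrite ler_pM2r // invr_gt0.
  lra.
have /choice[psi hpsi] (h : 'rV[R]_4) : exists y,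
    ball h0 d h -> `|y0 - y| <= eta /\ F y h = 0.
  have [Bh|nB] := pselect (ball h0 d h); last by exists 0.
  have [|y By /GF Gy] := banach_ball _ _ (G h) y0 eta eta0 (self h ^~ Bh).
    by move=> y y' *; exact: contr.
  by exists y.
have uniq h y y' : ball h0 d h -> `|y0 - y| <= eta -> `|y0 - y'| <= eta ->
    F y h = 0 -> F y' h = 0 -> y = y'.
  move=> Bh By By' /GF Fy /GF Fy'; have := contr _ _ _ Bh By By'.
  rewrite Fy Fy' => hle; apply/eqP; rewrite -subr_eq0 -normr_le0; lra.
exists eta, d, psi; split=> //; first by rewrite eta0.
  move=> h Bh; have [Bp /FP[? ?]] := hpsi _ Bh; split=> //.
  apply/(@cvgrPdist_le _ _ _ (nbhs h) (nbhs_filter h)) => eps eps0.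
  pose q := psi h.
  (* For a contraction of factor 1/2, a point lies within twice its displacement from the fixed
     point; this is applied to [psi h] and [G h']. *)
  have lip h' : ball h0 d h' -> `|psi h - psi h'| <=
      2 * (c * (6 * `|h - h'| * (`|q1 q| + `|q2 q|))).
    move=> Bh'; have [Bp' F'] := hpsi _ Bh'.
    have e1' : G h' (psi h') = psi h' by exact/GF.
    have h1 := contr _ _ _ Bh' Bp Bp'.
    have h2 : `|psi h - G h' (psi h)| <= c * `|F (psi h) h'|.
      by rewrite /G subKr.
    have h3 : `|F (psi h) h'| <= 6 * `|h - h'| * (`|q1 q| + `|q2 q|).
      have comp r : trpair h r = 0 -> `|trpair h' r| <= 6 * `|h - h'| * `|r|.
        move=> e'; rewrite -[trpair h' r]subr0 -e' -trpairBl distrC.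
        exact: trpair_le.
      apply: rv_norm_le; first by rewrite !mulr_ge0 // addr_ge0.
      move=> j; rewrite mxE; case: ifP => _; apply: (le_trans (comp _ _)) => //.
        by rewrite ler_wpM2l ?mulr_ge0 // lerDl.
      by rewrite ler_wpM2l ?mulr_ge0 // lerDr.
    have h4 : c * `|F (psi h) h'| <= c * (6 * `|h - h'| * (`|q1 q| + `|q2 q|)).
      by rewrite ler_pM2l.
    have h5 : `|psi h - psi h'| <= `|psi h - G h' (psi h)| +
        `|G h' (psi h) - G h' (psi h')|.
      by rewrite -{1}e1' -(subrKA (G h' (psi h))) ler_normD.
    lra.
  pose B := 2 * (c * (6 * (`|q1 q| + `|q2 q|))) + 1.
  have B0 : 0 < B by rewrite ltr_wpDl // !mulr_ge0 // ?(ltW c0) // addr_ge0.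
  near=> h'.
  have Bh' : ball h0 d h'.
    by near: h'; apply: open_nbhs_nbhs; split => //; exact: ball_open.
  apply: (le_trans (lip _ Bh')).
  have hh : `|h - h'| <= eps / B.
    by near: h'; apply: cvgr_dist_le; rewrite ?divr_gt0.
  have -> : 2 * (c * (6 * `|h - h'| * (`|q1 q| + `|q2 q|))) = `|h - h'| * (B - 1).
    by rewrite /B; ring.
  apply: (@le_trans _ _ (`|h - h'| * B)); first by rewrite ler_wpM2l //; lra.
  by rewrite -ler_pdivlMr.
move=> h y Bh By t1 t2; have [Bp Fp] := hpsi _ Bh.
by apply: (uniq h) => //; exact/FP.
Unshelve. all: by end_near. Qed.

(** * The cone of positive definite forms *)

(** The polarisation of [hdet], a Lorentzian form of signature (1, 3); between positive forms of
    determinant 1 it is the hyperbolic cosine of the distance. *)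
Definition hform {R : realType} (k l : 'rV[R]_4) : R :=
  (k 0 0 * l 0 3 + k 0 3 * l 0 0) / 2 - k 0 1 * l 0 1 - k 0 2 * l 0 2.

(** The adjugate matrix in coordinates, which exchanges the trace pairing with twice [hform]. *)
Definition hadj {R : realType} (k : 'rV[R]_4) : 'rV[R]_4 :=
  \row_i [:: k 0 3; - k 0 1; - k 0 2; k 0 0]`_i.

Lemma hadjE (R : realType) (k : 'rV[R]_4) :
  [/\ hadj k 0 0 = k 0 3, hadj k 0 1 = - k 0 1, hadj k 0 2 = - k 0 2 &
      hadj k 0 3 = k 0 0].
Proof. by split; rewrite mxE. Qed.

Lemma trpair_hadj (R : realType) (k q : 'rV[R]_4) :
  trpair (hadj k) q = 2 * hform k q.
Proof.
have [e0 e1 e2 e3] := hadjE _ k.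
by rewrite /trpair e0 e1 e2 e3 /hform; field.
Qed.

Lemma hdet_hadj (R : realType) (k : 'rV[R]_4) : hdet (hadj k) = hdet k.
Proof.
have [e0 e1 e2 e3] := hadjE _ k.
by rewrite /hdet e0 e1 e2 e3; ring.
Qed.

Lemma hdet_add (R : realType) (k l : 'rV[R]_4) :
  hdet (k + l) = hdet k + hdet l + 2 * hform k l.
Proof. by rewrite /hdet /hform !mxE; field. Qed.

Lemma hform_hdet (R : realType) (k : 'rV[R]_4) : hform k k = hdet k.
Proof. by rewrite /hdet /hform; field. Qed.

Lemma hdetZ (R : realType) (t : R) (k : 'rV[R]_4) :
  hdet (t *: k) = t ^+ 2 * hdet k.
Proof. by rewrite /hdet !mxE; ring. Qed.

Lemma pos_cone3 (R : realType) (k : 'rV[R]_4) : pos_cone k -> 0 < k 0 3.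
Proof.
move=> [k0 dk]; rewrite -(pmulr_rgt0 _ k0).
have := sqr_ge0 (k 0 1); have := sqr_ge0 (k 0 2).
by move: dk; rewrite /hdet; lra.
Qed.

Lemma pos_psd (R : realType) (k : 'rV[R]_4) : pos_cone k -> psd_cone k.
Proof. by move=> pk; have [k0 dk] := pk; split; rewrite ltW // pos_cone3. Qed.

Lemma hadj_pos (R : realType) (k : 'rV[R]_4) : pos_cone k -> pos_cone (hadj k).
Proof.
move=> pk; split; last by rewrite hdet_hadj; case: pk.
by have [-> _ _ _] := hadjE _ k; exact: pos_cone3.
Qed.

(** Self-duality of the cone: off the case [h 0 0 = 0], the pairing times [r 0 3 * h 0 0] is a sum
    of two squares and of positive multiples of [hdet r] and [hdet h]. Admitting [h] on the boundary
    of the cone is what lets the fitting condition act at the endpoints at infinity. *)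
Lemma trpair_gt0 (R : realType) (h r : 'rV[R]_4) :
  psd_cone h -> h != 0 -> pos_cone r -> 0 < trpair h r.
Proof.
move=> [h0 h3 dh] hn0 pr; have r3 := pos_cone3 _ _ pr; have [r0 dr] := pr.
have [e0|h0n] := eqVneq (h 0 0) 0.
  have /eqP : h 0 1 ^+ 2 + h 0 2 ^+ 2 = 0.
    apply/eqP; rewrite eq_le addr_ge0 ?sqr_ge0// andbT.
    by move: dh; rewrite /hdet e0; lra.
  rewrite paddr_eq0 ?sqr_ge0// !sqrf_eq0 => /andP[/eqP e1 /eqP e2].
  rewrite /trpair e0 e1 e2 !mul0r addr0 mulr0 addr0 add0r mulr_gt0 //.
  rewrite lt_neqAle h3 andbT eq_sym; apply: contraNneq hn0 => e3.
  apply/eqP/rowP => i; rewrite mxE.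
  case: i => -[|[|[|[|//]]]] lt; [rewrite -[RHS]e0|rewrite -[RHS]e1|
    rewrite -[RHS]e2|rewrite -[RHS]e3]; by congr (h _ _); apply/val_inj.
have hp : 0 < h 0 0 by rewrite lt_neqAle eq_sym h0n.
rewrite -(pmulr_rgt0 _ hp) -(pmulr_rgt0 _ r3).
have -> : r 0 3 * (h 0 0 * trpair h r) =
    (h 0 1 * r 0 3 + h 0 0 * r 0 1) ^+ 2 + (h 0 2 * r 0 3 + h 0 0 * r 0 2) ^+ 2
    + h 0 0 ^+ 2 * hdet r + r 0 3 ^+ 2 * hdet h.
  by rewrite /trpair /hdet; ring.
have := sqr_ge0 (h 0 1 * r 0 3 + h 0 0 * r 0 1).
have := sqr_ge0 (h 0 2 * r 0 3 + h 0 0 * r 0 2).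
have : 0 < h 0 0 ^+ 2 * hdet r by rewrite mulr_gt0 // exprn_gt0.
have : 0 <= r 0 3 ^+ 2 * hdet h by rewrite mulr_ge0 // sqr_ge0.
lra.
Qed.

Lemma pos_neq0 (R : realType) (k : 'rV[R]_4) : pos_cone k -> k != 0.
Proof. by move=> [k0 _]; apply: contraTneq k0 => ->; rewrite mxE ltxx. Qed.

Lemma hform_gt0 (R : realType) (k l : 'rV[R]_4) :
  pos_cone k -> pos_cone l -> 0 < hform k l.
Proof.
move=> pk pl; have pk' := hadj_pos _ _ pk.
have := trpair_gt0 _ _ _ (pos_psd _ _ pk') (pos_neq0 _ _ pk') pl.
by rewrite trpair_hadj pmulr_rgt0.
Qed.

Lemma pos_coneD (R : realType) (k l : 'rV[R]_4) :
  pos_cone k -> pos_cone l -> pos_cone (k + l).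
Proof.
move=> pk pl; have f := hform_gt0 _ _ _ pk pl; have [k0 dk] := pk.
have [l0 dl] := pl; split; first by rewrite mxE addr_gt0.
by rewrite hdet_add; lra.
Qed.

Lemma pos_coneZ (R : realType) (t : R) (k : 'rV[R]_4) :
  0 < t -> pos_cone k -> pos_cone (t *: k).
Proof.
move=> t0 [k0 dk]; split; first by rewrite mxE mulr_gt0.
by rewrite hdetZ mulr_gt0 // exprn_gt0.
Qed.

(** The condition [0 < hdet x] leaves two opposite cones, between which the sign of [hform o x]
    decides. *)
Lemma pos_cone_form (R : realType) (o x : 'rV[R]_4) :
  pos_cone o -> 0 < hdet x -> 0 < hform o x -> pos_cone x.
Proof.
move=> po dx fx; split=> //; rewrite ltNge; apply/negP => x0.
have x0n : x 0 0 != 0.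
  apply: contraTneq dx => e; rewrite /hdet e mul0r -leNgt.
  by have := sqr_ge0 (x 0 1); have := sqr_ge0 (x 0 2); lra.
have px : pos_cone (- x).
  split; last by rewrite -scaleN1r hdetZ sqrrN expr1n mul1r.
  by rewrite mxE oppr_gt0 lt_neqAle x0n.
have := hform_gt0 _ _ _ po px.
have -> : hform o (- x) = - hform o x by rewrite /hform !mxE; field.
lra.
Qed.

(** * Continuity at a point of the forms, and compactness of a slice of the cone *)

Lemma forcontD (R : realType) (T : topologicalType) (f g : T -> R) x :
  {for x, continuous f} -> {for x, continuous g} ->
  {for x, continuous (fun z => f z + g z)}.
Proof. by move=> cf cg; apply: cvgD. Qed.

Lemma forcontB (R : realType) (T : topologicalType) (f g : T -> R) x :
  {for x, continuous f} -> {for x, continuous g} ->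
  {for x, continuous (fun z => f z - g z)}.
Proof. by move=> cf cg; apply: cvgB. Qed.

Lemma forcontBv (R : realType) (V : normedModType R) (T : topologicalType)
    (f g : T -> V) x :
  {for x, continuous f} -> {for x, continuous g} ->
  {for x, continuous (fun z => f z - g z)}.
Proof. by move=> cf cg; apply: cvgB. Qed.

Lemma forcontCv (R : realType) (V : normedModType R) (T : topologicalType)
    (c : V) (x : T) : {for x, continuous (fun _ : T => c)}.
Proof. exact: cvg_cst. Qed.

Lemma forcontDv (R : realType) (V : normedModType R) (T : topologicalType)
    (f g : T -> V) x :
  {for x, continuous f} -> {for x, continuous g} ->
  {for x, continuous (fun z => f z + g z)}.
Proof. by move=> cf cg; apply: cvgD. Qed.

Lemma forcontZv (R : realType) (V : normedModType R) (T : topologicalType)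
    (f : T -> R) (g : T -> V) x :
  {for x, continuous f} -> {for x, continuous g} ->
  {for x, continuous (fun z => f z *: g z)}.
Proof. by move=> cf cg; apply: cvgZ. Qed.

Lemma forcontM (R : realType) (T : topologicalType) (f g : T -> R) x :
  {for x, continuous f} -> {for x, continuous g} ->
  {for x, continuous (fun z => f z * g z)}.
Proof. by move=> cf cg; apply: cvgM. Qed.

Lemma forcontV (R : realType) (T : topologicalType) (f : T -> R) x :
  f x != 0 -> {for x, continuous f} -> {for x, continuous (fun z => (f z)^-1)}.
Proof. by move=> f0 cf; apply: cvgV. Qed.

Lemma forcontC (R : realType) (T : topologicalType) (c : R) (x : T) :
  {for x, continuous (fun _ : T => c)}.
Proof. exact: cvg_cst. Qed.

Lemma forcont_coord (R : realType) n (k : 'rV[R]_n) i :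
  {for k, continuous (fun k : 'rV[R]_n => k 0 i)}.
Proof. exact: coord_continuous. Qed.

Lemma hdet_continuous (R : realType) : continuous (@hdet R).
Proof.
have -> : @hdet R = fun k => k 0 0 * k 0 3 - k 0 1 * k 0 1 - k 0 2 * k 0 2.
  by apply/funext => k; rewrite /hdet !expr2.
move=> k; have m i j : {for k, continuous (fun k : 'rV[R]_4 => k 0 i * k 0 j)}.
  by apply: forcontM; exact: forcont_coord.
exact: (forcontB _ _ _ _ _ (forcontB _ _ _ _ _ (m 0 3) (m 1 1)) (m 2 2)).
Qed.

Lemma trpair_continuous (R : realType) (q : 'rV[R]_4) :
  continuous (fun h => trpair h q).
Proof.
move=> h; have m i : {for h, continuous (fun k : 'rV[R]_4 => k 0 i * q 0 i)}.
  by apply: forcontM; [exact: forcont_coord|exact: forcontC].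
exact: (forcontD _ _ _ _ _ (forcontD _ _ _ _ _ (m 0) (m 3))
  (forcontM _ _ _ _ _ (forcontC _ _ 2 h) (forcontD _ _ _ _ _ (m 1) (m 2)))).
Qed.

Lemma trpair_continuousr (R : realType) (q : 'rV[R]_4) :
  continuous (trpair q).
Proof.
have -> : trpair q = fun h => trpair h q.
  by apply/funext => h; rewrite /trpair; ring.
exact: trpair_continuous.
Qed.

Lemma pos_cone_open (R : realType) : open (@pos_cone R).
Proof.
have -> : @pos_cone R = (fun k : 'rV[R]_4 => k 0 0) @^-1` [set x | 0 < x] `&`
    @hdet R @^-1` [set x | 0 < x] by [].
apply: openI; apply: open_comp; try exact: open_gt.
  by move=> k _; exact: coord_continuous.
by move=> k _; exact: hdet_continuous.
Qed.

Definition htr {R : realType} (k : 'rV[R]_4) : R := k 0 0 + k 0 3.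

Lemma htr_continuous (R : realType) : continuous (@htr R).
Proof.
move=> k; exact: (forcontD _ _ _ _ _ (forcont_coord _ _ k 0)
  (forcont_coord _ _ k 3)).
Qed.

Lemma psd_norm_le (R : realType) (k : 'rV[R]_4) : psd_cone k -> `|k| <= htr k.
Proof.
move=> [k0 k3 dk]; have t0 : 0 <= htr k by rewrite addr_ge0.
apply: rv_norm_le => // i.
have sq x : x ^+ 2 <= k 0 0 * k 0 3 -> `|x| <= htr k.
  move=> h; rewrite -(ler_pXn2r (n := 2)) ?nnegrE// real_normK ?num_real//.
  apply: (le_trans h); rewrite /htr sqrrD.
  have := sqr_ge0 (k 0 0); have := sqr_ge0 (k 0 3).
  have := mulr_ge0 k0 k3; rewrite mulr2n; lra.
have s1 := sqr_ge0 (k 0 1); have s2 := sqr_ge0 (k 0 2); rewrite /hdet in dk.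
case: i => -[|[|[|[|//]]]] lt.
- by rewrite (_ : Ordinal lt = 0) ?ger0_norm // ?lerDl //; apply/val_inj.
- by rewrite (_ : Ordinal lt = 1); [apply: sq; lra|apply/val_inj].
- by rewrite (_ : Ordinal lt = 2); [apply: sq; lra|apply/val_inj].
- by rewrite (_ : Ordinal lt = 3) ?ger0_norm // ?lerDr //; apply/val_inj.
Qed.

(** One point on each ray of the closed cone: a compact model of H^3 with its boundary, the latter
    made of the forms of rank one. *)
Definition psd_slice {R : realType} : set 'rV[R]_4 :=
  [set h | psd_cone h /\ htr h = 1].

Lemma psd_slice_compact (R : realType) : compact (@psd_slice R).
Proof.
apply: bounded_closed_compact.
  exists 1; split; first exact: num_real.
  move=> M M1 h [ph th] /=; apply: le_trans (ltW M1).
  by rewrite -th; exact: psd_norm_le.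
have -> : @psd_slice R = ((fun k : 'rV[R]_4 => k 0 0) @^-1` [set x | 0 <= x] `&`
    (fun k : 'rV[R]_4 => k 0 3) @^-1` [set x | 0 <= x] `&`
    @hdet R @^-1` [set x | 0 <= x]) `&` (@htr R @^-1` [set x | x = 1]).
  by apply/seteqP; split=> [k [[? ? ?] ?]|k [[[? ?] ?] ?]].
apply: closedI; last first.
  apply: closed_comp; first by move=> k _; exact: htr_continuous.
  exact: closed_eq.
apply: closedI; last first.
  apply: closed_comp; first by move=> k _; exact: hdet_continuous.
  exact: closed_ge.
by apply: closedI; apply: closed_comp; try exact: closed_ge;
  move=> k _; exact: coord_continuous.
Qed.

(** * The Loewner order and its intervals *)

Definition clt {R : realType} (k l : 'rV[R]_4) : Prop := pos_cone (l - k).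

Lemma clt_trans (R : realType) (k l m : 'rV[R]_4) :
  clt k l -> clt l m -> clt k m.
Proof.
by move=> kl lm; rewrite /clt -[m](subrK l) -addrA; exact: pos_coneD.
Qed.

Lemma cltD (R : realType) (k l k' l' : 'rV[R]_4) :
  clt k l -> clt k' l' -> clt (k + k') (l + l').
Proof. by move=> h h'; rewrite /clt opprD addrACA; exact: pos_coneD. Qed.

Lemma cltZ (R : realType) (t : R) (k l : 'rV[R]_4) :
  0 < t -> clt k l -> clt (t *: k) (t *: l).
Proof. by move=> t0 h; rewrite /clt -scalerBr; exact: pos_coneZ. Qed.

Lemma clt_scale (R : realType) (a b : R) (k : 'rV[R]_4) :
  a < b -> pos_cone k -> clt (a *: k) (b *: k).
Proof. by move=> ab pk; rewrite /clt -scalerBl; apply: pos_coneZ; rewrite ?subr_gt0. Qed.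

Lemma clt_pos (R : realType) (k l : 'rV[R]_4) :
  pos_cone k -> clt k l -> pos_cone l.
Proof. by move=> pk h; rewrite -[l](subrK k); exact: pos_coneD. Qed.

(** The coefficient makes [t *: o - k] the image of [k] under the reflection fixing [o], which
    preserves [hdet] and [hform o]. *)
Lemma clt_hform (R : realType) (o k : 'rV[R]_4) :
  pos_cone o -> pos_cone k -> clt k ((2 * hform o k / hdet o) *: o).
Proof.
move=> po pk; have [q0 dq] := po; have [k0 dk] := pk.
have f := hform_gt0 _ _ _ po pk; set t := _ / _.
have e1 : hdet (t *: o - k) = hdet k.
  have -> : hdet (t *: o - k) = t ^+ 2 * hdet o - 2 * t * hform o k + hdet k.
    by rewrite /hdet /hform !mxE; field.
  by rewrite /t; field; rewrite gt_eqF.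
have e2 : hform o (t *: o - k) = hform o k.
  have -> : hform o (t *: o - k) = t * hdet o - hform o k.
    by rewrite /hdet /hform !mxE; field.
  by rewrite /t; field; rewrite gt_eqF.
by apply: pos_cone_form po _ _; rewrite ?e1 ?e2.
Qed.

(** For small [e], up to constants, a ball of Thompson's part metric on the cone. These sets are
    open and convex, and scaling and SL(2, C) permute them with [e] unchanged. *)
Definition cnear {R : realType} (e : R) (h : 'rV[R]_4) : set 'rV[R]_4 :=
  [set k | clt ((1 - e) *: h) k /\ clt k ((1 + e) *: h)].

Lemma clt_openr (R : realType) (k : 'rV[R]_4) : open [set l : 'rV[R]_4 | clt k l].
Proof.
apply: (@open_comp _ _ (fun l : 'rV[R]_4 => l - k)); last exact: pos_cone_open.
by move=> l _; exact: (forcontBv _ _ _ id _ l cvg_id (forcontCv _ _ _ k l)).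
Qed.

Lemma clt_openl (R : realType) (k : 'rV[R]_4) : open [set l : 'rV[R]_4 | clt l k].
Proof.
apply: (@open_comp _ _ (fun l : 'rV[R]_4 => k - l)); last exact: pos_cone_open.
by move=> l _; exact: (forcontBv _ _ _ _ id l (forcontCv _ _ _ k l) cvg_id).
Qed.

Lemma clt_itv_open (R : realType) (a b : 'rV[R]_4) :
  open [set k | clt a k /\ clt k b].
Proof. by apply: openI; [exact: clt_openr|exact: clt_openl]. Qed.

Lemma clt_itv_convex (R : realType) (a b x y : 'rV[R]_4) (t : R) :
  clt a x /\ clt x b -> clt a y /\ clt y b -> 0 <= t <= 1 ->
  clt a (x + t *: (y - x)) /\ clt (x + t *: (y - x)) b.
Proof.
move=> [ax xb] [ay yb] /andP[t0 t1].
have [->|tn0] := eqVneq t 0; first by rewrite scale0r addr0.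
have [->|tn1] := eqVneq t 1; first by rewrite scale1r addrC subrK.
have tp : 0 < t by rewrite lt_neqAle eq_sym tn0.
have tq : 0 < 1 - t by rewrite subr_gt0 lt_neqAle tn1.
have e (z : 'rV[R]_4) : z = (1 - t) *: z + t *: z by rewrite -scalerDl subrK scale1r.
have -> : x + t *: (y - x) = (1 - t) *: x + t *: y.
  by rewrite scalerBr scalerBl scale1r addrA addrAC.
by rewrite {1}(e a) {1}(e b); split; apply: cltD; exact: cltZ.
Qed.

Lemma clt_itv_connected (R : realType) (a b a' b' : 'rV[R]_4) :
  connected ([set k | clt a k /\ clt k b] `&` [set k | clt a' k /\ clt k b']).
Proof.
apply: convex_connected => x y t [h1 h2] [h3 h4] t01.
by split; exact: clt_itv_convex.
Qed.

Lemma cnear_refl (R : realType) (e : R) (h : 'rV[R]_4) :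
  0 < e -> pos_cone h -> cnear e h h.
Proof.
move=> e0 ph; rewrite /cnear /=.
by split; [rewrite -[X in clt _ X]scale1r|rewrite -[X in clt X _]scale1r];
  apply: clt_scale => //; lra.
Qed.

Lemma cnear_pos (R : realType) (e : R) (h k : 'rV[R]_4) :
  e < 1 -> pos_cone h -> cnear e h k -> pos_cone k.
Proof.
move=> e1 ph [h1 _]; apply: clt_pos h1; apply: pos_coneZ => //; lra.
Qed.

Lemma cnear_le (R : realType) (e e' : R) (h : 'rV[R]_4) :
  e <= e' -> pos_cone h -> cnear e h `<=` cnear e' h.
Proof.
move=> ee ph k; have [->//|ne] := eqVneq e e'.
have lt : e < e' by rewrite lt_neqAle ne.
move=> [h1 h2]; split.
  by apply: clt_trans h1; apply: clt_scale => //; lra.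
by apply: (clt_trans _ _ _ _ h2); apply: clt_scale => //; lra.
Qed.

(** The two chains through [y] compare [y1] with [y2] up to the ratio of [1 + e / 4] and
    [1 - e / 4], which together with its inverse lies between [1 - e] and [1 + e]. This is the
    relation between [M] and [N] demanded by [section_extend]. *)
Lemma cnear_sym (R : realType) (e : R) (y y1 y2 : 'rV[R]_4) :
  0 < e <= 1 -> pos_cone y2 ->
  cnear (e / 4) y1 y -> cnear (e / 4) y2 y -> cnear e y2 y1.
Proof.
move=> /andP[e0 e1] p2 [a1 b1] [a2 b2].
have d0 : 0 < 1 - e / 4 by lra.
have d1 : 0 < 1 + e / 4 by lra.
have h1 := clt_trans _ _ _ _ a1 b2; have h2 := clt_trans _ _ _ _ a2 b1.
have i0 : 0 < (1 - e / 4)^-1 by rewrite invr_gt0.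
have i1 : 0 < (1 + e / 4)^-1 by rewrite invr_gt0.
have {}h1 := cltZ _ _ _ _ i0 h1; have {}h2 := cltZ _ _ _ _ i1 h2.
rewrite !scalerA mulVf ?gt_eqF// scale1r in h1.
rewrite !scalerA mulVf ?gt_eqF// scale1r in h2.
have s : 0 < e * e by rewrite mulr_gt0.
have s2 : e * e <= e by rewrite ler_piMl // ltW.
split.
  apply: clt_trans h2; apply: clt_scale => //.
  by rewrite mulrC ltr_pdivlMr //; lra.
apply: (clt_trans _ _ _ _ h1); apply: clt_scale => //.
by rewrite mulrC ltr_pdivrMr //; lra.
Qed.

Lemma cnearZ (R : realType) (e t : R) (h k : 'rV[R]_4) :
  0 < t -> cnear e h k -> cnear e (t *: h) (t *: k).
Proof.
move=> t0 [h1 h2]; split.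
  by have := cltZ _ _ _ _ t0 h1; rewrite !scalerA mulrC.
by have := cltZ _ _ _ _ t0 h2; rewrite !scalerA [t * _]mulrC.
Qed.

(** [k - (1 - e) h] is positive of trace at most [2 e], and the trace bounds the norm. The estimate
    does not degenerate as [h] approaches the boundary of the cone. *)
Lemma cnear_norm (R : realType) (e : R) (h k : 'rV[R]_4) :
  0 < e -> psd_cone h -> htr h = 1 -> cnear e h k -> `|h - k| <= 3 * e.
Proof.
rewrite /cnear /clt => e0 ph th [/pos_psd h1 /pos_psd h2].
have n1 := psd_norm_le _ _ h1.
have t1 : htr (k - (1 - e) *: h) = htr k - (1 - e).
  by rewrite -[in RHS](mulr1 (1 - e)) -th /htr !mxE; ring.
have t2 : htr ((1 + e) *: h - k) = (1 + e) - htr k.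
  by rewrite -[in RHS](mulr1 (1 + e)) -th /htr !mxE; ring.
have := le_trans (normr_ge0 _) (psd_norm_le _ _ h2).
have nh : `|e *: h| <= e.
  rewrite normrZ (gtr0_norm e0) -[leRHS]mulr1; apply: ler_wpM2l; first exact: ltW.
  by rewrite -th; exact: psd_norm_le.
have -> : h - k = e *: h - (k - (1 - e) *: h).
  by rewrite scalerBl scale1r opprB addrA [e *: h + _]addrC subrK.
have := ler_normB (e *: h) (k - (1 - e) *: h); lra.
Qed.

(** * Mixed planes and their geodesics *)

(** If [hdet q >= 0], the diagonal entries do not have opposite signs, so [q] or [- q] is positive
    semi-definite and mixedness forces [q = 0]. *)
Lemma mixed_hdet_lt0 (R : realType) (P : mixed_plane R) (q : 'rV[R]_4) :
  q \in plane P -> q != 0 -> hdet q < 0.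
Proof.
move=> Pq q0; rewrite ltNge; apply: contra q0 => dq; apply/eqP.
have s : 0 <= q 0 0 * q 0 3.
  by have := sqr_ge0 (q 0 1); have := sqr_ge0 (q 0 2); move: dq; rewrite /hdet; lra.
have pos (k : 'rV[R]_4) : k \in plane P -> 0 <= hdet k -> 0 <= k 0 0 ->
    0 <= k 0 3 -> k = 0.
  move=> Pk dk k0 k3; apply: (@mixed_planeP _ P) => //.
  by apply: psd_pos_semidef; split.
have neg : q 0 0 <= 0 -> q 0 3 <= 0 -> q = 0.
  move=> h0 h3; apply: oppr_inj; rewrite oppr0; apply: pos.
  - by rewrite rpredN.
  - by rewrite -scaleN1r hdetZ sqrrN expr1n mul1r.
  - by rewrite mxE oppr_ge0.
  - by rewrite mxE oppr_ge0.
have [h0|h0|h0] := ltrgtP (q 0 0) 0.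
- by apply: neg; [exact: ltW|rewrite -(nmulr_rge0 _ h0)].
- by apply: pos => //; [exact: ltW|rewrite -(pmulr_rge0 _ h0)].
- by have [h3|h3] := lerP (q 0 3) 0; [apply: neg|apply: pos]; rewrite ?h0 // ltW.
Qed.

Lemma span2P (R : realType) (q1 q2 v : 'rV[R]_4) :
  reflect (exists a b : R, v = a *: q1 + b *: q2) (v \in <<[:: q1; q2]>>%VS).
Proof.
rewrite span_cons span_seq1; apply: (iffP memv_addP).
  by move=> [_ /vlineP[a ->] [_ /vlineP[b ->] ->]]; exists a, b.
move=> [a [b ->]]; exists (a *: q1); first by rewrite memvZ // memv_line.
by exists (b *: q2) => //; rewrite memvZ // memv_line.
Qed.

(** * Orthogonal projection to a mixed plane for the determinant form *)

Definition gram {R : realType} (q1 q2 : 'rV[R]_4) : R :=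
  hdet q1 * hdet q2 - hform q1 q2 ^+ 2.

(** Cramer's rule for the [hform]-orthogonal projection of [v] to the span of [q1] and [q2]; the
    formula makes continuity in the frame visible. *)
Definition fst_coord {R : realType} (q1 q2 v : 'rV[R]_4) : R :=
  (hform v q1 * hdet q2 - hform v q2 * hform q1 q2) / gram q1 q2.

Definition snd_coord {R : realType} (q1 q2 v : 'rV[R]_4) : R :=
  (hform v q2 * hdet q1 - hform v q1 * hform q1 q2) / gram q1 q2.

Lemma hformC (R : realType) (k l : 'rV[R]_4) : hform k l = hform l k.
Proof. by rewrite /hform; field. Qed.

Lemma hformDl (R : realType) (k l m : 'rV[R]_4) :
  hform (k + l) m = hform k m + hform l m.
Proof. by rewrite /hform !mxE; field. Qed.

Lemma hformZl (R : realType) (t : R) (k m : 'rV[R]_4) :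
  hform (t *: k) m = t * hform k m.
Proof. by rewrite /hform !mxE; field. Qed.

Lemma hformBl (R : realType) (k l m : 'rV[R]_4) :
  hform (k - l) m = hform k m - hform l m.
Proof. by rewrite /hform !mxE; field. Qed.

(** The combination [q] is orthogonal to [q2] and satisfies [hdet q = hdet q2 * gram q1 q2], where
    both determinants are negative. *)
Lemma mixed_gram_gt0 (R : realType) (P : mixed_plane R) (q1 q2 : 'rV[R]_4) :
  plane P = <<[:: q1; q2]>>%VS -> 0 < gram q1 q2.
Proof.
move=> PE; have fr : free [:: q1; q2].
  by rewrite /free -PE mixed_plane_dim.
move: fr; rewrite free_cons span_seq1 seq1_free => /andP[q1n q20].
have P2 : q2 \in plane P by rewrite PE; apply/span2P; exists 0, 1; rewrite scale0r add0r scale1r.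
have d2 := mixed_hdet_lt0 _ _ _ P2 q20.
pose q := hdet q2 *: q1 - hform q1 q2 *: q2.
have Pq : q \in plane P.
  by rewrite PE; apply/span2P; exists (hdet q2), (- hform q1 q2); rewrite scaleNr.
have q0 : q != 0.
  apply: contraNneq q1n => /eqP; rewrite subr_eq0 => /eqP e.
  have -> : q1 = (hform q1 q2 / hdet q2) *: q2.
    by rewrite mulrC -scalerA -e scalerA mulVf ?scale1r // lt_eqF.
  by rewrite memvZ // memv_line.
have := mixed_hdet_lt0 _ _ _ Pq q0.
have -> : hdet q = hdet q2 * gram q1 q2.
  by rewrite /q /gram -!hform_hdet /hform !mxE; field.
by rewrite nmulr_rlt0.
Qed.

Lemma frame_coordE (R : realType) (q1 q2 : 'rV[R]_4) (a b : R) :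
  gram q1 q2 != 0 ->
  fst_coord q1 q2 (a *: q1 + b *: q2) = a /\
  snd_coord q1 q2 (a *: q1 + b *: q2) = b.
Proof.
move=> g0; rewrite /fst_coord /snd_coord !hformDl !hformZl !hform_hdet.
rewrite (hformC _ q2 q1); move: g0; rewrite /gram.
by move: (hdet q1) (hdet q2) (hform q1 q2) => x y z g0; split; field.
Qed.

Definition orth_part {R : realType} (q1 q2 v : 'rV[R]_4) : 'rV[R]_4 :=
  v - (fst_coord q1 q2 v *: q1 + snd_coord q1 q2 v *: q2).

Lemma orth_part_form (R : realType) (q1 q2 v q : 'rV[R]_4) :
  gram q1 q2 != 0 -> q \in <<[:: q1; q2]>>%VS -> hform (orth_part q1 q2 v) q = 0.
Proof.
move=> g0 /span2P[a [b ->]]; rewrite hformC hformDl !hformZl.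
rewrite !(hformC _ _ (orth_part _ _ _)) /orth_part !hformBl !hformDl !hformZl.
rewrite !hform_hdet (hformC _ q2 q1) /fst_coord /snd_coord.
move: g0; rewrite /gram.
move: (hdet q1) (hdet q2) (hform q1 q2) (hform v q1) (hform v q2).
by move=> x y z s t g0; field.
Qed.

(** The cone over the geodesic: all positive multiples of its points are kept, which makes the fiber
    convex. *)
Definition fiber {R : realType} (P : mixed_plane R) : set 'rV[R]_4 :=
  [set h | pos_cone h /\ forall q, q \in plane P -> trpair h q = 0].

Definition unit_form {R : realType} : 'rV[R]_4 := \row_i [:: 1; 0; 0; 1]`_i.

Lemma unit_formE (R : realType) (k : 'rV[R]_4) :
  hform unit_form k = htr k / 2 /\ hdet (@unit_form R) = 1.
Proof. by rewrite /hform /hdet /htr !mxE /=; split; field. Qed.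

Lemma hadjK (R : realType) : involutive (@hadj R).
Proof.
move=> k; have [e0 e1 e2 e3] := hadjE _ k; apply/rowP => i; rewrite mxE.
rewrite e0 e1 e2 e3 opprK opprK.
by case: i => -[|[|[|[|//]]]] lt /=; congr (k _ _); apply/val_inj.
Qed.

Definition center_spec {R : realType} (P : mixed_plane R) (h : 'rV[R]_4) : Prop :=
  fiber P h /\ unit_form - hadj h \in plane P.

(* The point of the geodesic closest to the base point [unit_form], i.e. the
   projection of [unit_form] to the orthogonal of [P] for the determinant form,
   which is negative definite on [P]. *)
Lemma orth_part_center (R : realType) (P : mixed_plane R) (q1 q2 : 'rV[R]_4) :
  plane P = <<[:: q1; q2]>>%VS ->
  center_spec P (hadj (orth_part q1 q2 unit_form)).
Proof.
move=> PE; have g0 : gram q1 q2 != 0 by rewrite gt_eqF // (mixed_gram_gt0 _ P).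
set k := orth_part q1 q2 unit_form.
have k0 q : q \in plane P -> hform k q = 0.
  by rewrite PE; exact: orth_part_form.
have pP : unit_form - k \in plane P.
  by rewrite PE /k /orth_part subKr; apply/span2P; eexists; eexists.
set r := unit_form - k in pP.
have kE : unit_form = k + r by rewrite /r addrC subrK.
have dr : hdet r <= 0.
  have [->|r0] := eqVneq r 0; last by rewrite ltW // (mixed_hdet_lt0 _ P).
  by rewrite -(scale0r 0) hdetZ expr0n mul0r.
have dk : hdet k = 1 - hdet r.
  have := (unit_formE _ (0 : 'rV[R]_4)).2; rewrite {1}kE hdet_add k0 // => <-.
  by rewrite mulr0 addr0 addrK.
have d1 : 1 <= hdet k by rewrite dk; lra.
have tk : htr k = 2 * hdet k.
  have := (unit_formE _ k).1; rewrite {1}kE hformDl hform_hdet hformC.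
  by rewrite k0 //; lra.
split; last by rewrite hadjK.
split; last by move=> q Pq; rewrite trpair_hadj k0 // mulr0.
apply: hadj_pos; apply: (pos_cone_form _ unit_form); last 2 first.
- lra.
- by rewrite (unit_formE _ k).1 tk; lra.
by split; [rewrite mxE|rewrite (unit_formE _ (0 : 'rV[R]_4)).2].
Qed.

Lemma center_exists (R : realType) (P : mixed_plane R) :
  exists h, center_spec P h.
Proof.
have sz : size (vbasis (plane P)) = 2%N.
  by rewrite size_tuple mixed_plane_dim.
have := span_basis (vbasisP (plane P)); move: sz.
case: (vbasis (plane P)) => -[|q1 [|q2 [|? ?]]] //= _ _ e.
by exists (hadj (orth_part q1 q2 unit_form)); apply: orth_part_center.
Qed.

Definition geo_center {R : realType} (P : mixed_plane R) : 'rV[R]_4 :=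
  sval (cid (center_exists R P)).

Lemma centerP (R : realType) (P : mixed_plane R) : center_spec P (geo_center P).
Proof. by rewrite /geo_center; case: cid. Qed.

(** The difference of the two projections lies in [P] and is orthogonal to [P], on which [hform] is
    definite. Uniqueness allows the continuity of [geo_center] to be checked in any local frame. *)
Lemma center_unique (R : realType) (P : mixed_plane R) (h h' : 'rV[R]_4) :
  center_spec P h -> center_spec P h' -> h = h'.
Proof.
move=> [[_ f] p] [[_ f'] p']; apply: (inv_inj (hadjK R)).
have d : hadj h' - hadj h \in plane P.
  by have := rpredB p p'; rewrite opprB addrCA addrAC subrr add0r addrC.
have [/eqP|d0] := eqVneq (hadj h' - hadj h) 0.
  by rewrite subr_eq0 => /eqP.
have := mixed_hdet_lt0 _ _ _ d d0; rewrite -hform_hdet hformBl.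
have e (k q : 'rV[R]_4) : trpair k q = 0 -> hform (hadj k) q = 0.
  by rewrite -{1}[k]hadjK trpair_hadj; lra.
by rewrite (e _ _ (f _ d)) (e _ _ (f' _ d)) subrr ltxx.
Qed.

Lemma fiber_geodesic (R : realType) (P : mixed_plane R) (h : 'rV[R]_4) :
  hdet h = 1 -> fiber P h <-> geodesic P (herm h).
Proof.
move=> dh; split=> [[ph f]|[[/pos_defP ph _] f]]; split=> //.
- split; first exact/pos_defP.
  by rewrite hdet_det dh.
- by move=> q Pq; rewrite trpair_tr f.
- by move=> q Pq; have := f q Pq; rewrite trpair_tr => -[].
Qed.

Lemma fiberZ (R : realType) (P : mixed_plane R) (t : R) (h : 'rV[R]_4) :
  0 < t -> fiber P h -> fiber P (t *: h).
Proof.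
move=> t0 [ph f]; split; first exact: pos_coneZ.
by move=> q Pq; rewrite trpairZl f // mulr0.
Qed.

Lemma herm_actZ (R : realType) (m : 'M[complex R]_2) (t : R) (h : 'rV[R]_4) :
  herm_act m (t *: h) = t *: herm_act m h.
Proof.
have e0 : herm_act m 0 = 0.
  have := herm_act_linear _ m 1 0 0; rewrite !scale1r addr0.
  by move/eqP; rewrite -subr_eq subrr eq_sym => /eqP.
by rewrite -[t *: h]addr0 herm_act_linear e0 addr0.
Qed.

(** Equivariance is known for points of determinant 1, so [h] is normalised by [t] and scaled back
    at the end. *)
Lemma fiber_equivariant (R : realType) (P Q : mixed_plane R)
    (m : 'M[complex R]_2) (h : 'rV[R]_4) :
  \det m = 1 -> geodesic Q = H3_act m @` geodesic P ->
  fiber P h -> fiber Q (herm_act m h).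
Proof.
move=> dm QP fh; have [[h0 dh] _] := fh.
pose t := (Num.sqrt (hdet h))^-1.
have s0 : 0 < Num.sqrt (hdet h) by rewrite sqrtr_gt0.
have t0 : 0 < t by rewrite invr_gt0.
have dt : hdet (t *: h) = 1.
  by rewrite hdetZ exprVn sqr_sqrtr ?ltW // mulVf // gt_eqF.
have : geodesic Q (herm (herm_act m (t *: h))).
  rewrite QP herm_actE; exists (herm (t *: h)) => //.
  by apply/fiber_geodesic => //; exact: fiberZ.
move/fiber_geodesic; rewrite herm_act_hdet // => /(_ dt).
rewrite herm_actZ => /(fiberZ _ _ _ _ s0).
by rewrite scalerA mulfV ?scale1r // gt_eqF.
Qed.

(** * Fitting immersions in a chart *)

Lemma hform_forcont (R : realType) (T : topologicalType)
    (f g : T -> 'rV[R]_4) x :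
  {for x, continuous f} -> {for x, continuous g} ->
  {for x, continuous (fun z => hform (f z) (g z))}.
Proof.
move=> cf cg.
have c (k : T -> 'rV[R]_4) i : {for x, continuous k} ->
    {for x, continuous (fun z => k z 0 i)}.
  move=> ck; apply: (@continuous_comp _ _ _ k (fun v : 'rV[R]_4 => v 0 i)) => //.
  exact: coord_continuous.
have m i j := forcontM _ _ _ _ _ (c _ i cf) (c _ j cg).
exact: (forcontB _ _ _ _ _ (forcontB _ _ _ _ _ (forcontM _ _ _ _ _
  (forcontD _ _ _ _ _ (m 0 3) (m 3 0)) (forcontC _ _ 2^-1 x)) (m 1 1)) (m 2 2)).
Qed.

Lemma hdet_forcont (R : realType) (T : topologicalType) (f : T -> 'rV[R]_4) x :
  {for x, continuous f} -> {for x, continuous (fun z => hdet (f z))}.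
Proof.
move=> cf; apply: (@continuous_comp _ _ _ f (@hdet R)) => //.
exact: hdet_continuous.
Qed.

Lemma hadj_forcont (R : realType) (T : topologicalType) (f : T -> 'rV[R]_4) x :
  {for x, continuous f} -> {for x, continuous (fun z => hadj (f z))}.
Proof.
move=> cf.
(* [hadj] is the reflection that fixes [unit_form]. *)
have -> : (fun z => hadj (f z)) = fun z =>
    (2 * hform (f z) unit_form) *: unit_form - f z.
  apply/funext => z; apply/rowP => i; rewrite !mxE /hform !mxE /=.
  case: i => -[|[|[|[|//]]]] lt /=.
  - by rewrite (_ : Ordinal lt = 0); [field|apply/val_inj].
  - by rewrite (_ : Ordinal lt = 1); [field|apply/val_inj].
  - by rewrite (_ : Ordinal lt = 2); [field|apply/val_inj].
  - by rewrite (_ : Ordinal lt = 3); [field|apply/val_inj].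
exact: (forcontBv _ _ _ _ _ _ (forcontZv _ _ _ _ _ _ (forcontM _ _ _ _ _
  (forcontC _ _ 2 x) (hform_forcont _ _ _ _ _ cf (forcontCv _ _ _ unit_form x)))
  (forcontCv _ _ _ unit_form x)) cf).
Qed.

Lemma trpair_forcont (R : realType) (T : topologicalType)
    (f g : T -> 'rV[R]_4) x :
  {for x, continuous f} -> {for x, continuous g} ->
  {for x, continuous (fun z => trpair (f z) (g z))}.
Proof.
move=> cf cg.
have -> : (fun z => trpair (f z) (g z)) = fun z => 2 * hform (hadj (f z)) (g z).
  by apply/funext => z; rewrite -trpair_hadj hadjK.
exact: (forcontM _ _ _ _ _ (forcontC _ _ 2 x)
  (hform_forcont _ _ _ _ _ (hadj_forcont _ _ _ _ cf) cg)).
Qed.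

Lemma coord_forcont (R : realType) (T : topologicalType)
    (f g v : T -> 'rV[R]_4) x :
  gram (f x) (g x) != 0 ->
  {for x, continuous f} -> {for x, continuous g} -> {for x, continuous v} ->
  {for x, continuous (fun z => fst_coord (f z) (g z) (v z))} /\
  {for x, continuous (fun z => snd_coord (f z) (g z) (v z))}.
Proof.
move=> g0 cf cg cv.
have H k l := hform_forcont R T k l x.
have D k := hdet_forcont R T k x.
have gE : (fun z => gram (f z) (g z)) = fun z =>
    hdet (f z) * hdet (g z) - hform (f z) (g z) * hform (f z) (g z).
  by apply/funext => z; rewrite /gram expr2.
have cgram : {for x, continuous (fun z => gram (f z) (g z))}.
  rewrite gE; exact: (forcontB _ _ _ _ _ (forcontM _ _ _ _ _ (D _ cf) (D _ cg))
    (forcontM _ _ _ _ _ (H _ _ cf cg) (H _ _ cf cg))).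
have ci := forcontV R T (fun z => gram (f z) (g z)) x g0 cgram.
split.
- exact: (forcontM _ _ _ _ _ (forcontB _ _ _ _ _ (forcontM _ _ _ _ _
    (H _ _ cv cf) (D _ cg)) (forcontM _ _ _ _ _ (H _ _ cv cg) (H _ _ cf cg))) ci).
- exact: (forcontM _ _ _ _ _ (forcontB _ _ _ _ _ (forcontM _ _ _ _ _
    (H _ _ cv cg) (D _ cf)) (forcontM _ _ _ _ _ (H _ _ cv cf) (H _ _ cf cg))) ci).
Qed.

Lemma smooth_strict (R : realType) (U : set 'rV[R]_2)
    (q : 'rV[R]_2 -> 'rV[R]_4) (y0 : 'rV[R]_2) :
  open U -> U y0 -> smooth_on U q ->
  [/\ strict_derivative q y0 (fun w => 'D_w q y0),
      forall w, derivable q y0 w & {for y0, continuous q}].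
Proof.
move=> oU Uy /(_ 1%N)[dq cq].
have d0 := dq _ Uy.
have nU : nbhs y0 U by exact: open_nbhs_nbhs.
split; last 2 first.
- by move=> w; exact: diff_derivable.
- exact: differentiable_continuous.
split; first by move=> w; exact: derive_rV2.
move=> e e0; apply: strict_differentiable => //.
  by apply: filterS nU.
by move=> v; apply: (cq v); rewrite in_setE.
Qed.

Lemma derive_trpair (R : realType) (h : 'rV[R]_4) (q : 'rV[R]_2 -> 'rV[R]_4)
    (y w : 'rV[R]_2) :
  derivable q y w -> trpair h (q y) = 0 ->
  (fun t : R => t^-1 * trpair h (q (t *: w + y))) @ 0^' --> trpair h ('D_w q y).
Proof.
move=> dq h0.
have -> : (fun t : R => t^-1 * trpair h (q (t *: w + y))) =
    trpair h \o (fun t : R => t^-1 *: ((q \o shift y) (t *: w) - q y)).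
  by apply/funext => t; rewrite /= trpairZr trpairBr h0 subr0.
have dq' : (fun t : R => t^-1 *: ((q \o shift y) (t *: w) - q y)) @ 0^' -->
    'D_w q y by exact: dq.
exact: (cvg_comp _ _ dq' (trpair_continuousr _ h _)).
Qed.

(** Fitting provides a section [s] of [P] whose derivative along [w] is, modulo [P y], a positive
    definite [r]. Write [s] as [a q1 + b q2] with [a] and [b] continuous. The difference quotients
    of the pairings of [h] with [q1] and [q2] tend to 0, hence so does that of the pairing with [s],
    and no derivative of [a] or [b] is involved. Thus [h] is orthogonal to [r], against
    [trpair_gt0]. *)
Lemma fitting_injective (R : realType) (P : 'rV[R]_2 -> mixed_plane R)
    (y : 'rV[R]_2) (U : set 'rV[R]_2) (q1 q2 : 'rV[R]_2 -> 'rV[R]_4) :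
  open U -> U y -> smooth_on U q1 -> smooth_on U q2 ->
  (forall z, U z -> plane (P z) = <<[:: q1 z; q2 z]>>%VS) ->
  (forall w, w != 0 -> exists q r, gr_diff P y w q r /\ pos_def (herm r)) ->
  forall h, psd_cone h -> h != 0 ->
  (forall q, q \in plane (P y) -> trpair h q = 0) ->
  forall w, trpair h ('D_w q1 y) = 0 -> trpair h ('D_w q2 y) = 0 -> w = 0.
Proof.
move=> oU Uy s1 s2 PE fit h ph hn0 hP w w1 w2; apply/eqP/negPn/negP => wn0.
have [q [r [[V [s [[oV Vy] ss sP sy dr]]] /pos_defP pr]]] := fit _ wn0.
have [_ d1 c1] := smooth_strict _ _ _ _ oU Uy s1.
have [_ d2 c2] := smooth_strict _ _ _ _ oU Uy s2.
have [_ ds cs] := smooth_strict _ _ _ _ oV Vy ss.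
have g0 : gram (q1 y) (q2 y) != 0 by rewrite gt_eqF // (mixed_gram_gt0 _ _ _ _ (PE _ Uy)).
have in1 : q1 y \in plane (P y).
  by rewrite PE //; apply/span2P; exists 1, 0; rewrite scale0r addr0 scale1r.
have in2 : q2 y \in plane (P y).
  by rewrite PE //; apply/span2P; exists 0, 1; rewrite scale0r add0r scale1r.
have l1 := derive_trpair _ h _ _ _ (d1 w) (hP _ in1).
have l2 := derive_trpair _ h _ _ _ (d2 w) (hP _ in2).
have ls := derive_trpair _ h _ _ _ (ds w) (hP _ (sP _ Vy)).
rewrite w1 in l1; rewrite w2 in l2.
have [ca cb] := coord_forcont _ _ _ _ _ _ g0 c1 c2 cs.
have cl : (fun t : R => t *: w + y) @ 0^' --> y.
  have : continuous_at (0 : R) (fun t : R => t *: w + y).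
    exact: (forcontDv _ _ _ _ _ _ (forcontZv _ _ _ id _ _ cvg_id
      (forcontCv _ _ _ w 0)) (forcontCv _ _ _ y 0)).
  rewrite /continuous_at scale0r add0r => cl.
  by move=> B /cl cB; exact: (nbhs_dnbhs cB).
have la := cvg_comp _ _ cl ca; have lb := cvg_comp _ _ cl cb.
pose a t := fst_coord (q1 (t *: w + y)) (q2 (t *: w + y)) (s (t *: w + y)).
pose b t := snd_coord (q1 (t *: w + y)) (q2 (t *: w + y)) (s (t *: w + y)).
pose quot (q : 'rV[R]_2 -> 'rV[R]_4) t := t^-1 * trpair h (q (t *: w + y)).
pose g t := a t * quot q1 t + b t * quot q2 t.
have lim0 : g t @[t --> (0:R)^'] --> (0 : R).
  have l1' : quot q1 @ (0:R)^' --> (0 : R) by exact: l1.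
  have l2' : quot q2 @ (0:R)^' --> (0 : R) by exact: l2.
  have la' : a @ (0:R)^' --> fst_coord (q1 y) (q2 y) (s y) by exact: la.
  have lb' : b @ (0:R)^' --> snd_coord (q1 y) (q2 y) (s y) by exact: lb.
  have e : (0:R) = fst_coord (q1 y) (q2 y) (s y) * 0 +
      snd_coord (q1 y) (q2 y) (s y) * 0 by rewrite !mulr0 addr0.
  by rewrite [X in _ --> X]e; apply: cvgD; apply: cvgM.
have e0 : trpair h ('D_w s y) = 0.
  apply: (@cvg_unique _ _ (quot s t @[t --> (0:R)^'])) => //.
  have E : {near (0:R)^', g =1 quot s}.
    have nUV : \forall z \near y, U z /\ V z.
      by apply: filterI; exact: open_nbhs_nbhs.
    near=> t.
    have [Uz Vz] : U (t *: w + y) /\ V (t *: w + y) by near: t; exact: (cl _ nUV).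
    have := sP _ Vz; rewrite PE // => /span2P[a' [b' sE]].
    have gz : gram (q1 (t *: w + y)) (q2 (t *: w + y)) != 0.
      by rewrite gt_eqF // (mixed_gram_gt0 _ _ _ _ (PE _ Uz)).
    have [ea eb] := frame_coordE _ _ _ a' b' gz.
    by rewrite -sE in ea eb; rewrite /g /a /b /quot ea eb sE trpairDr !trpairZr; ring.
  exact: (cvg_trans (near_eq_cvg E) lim0).
have := hP _ dr; rewrite trpairBr e0 sub0r => /eqP; rewrite oppr_eq0 => /eqP e1.
by have := trpair_gt0 _ _ _ ph hn0 pr; rewrite e1 ltxx.
Unshelve. all: by end_near. Qed.

Lemma span2_orth (R : realType) (h q1 q2 : 'rV[R]_4) :
  (forall q, q \in <<[:: q1; q2]>>%VS -> trpair h q = 0) <->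
  trpair h q1 = 0 /\ trpair h q2 = 0.
Proof.
split=> [H|[e1 e2] q /span2P[a [b ->]]]; last first.
  by rewrite trpairDr !trpairZr e1 e2 !mulr0 addr0.
split; apply: H; apply/span2P.
  by exists 1, 0; rewrite scale0r addr0 scale1r.
by exists 0, 1; rewrite scale0r add0r scale1r.
Qed.

Lemma center_forcont (R : realType) (P : 'rV[R]_2 -> mixed_plane R)
    (y0 : 'rV[R]_2) (D : set 'rV[R]_2) :
  gr_smooth_on D P -> D y0 -> {for y0, continuous (fun y => geo_center (P y))}.
Proof.
move=> sm /sm[U [q1 [q2 [[oU Uy] s1 s2 PE]]]].
have [_ _ c1] := smooth_strict _ _ _ _ oU Uy s1.
have [_ _ c2] := smooth_strict _ _ _ _ oU Uy s2.
have g0 : gram (q1 y0) (q2 y0) != 0.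
  by rewrite gt_eqF // (mixed_gram_gt0 _ _ _ _ (PE _ Uy)).
have cE y : U y -> geo_center (P y) = hadj (orth_part (q1 y) (q2 y) unit_form).
  move=> Uy'; apply: (center_unique _ (P y)); first exact: centerP.
  by apply: orth_part_center; exact: PE.
have [ca cb] := coord_forcont _ _ _ _ _ _ g0 c1 c2 (forcontCv _ _ _ unit_form y0).
have cf : {for y0, continuous
    (fun y => hadj (orth_part (q1 y) (q2 y) unit_form))}.
  apply: hadj_forcont.
  exact: (forcontBv _ _ _ _ _ _ (forcontCv _ _ _ unit_form y0)
    (forcontDv _ _ _ _ _ _ (forcontZv _ _ _ _ _ _ ca c1)
      (forcontZv _ _ _ _ _ _ cb c2))).
have nU : nbhs y0 U by exact: open_nbhs_nbhs.
have E : {near y0, (fun y => hadj (orth_part (q1 y) (q2 y) unit_form)) =1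
    (fun y => geo_center (P y))}.
  by near=> y; rewrite cE //; near: y; exact: nU.
rewrite /prop_for /continuous_at cE //.
exact: (cvg_trans (near_eq_cvg E) cf).
Unshelve. all: by end_near. Qed.

Definition fitting_at {R : realType} (P : 'rV[R]_2 -> mixed_plane R)
    (y : 'rV[R]_2) : Prop :=
  forall w, w != 0 -> exists q r, gr_diff P y w q r /\ pos_def (herm r).

Lemma chart_loc_inj (R : realType) (P : 'rV[R]_2 -> mixed_plane R)
    (y0 : 'rV[R]_2) (D : set 'rV[R]_2) (h0 : 'rV[R]_4) :
  gr_smooth_on D P -> D y0 -> fitting_at P y0 -> fiber (P y0) h0 ->
  exists2 d : R, 0 < d & forall h y1 y2, ball h0 d h -> ball y0 d y1 ->
    ball y0 d y2 -> fiber (P y1) h -> fiber (P y2) h -> y1 = y2.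
Proof.
move=> sm /sm[U [q1 [q2 [[oU Uy] s1 s2 PE]]]] fit [p0 f0].
have [sd1 _ _] := smooth_strict _ _ _ _ oU Uy s1.
have [sd2 _ _] := smooth_strict _ _ _ _ oU Uy s2.
have inj := fitting_injective _ _ _ _ _ _ oU Uy s1 s2 PE fit _
  (pos_psd _ _ p0) (pos_neq0 _ _ p0) f0.
have /nbhs_ballP[rho rho0 hrho] : nbhs y0 U by exact: open_nbhs_nbhs.
move: f0; rewrite PE // => /span2_orth[e1 e2].
have [eta [d [psi [/andP[eta0 _] d0 _ uniq]]]] :=
  implicit_solution _ _ _ _ _ _ _ _ rho0 sd1 sd2 e1 e2 inj.
pose m := Num.min rho (Num.min eta d).
exists m; first by rewrite !lt_min rho0 eta0.
have [mr me md] : [/\ m <= rho, m <= eta & m <= d].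
  by rewrite /m !ge_min !lexx ?orbT.
move=> h y1 y2 Bh B1 B2 [_ f1] [_ f2].
have Bh' := le_ball md Bh.
have key y : ball y0 m y -> (forall q, q \in plane (P y) -> trpair h q = 0) ->
    y = psi h.
  move=> By; rewrite PE; last by apply: hrho; exact: le_ball By.
  move=> /span2_orth[t1 t2]; apply: uniq => //.
  by move: By; rewrite -ball_normE /= => By; apply: le_trans (ltW By) me.
by rewrite (key _ B1 f1) (key _ B2 f2).
Qed.

(** The size [e] must not depend on [h], which varies in a noncompact fiber. Scaled to trace 1, [h]
    stays in the compact [psd_slice]. Near a form [h0] that annihilates [P y0], possibly an endpoint
    at infinity, [implicit_solution] applies; near any other [h0], no [h] annihilates a plane [P y]
    with [y] close to [y0], and nothing is to be solved. *)
Lemma chart_sections (R : realType) (P : 'rV[R]_2 -> mixed_plane R)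
    (y0 : 'rV[R]_2) (D : set 'rV[R]_2) (rho : R) :
  gr_smooth_on D P -> D y0 -> fitting_at P y0 -> 0 < rho ->
  exists2 e : R, 0 < e < 1 & forall y h, ball y0 e y -> fiber (P y) h ->
    exists psi : 'rV[R]_4 -> 'rV[R]_2, psi h = y /\
      forall k, cnear e h k -> [/\ ball y0 rho (psi k), fiber (P (psi k)) k &
        {for k, continuous psi}].
Proof.
move=> sm /sm[U [q1 [q2 [[oU Uy] s1 s2 PE]]]] fit rho0.
have [sd1 _ c1] := smooth_strict _ _ _ _ oU Uy s1.
have [sd2 _ c2] := smooth_strict _ _ _ _ oU Uy s2.
have inj := fitting_injective _ _ _ _ _ _ oU Uy s1 s2 PE fit.
have /nbhs_ballP[r r0 hr] : nbhs y0 U by exact: open_nbhs_nbhs.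
pose rr := Num.min r rho / 2.
have rr0 : 0 < rr by rewrite divr_gt0 // lt_min r0.
have [rr1 rr2] : rr < r /\ rr < rho.
  have h1 : Num.min r rho <= r by rewrite ge_min lexx.
  have h2 : Num.min r rho <= rho by rewrite ge_min lexx orbT.
  by move: rr0; rewrite /rr; split; lra.
pose Q (e : R) (h : 'rV[R]_4) := forall y, ball y0 e y ->
  trpair h (q1 y) = 0 -> trpair h (q2 y) = 0 ->
  exists psi : 'rV[R]_4 -> 'rV[R]_2, psi h = y /\
    forall k, cnear e h k -> [/\ `|y0 - psi k| <= rr,
      trpair k (q1 (psi k)) = 0, trpair k (q2 (psi k)) = 0 &
      {for k, continuous psi}].
have cov : \forall e \near (0:R)^'+, psd_slice `<=` Q e.
  have /compact_near_coveringP/near_covering_withinP cpt := psd_slice_compact R.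
  apply: cpt => h0 [ph0 th0].
  have hn0 : h0 != 0.
    apply: contra_eq_neq th0 => ->; rewrite /htr !mxE addr0.
    by rewrite eq_sym oner_neq0.
  have [[e1 e2]|ne] := pselect (trpair h0 (q1 y0) = 0 /\ trpair h0 (q2 y0) = 0).
    have inj0 := inj h0 ph0 hn0; rewrite PE // in inj0.
    have {}inj0 := inj0 (iffRL (span2_orth _ _ _ _) (conj e1 e2)).
    have [eta [d [psi [/andP[eta0 etar] d0 sol uniq]]]] :=
      implicit_solution _ _ _ _ _ _ _ _ rr0 sd1 sd2 e1 e2 inj0.
    (* By [cnear_norm], [k] is at distance less than [d / 2 + 3 d / 8 < d] from [h0], where [psi] is
       defined; [e < eta] puts [y] in the range of uniqueness, so that [psi h = y]. *)
    exists (ball h0 (d / 2), [set e | 0 < e /\ e < Num.min eta (d / 8)]).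
      split; first by apply: nbhsx_ballx; rewrite divr_gt0.
      apply: filterI; first exact: nbhs_right_gt.
      by apply: nbhs_right_lt; rewrite lt_min eta0 divr_gt0.
    move=> [h e] /= [Bh [e0]]; rewrite lt_min => /andP[eeta ed] [ph th].
    have Bd : ball h0 d h by apply: le_ball Bh; lra.
    move=> y By t1 t2; exists psi; split.
      apply/esym/uniq => //; move: By; rewrite -ball_normE /= => By; lra.
    move=> k hk; have hd := cnear_norm _ _ _ _ e0 ph th hk.
    have Bk : ball h0 d k.
      move: Bh; rewrite -!ball_normE /= => Bh; rewrite -(subrKA h).
      apply: (le_lt_trans (ler_normD _ _)); lra.
    have [Bp f1 f2 cp] := sol _ Bk; split=> //; exact: le_trans etar.
  have [A [V [nA nV AV]]] : exists (A : set 'rV[R]_2) (V : set 'rV[R]_4),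
      [/\ nbhs y0 A, nbhs h0 V & forall y h, A y -> V h ->
        ~ (trpair h (q1 y) = 0 /\ trpair h (q2 y) = 0)].
    have main (q : 'rV[R]_2 -> 'rV[R]_4) : {for y0, continuous q} ->
        trpair h0 (q y0) != 0 -> exists (A : set 'rV[R]_2) (V : set 'rV[R]_4),
        [/\ nbhs y0 A, nbhs h0 V & forall y h, A y -> V h ->
          trpair h (q y) != 0].
      move=> cq t0.
      have cz : {for (y0, h0), continuous
          (fun z : 'rV[R]_2 * 'rV[R]_4 => trpair z.2 (q z.1))}.
        apply: trpair_forcont; first exact: cvg_snd.
        apply: (@continuous_comp _ _ _ fst q); first exact: cvg_fst.
        exact: cq.
      have : \forall x \near trpair h0 (q y0), x != 0.
        by apply: open_nbhs_nbhs; split => //; exact: open_neq.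
      move=> /(cz _) [[A V] /= [nA nV] AV]; exists A, V; split=> // y h Ay Vh.
      exact: (AV (y, h)).
    have [t1|t1] := eqVneq (trpair h0 (q1 y0)) 0; last first.
      have [A [V [nA nV AV]]] := main _ c1 t1.
      by exists A, V; split=> // y h Ay Vh [e _]; move: (AV _ _ Ay Vh); rewrite e eqxx.
    have [t2|t2] := eqVneq (trpair h0 (q2 y0)) 0; first by case: ne.
    have [A [V [nA nV AV]]] := main _ c2 t2.
    by exists A, V; split=> // y h Ay Vh [_ e]; move: (AV _ _ Ay Vh); rewrite e eqxx.
  move/nbhs_ballP : nA => [a a0 hA].
  exists (V, [set e | e < a]).
    by split => //; exact: nbhs_right_lt.
  move=> [h e] /= [Vh ea] _ y By t1 t2; case: (AV y h) => //.
  by apply: hA; apply: le_ball By; exact: ltW.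
have : \forall e \near (0:R)^'+, (0 < e /\ e < Num.min 1 r) /\ psd_slice `<=` Q e.
  apply: filterI => //; apply: filterI; first exact: nbhs_right_gt.
  by apply: nbhs_right_lt; rewrite lt_min ltr01.
case/filter_ex => e [[e0]]; rewrite lt_min => /andP[e1 er] Qe.
exists e; first by rewrite e0.
move=> y h By [ph fh].
have t0 : 0 < htr h by rewrite addr_gt0 //; [case: ph|exact: pos_cone3].
pose t := (htr h)^-1; have tp : 0 < t by rewrite invr_gt0.
have sl : psd_slice (t *: h).
  split; first by apply: pos_psd; exact: pos_coneZ.
  by rewrite /htr !mxE -mulrDr mulVf // gt_eqF.
have Uy' : U y by apply: hr; apply: le_ball By; exact: ltW.
move: fh; rewrite PE // => /span2_orth[f1 f2].
have [||psi [psih hpsi]] := Qe _ sl y By.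
- by rewrite trpairZl f1 mulr0.
- by rewrite trpairZl f2 mulr0.
exists (fun k => psi (t *: k)); split=> // k hk.
have [Bk g1 g2 ck] := hpsi _ (cnearZ _ _ _ _ _ tp hk).
have Bp : ball y0 r (psi (t *: k)) by rewrite -ball_normE /=; exact: le_lt_trans rr1.
split.
- by rewrite -ball_normE /=; exact: le_lt_trans rr2.
- split; first exact: cnear_pos hk.
  rewrite PE; last exact: hr.
  apply/span2_orth; rewrite !trpairZl in g1 g2.
  by split; [move/eqP: g1|move/eqP: g2]; rewrite mulf_eq0 gt_eqF //= => /eqP.
- have ct : {for k, continuous (fun k : 'rV[R]_4 => t *: k)}.
    exact: (forcontZv _ _ _ _ id k (forcontC _ _ t k) cvg_id).
  exact: (continuous_comp ct ck).
Qed.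

(** * The geodesics of an equivariant fitting immersion *)

Lemma herm_act_continuous (R : realType) (m : 'M[complex R]_2) :
  continuous (@herm_act R m).
Proof.
have -> : @herm_act R m = fun k => k 0 0 *: herm_act m (delta_mx 0 0) +
    (k 0 1 *: herm_act m (delta_mx 0 1) + (k 0 2 *: herm_act m (delta_mx 0 2) +
    k 0 3 *: herm_act m (delta_mx 0 3))).
  apply/funext => k.
  have kE : k = k 0 0 *: delta_mx 0 0 + (k 0 1 *: delta_mx 0 1 +
      (k 0 2 *: delta_mx 0 2 + k 0 3 *: delta_mx 0 3)).
    rewrite {1}(row_sum_delta k) !big_ord_recl big_ord0 addr0.
    by congr (_ + (k _ _ *: delta_mx _ _ + (k _ _ *: delta_mx _ _ +
      k _ _ *: delta_mx _ _))); apply/val_inj.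
  by rewrite {1}kE 3!herm_act_linear herm_actZ.
move=> k; have t i := forcontZv R _ _ _ _ _ (forcont_coord R 4 k i)
  (forcontCv R _ _ (herm_act m (delta_mx 0 i)) k).
exact: (forcontDv _ _ _ _ _ _ (t 0) (forcontDv _ _ _ _ _ _ (t 1)
  (forcontDv _ _ _ _ _ _ (t 2) (t 3)))).
Qed.

Lemma herm_act_clt (R : realType) (m : 'M[complex R]_2) (k l : 'rV[R]_4) :
  \det m = 1 -> clt k l -> clt (herm_act m k) (herm_act m l).
Proof.
move=> dm; rewrite /clt => /(herm_act_pos _ _ _ dm).
by rewrite -[l - k]addrC -scaleN1r herm_act_linear scaleN1r addrC.
Qed.

Lemma herm_act_cnear (R : realType) (m : 'M[complex R]_2) (e : R)
    (h k : 'rV[R]_4) :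
  \det m = 1 -> cnear e h k -> cnear e (herm_act m h) (herm_act m k).
Proof.
move=> dm [h1 h2]; split; rewrite -herm_actZ; exact: herm_act_clt.
Qed.

(** A section of this relation is an inverse branch of the developing map. *)
Definition dev_graph {R : realType} {X : topologicalType}
    (u : X -> mixed_plane R) : set (X * 'rV[R]_4) :=
  [set z | fiber (u z.1) z.2].

Definition chart_fitting {R : realType} {X : topologicalType}
    (B : set (chart R X)) (u : X -> mixed_plane R) : Prop :=
  forall phi, B phi -> gr_smooth_on (chart_img phi) (u \o chart_inv phi) /\
    forall y, chart_img phi y -> fitting_at (u \o chart_inv phi) y.

Lemma dev_loc_inj (R : realType) (X : topologicalType) (B : set (chart R X))
    (u : X -> mixed_plane R) :
  (forall x, exists2 phi, B phi & chart_dom phi x) -> chart_fitting B u ->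
  locally_injective (dev_graph u).
Proof.
move=> cov fit x h fxh; have [phi Bphi dx] := cov x.
have [sm ft] := fit _ Bphi.
have ix : chart_img phi (chart_map phi x) by exists x.
have mK z : chart_dom phi z -> chart_inv phi (chart_map phi z) = z.
  by move=> dz; rewrite (chart_mapK (c := phi)) ?in_setE.
have [|d d0 hd] := chart_loc_inj _ _ _ _ h sm ix (ft _ ix).
  by rewrite /= mK.
exists (chart_dom phi `&` chart_map phi @^-1` ball (chart_map phi x) d),
  (ball h d); split.
- apply: filterI; first by apply: open_nbhs_nbhs; split => //; exact: chart_dom_open.
  apply: (chart_map_cts (c := phi)); first by rewrite in_setE.
  exact: nbhsx_ballx.
- exact: nbhsx_ballx.
move=> k Bk x1 x2 [d1 B1] [d2 B2] f1 f2.
rewrite -(mK _ d1) -(mK _ d2); congr (chart_inv phi _).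
by apply: (hd k) => //; rewrite /= mK.
Qed.

Lemma local_sections (R : realType) (X : topologicalType) (B : set (chart R X))
    (u : X -> mixed_plane R) (x : X) (K : set X) :
  (forall x, exists2 phi, B phi & chart_dom phi x) -> chart_fitting B u ->
  nbhs x K -> exists2 e : R, 0 < e < 1 & \forall x' \near x, forall h,
    fiber (u x') h -> exists s : 'rV[R]_4 -> X, s h = x' /\
      forall k, cnear e h k -> [/\ K (s k), fiber (u (s k)) k &
        {for k, continuous s}].
Proof.
move=> cov fit nK; have [phi Bphi dx] := cov x.
have [sm ft] := fit _ Bphi.
have ix : chart_img phi (chart_map phi x) by exists x.
have mK z : chart_dom phi z -> chart_inv phi (chart_map phi z) = z.
  by move=> dz; rewrite (chart_mapK (c := phi)) ?in_setE.
have [rho rho0 hrho] := chart_ball _ _ _ _ _ dx nK.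
have [e e01 he] := chart_sections _ _ _ _ _ sm ix (ft _ ix) rho0.
have e0 : 0 < e by case/andP: e01.
exists e => //.
have near1 : \forall x' \near x, chart_dom phi x'.
  by apply: open_nbhs_nbhs; split => //; exact: chart_dom_open.
have near2 : \forall x' \near x, ball (chart_map phi x) e (chart_map phi x').
  apply: (chart_map_cts (c := phi)); first by rewrite in_setE.
  exact: nbhsx_ballx.
apply: filterS2 near1 near2 => x' d' B' h fh.
have [|psi [psih hpsi]] := he _ h B'; first by rewrite /= mK.
exists (chart_inv phi \o psi); split; first by rewrite /= psih mK.
move=> k /hpsi[Bk fk ck]; have [ik Kk] := hrho _ Bk; split=> //.
apply: continuous_comp; first exact: ck.
by apply: (chart_inv_cts (c := phi)); rewrite in_setE.
Qed.

Lemma center_continuous (R : realType) (X : topologicalType)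
    (B : set (chart R X)) (u : X -> mixed_plane R) :
  (forall x, exists2 phi, B phi & chart_dom phi x) -> chart_fitting B u ->
  continuous (fun x => geo_center (u x)).
Proof.
move=> cov fit x; have [phi Bphi dx] := cov x.
have [sm ft] := fit _ Bphi.
have ix : chart_img phi (chart_map phi x) by exists x.
have mK z : chart_dom phi z -> chart_inv phi (chart_map phi z) = z.
  by move=> dz; rewrite (chart_mapK (c := phi)) ?in_setE.
have cc := center_forcont _ _ _ _ sm ix.
have cp : {for x, continuous (chart_map phi)}.
  by apply: (chart_map_cts (c := phi)); rewrite in_setE.
have c1 := continuous_comp cp cc.
have near1 : \forall x' \near x, chart_dom phi x'.
  by apply: open_nbhs_nbhs; split => //; exact: chart_dom_open.
have E : {near x, ((fun y => geo_center ((u \o chart_inv phi) y)) \o chart_map phi)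
    =1 (fun x => geo_center (u x))}.
  by apply: filterS near1 => z dz; rewrite /= mK.
rewrite /continuous_at -[X in _ --> geo_center (u X)](mK _ dx).
exact: (cvg_trans (near_eq_cvg E) c1).
Qed.

Lemma fiber_act (R : realType) (X : Type) (Gamma : groupType)
    (act : Gamma -> X -> X) (rho : Gamma -> 'M[complex R]_2)
    (u : X -> mixed_plane R) (gamma : Gamma) (x : X) (h : 'rV[R]_4) :
  SL2_representation rho -> equivariant act rho u ->
  fiber (u x) h -> fiber (u (act gamma x)) (herm_act (rho gamma) h).
Proof. by move=> [d1 _ _] eq; apply: fiber_equivariant. Qed.

(** Compactness of [S] gives one [e] for some lift of each point; deck transformations carry it to
    all lifts because [cnear] is invariant under SL(2, C). A single [g] brings the image of the
    whole interval into [K], which is the bounded displacement behind the count of letters. *)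
Lemma uniform_sections (R : realType) (S X : topologicalType) (p : X -> S)
    (B : set (chart R X)) (Gamma : groupType) (act : Gamma -> X -> X)
    (rho : Gamma -> 'M[complex R]_2) (u : X -> mixed_plane R) (K : set X) :
  compact [set: S] -> covering_map p ->
  (forall s, exists2 x, p x = s & nbhs x K) ->
  (forall x, act 1%g x = x) ->
  (forall g d x, act (g * d)%g x = act g (act d x)) ->
  (forall g, continuous (act g)) ->
  (forall x x', p x = p x' -> exists g, act g x = x') ->
  SL2_representation rho -> equivariant act rho u ->
  (forall x, exists2 phi, B phi & chart_dom phi x) -> chart_fitting B u ->
  exists2 e : R, 0 < e < 1 & forall x h, fiber (u x) h ->
    exists s : 'rV[R]_4 -> X, exists g, s h = x /\
      forall k, cnear e h k -> [/\ K (act g (s k)), fiber (u (s k)) k &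
        {for k, continuous s}].
Proof.
move=> /compact_near_coveringP cS covp KS act1 actM actc trans hrho eqv cov fit.
have [drho rho1 rhoM] := hrho.
pose Q (e : R) (s0 : S) := forall x h, p x = s0 -> fiber (u x) h ->
  exists s : 'rV[R]_4 -> X, exists g, s h = x /\
    forall k, cnear e h k -> [/\ K (act g (s k)), fiber (u (s k)) k &
      {for k, continuous s}].
have h0 : \forall e \near (0:R)^'+, [set: S] `<=` Q e.
  apply: cS => s0 _; have [x1 px1 nK] := KS s0.
  have [e1 /andP[e10 e11] good] := local_sections _ _ _ _ _ _ cov fit nK.
  have := covering_near _ _ _ _ _ covp good; rewrite px1 => near_s.
  exists ([set s' | exists2 x', p x' = s' & forall h,
    fiber (u x') h -> exists s : 'rV[R]_4 -> X, s h = x' /\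
      forall k, cnear e1 h k -> [/\ K (s k), fiber (u (s k)) k &
        {for k, continuous s}]], [set e | e < e1]).
    by split; [exact: near_s|exact: nbhs_right_lt].
  move=> [s' e] /= [[x' px' hx'] ee1] x h px fh.
  have [g gx] : exists g, act g x = x' by apply: trans; rewrite px.
  have fgh := fiber_act _ _ _ _ _ _ g _ _ hrho eqv fh; rewrite gx in fgh.
  have [s [sh hs]] := hx' _ fgh.
  (* The section found at [x' = act g x] is conjugated back to [x]. *)
  exists (act g^-1%g \o s \o herm_act (rho g)), g; split.
    by rewrite /= sh -gx -actM mulVg act1.
  move=> k hk; have hk' : cnear e1 (herm_act (rho g) h) (herm_act (rho g) k).
    apply: herm_act_cnear => //; apply: (cnear_le _ e) hk; first exact: ltW.
    by case: fh.
  have [Ks fs cs] := hs _ hk'; split.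
  - by rewrite /= -actM mulgV act1.
  - have := fiber_act _ _ _ _ _ _ g^-1%g _ _ hrho eqv fs.
    by rewrite -herm_actM -rhoM mulVg rho1 herm_act1.
  - have c1 : {for k, continuous (herm_act (rho g))} by exact: herm_act_continuous.
    have c2 := continuous_comp c1 cs.
    by apply: (continuous_comp c2); exact: actc.
have : \forall e \near (0:R)^'+, (0 < e /\ e < 1) /\ [set: S] `<=` Q e.
  apply: filterI => //; apply: filterI; first exact: nbhs_right_gt.
  by apply: nbhs_right_lt.
case/filter_ex => e [[e0 e1] Qe]; exists e; first by rewrite e0.
by move=> x h; exact: (Qe (p x)).
Qed.

(** * Exhaustion of the cone by order intervals and the global section *)

Lemma bernoulli_ineq (R : realType) (mu : R) (n : nat) :
  0 <= mu -> 1 + n%:R * mu <= (1 + mu) ^+ n.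
Proof.
move=> mu0; elim: n => [|n IH]; first by rewrite expr0 mul0r addr0.
rewrite exprS -natr1; apply: (@le_trans _ _ ((1 + mu) * (1 + n%:R * mu))).
  by have := mulr_ge0 (ler0n R n) (mulr_ge0 mu0 mu0); nra.
by rewrite ler_wpM2l // addr_ge0.
Qed.

(** For [1 < r], the ball of radius [ln r] about [h0] in Thompson's part metric. *)
Definition clt_annulus {R : realType} (h0 : 'rV[R]_4) (r : R) : set 'rV[R]_4 :=
  [set h | clt (r^-1 *: h0) h /\ clt h (r *: h0)].

Lemma clt_annulus_le (R : realType) (h0 : 'rV[R]_4) (r r' : R) :
  pos_cone h0 -> 0 < r -> r < r' -> clt_annulus h0 r `<=` clt_annulus h0 r'.
Proof.
move=> p0 r0 rr h [h1 h2]; split.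
  apply: clt_trans h1; apply: clt_scale => //.
  by rewrite ltf_pV2 // posrE; exact: lt_trans rr.
by apply: (clt_trans _ _ _ _ h2); exact: clt_scale.
Qed.

Lemma clt_annulus_near (R : realType) (h0 : 'rV[R]_4) (e : R) :
  0 < e < 1 -> pos_cone h0 -> clt_annulus h0 (1 + e / 2) `<=` cnear e h0.
Proof.
move=> /andP[e0 e1] p0 h [h1 h2]; split.
  apply: clt_trans h1; apply: clt_scale => //.
  rewrite -[ltRHS]mul1r ltr_pdivlMr; last lra.
  by have : 0 < e * e by [rewrite mulr_gt0]; nra.
by apply: (clt_trans _ _ _ _ h2); apply: clt_scale => //; lra.
Qed.

(* The shrinking step: moving [h] towards [h0] inside the cone order divides
   the annulus radius by [1 + mu], at the price of a [cnear]-small move. *)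
Lemma clt_annulus_shrink (R : realType) (h0 h : 'rV[R]_4) (d r0 r mu : R) :
  0 < d < 1 -> 1 < r0 -> r0 <= r -> pos_cone h0 ->
  mu = d * (1 - r0 ^- 2) / 3 ->
  clt_annulus h0 ((1 + mu) * r) h ->
  exists2 y, clt_annulus h0 r y & cnear d y h.
Proof.
move=> /andP[d0 d1] r01 rr p0 muE [h1 h2].
have r00 : 0 < r0 by lra.
have rp : 0 < r by lra.
have i0 : 0 < r0 ^- 2 by rewrite invr_gt0 exprn_gt0.
have i1 : r0 ^- 2 < 1 by rewrite invf_lt1 ?exprn_gt0 // exprn_egt1.
have mu0 : 0 < mu by rewrite muE divr_gt0 // mulr_gt0 // subr_gt0.
have mud : 3 * mu = d * (1 - r0 ^- 2) by rewrite muE; field; rewrite gt_eqF.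
have mud' : 3 * mu < d by rewrite mud -[ltRHS]mulr1 ltr_pM2l //; lra.
pose k := 1 + mu; have k0 : 0 < k by rewrite addr_gt0.
(* With this [c], the term [c *: h0] is below [d *: h], so [z = h + c *: h0] lies between [h] and
   [(1 + d) *: h]; and [l] makes the lower bound of [l *: z] exactly [r^-1 *: h0]. *)
pose c := d / (k * r); have c0 : 0 < c by rewrite divr_gt0 // mulr_gt0.
pose l := k / (1 + d); have l0 : 0 < l by rewrite divr_gt0 // addr_gt0.
have ph : pos_cone h by apply: clt_pos h1; apply: pos_coneZ => //; rewrite invr_gt0 mulr_gt0.
pose z := h + c *: h0.
have hz : clt h z by rewrite /clt /z addrC addKr; exact: pos_coneZ.
have ch : clt (c *: h0) (d *: h).
  have := cltZ _ _ _ _ d0 h1; rewrite scalerA -/k.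
  by rewrite /c -[d / (k * r)]/(d * (k * r)^-1).
have zh : clt z ((1 + d) *: h).
  rewrite scalerDl scale1r /z /clt opprD addrACA subrr add0r.
  exact: ch.
exists (l *: z).
  split.
    have low : clt (((k * r)^-1 + c) *: h0) z.
      by rewrite /z scalerDl /clt opprD addrACA subrr addr0.
    have := cltZ _ _ _ _ l0 low; rewrite scalerA.
    suff -> : l * ((k * r)^-1 + c) = r^-1 by [].
    rewrite /l /c; field.
    by rewrite !gt_eqF //; lra.
  have up : clt z ((k * r + c) *: h0).
    rewrite /z scalerDl /clt opprD addrACA subrr addr0; exact: h2.
  apply: (clt_trans _ _ _ _ (cltZ _ _ _ _ l0 up)).
  rewrite scalerA; apply: clt_scale => //.
  have ri : r ^- 2 <= r0 ^- 2.
    by rewrite lef_pV2 ?posrE ?exprn_gt0 // ler_pXn2r // nnegrE ltW.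
  (* This inequality dictates [mu]: [k ^+ 2] stays below [1 + 3 * mu = 1 + d * (1 - r0 ^- 2)]. Since
     [r0 <= r], one [mu] works for all radii. *)
  have k2 : k ^+ 2 + d * r ^- 2 < 1 + d.
    have : k ^+ 2 < 1 + 3 * mu by rewrite /k; nra.
    rewrite mud; have := ler_wpM2l (ltW d0) ri; lra.
  have -> : l * (k * r + c) = r * ((k ^+ 2 + d * r ^- 2) / (1 + d)).
    by rewrite /l /c; field; rewrite !gt_eqF //; lra.
  by rewrite -[ltRHS]mulr1 ltr_pM2l // ltr_pdivrMr ?mul1r //; lra.
split.
  rewrite scalerA.
  have {}zh := cltZ _ _ _ _ (_ : 0 < (1 + d)^-1) zh.
  have i2 : 0 < (1 + d)^-1 by rewrite invr_gt0 addr_gt0.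
  have := zh i2; rewrite scalerA mulVf ?scale1r ?gt_eqF ?addr_gt0 // => zh'.
  apply: clt_trans zh'; apply: clt_scale.
    rewrite /l mulrA ltr_pdivrMr ?addr_gt0 // mulVf ?gt_eqF ?addr_gt0 //.
    by rewrite /k; nra.
  by apply: clt_pos hz.
apply: (clt_trans _ _ _ _ hz); rewrite scalerA -[X in clt X _]scale1r.
apply: clt_scale; last by apply: clt_pos hz.
rewrite /l mulrC divfK ?gt_eqF ?addr_gt0 //.
by rewrite /k; lra.
Qed.

(** The initial radius [1 + e / 2] puts the first annulus inside [cnear e h0], where a local section
    exists. The ratio [1 + mu] of successive radii is constant, so by Bernoulli's inequality the
    radii are unbounded, and [clt_hform] places every positive form in some annulus. *)
Lemma global_section (R : realType) (X : topologicalType)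
    (u : X -> mixed_plane R) (e : R) (x0 : X) (h0 : 'rV[R]_4) :
  hausdorff_space X -> locally_injective (dev_graph u) -> 0 < e < 1 ->
  (forall x h, fiber (u x) h -> exists s : 'rV[R]_4 -> X, s h = x /\
    forall k, cnear e h k -> fiber (u (s k)) k /\ {for k, continuous s}) ->
  fiber (u x0) h0 ->
  exists2 L, is_section (dev_graph u) pos_cone L & L h0 = x0.
Proof.
move=> hX iE e01 sec fh0; have [e0 e1] := andP e01.
have p0 : pos_cone h0 by case: fh0.
pose d := e / 4; have d01 : 0 < d < 1 by rewrite /d; apply/andP; split; lra.
pose r0 := 1 + e / 2; have r01 : 1 < r0 by rewrite /r0; lra.
have r00 : 0 < r0 by lra.
pose mu := d * (1 - r0 ^- 2) / 3.
have mu0 : 0 < mu.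
  have i1 : r0 ^- 2 < 1 by rewrite invf_lt1 ?exprn_gt0 // exprn_egt1.
  by rewrite /mu divr_gt0 // mulr_gt0 ?subr_gt0 //; case/andP: d01.
pose r n := r0 * (1 + mu) ^+ n.
have rS n : r n.+1 = (1 + mu) * r n by rewrite /r exprS mulrCA.
have rge n : r0 <= r n.
  rewrite /r -[leLHS]mulr1 ler_pM2l // (le_trans _ (bernoulli_ineq _ mu n (ltW mu0))) //.
  by rewrite lerDl mulr_ge0 // ltW.
have rp n : 0 < r n by exact: lt_le_trans (rge n).
apply: (section_exhaust X _ (dev_graph u) pos_cone (cnear d) (cnear e)
  (fun n => clt_annulus h0 (r n)) x0 h0 hX iE).
- move=> y py; split; first exact: clt_itv_open.
  + by apply: cnear_refl => //; case/andP: d01.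
  + by apply: cnear_le => //; rewrite /d; lra.
  + exact: cnear_refl.
- move=> x y fy; have [s [sy hs]] := sec x y fy.
  by exists s => // k /hs.
- by move=> y y1 y2 _ p2; apply: cnear_sym => //; rewrite e0 ltW.
- by move=> y y' _ _; exact: clt_itv_connected.
- by move=> n y _; exact: clt_itv_connected.
- move=> n y [y1 _]; apply: clt_pos y1; apply: pos_coneZ => //.
  by rewrite invr_gt0.
- move=> n; apply: clt_annulus_le => //.
  by rewrite rS mulrDl mul1r ltrDl mulr_gt0.
- by move=> n; exact: clt_itv_open.
- move=> n y; rewrite rS => hy.
  exact: (clt_annulus_shrink _ _ _ _ r0 _ mu d01 r01 (rge n) p0 _ hy).
- exact: fh0.
- have r1 : 1 < r 0%N by exact: lt_le_trans (rge 0%N).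
  have := clt_scale _ 1 (r 0%N) _ r1 p0; rewrite scale1r => up.
  split=> //; have ri : (r 0%N)^-1 < 1 by rewrite invf_lt1.
  by have := clt_scale _ _ 1 _ ri p0; rewrite scale1r.
- have -> : r 0%N = 1 + e / 2 by rewrite /r expr0 mulr1.
  exact: clt_annulus_near.
- move=> h ph.
  have c1 := clt_hform _ _ _ p0 ph; have c2 := clt_hform _ _ _ ph p0.
  set a := _ / _ in c1; set b := _ / _ in c2.
  have b0 : 0 < b.
    by rewrite divr_gt0 ?mulr_gt0 ?hform_gt0 //; case: ph.
  have [n hn] : exists n : nat, (Num.max a b) / mu < n%:R.
    by exists (Num.truncn ((Num.max a b) / mu)).+1; rewrite truncnS_gt.
  have mr : Num.max a b < r n.
    rewrite ltr_pdivrMr // in hn; apply: (lt_le_trans hn).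
    have h1 := bernoulli_ineq _ mu n (ltW mu0).
    have h2 : (1 + mu) ^+ n <= r n.
      by rewrite /r ler_peMl ?exprn_ge0 ?addr_ge0 // ltW.
    lra.
  move: mr; rewrite gt_max => /andP[ar br].
  exists n => //; split; last first.
    by apply: (clt_trans _ _ _ _ c1); exact: clt_scale.
  have c3 := clt_trans _ _ _ _ c2 (clt_scale _ _ _ _ br ph).
  have ri : 0 < (r n)^-1 by rewrite invr_gt0.
  have := cltZ _ _ _ _ ri c3.
  by rewrite scalerA mulVf ?scale1r // gt_eqF.
Qed.

(** * Word length and growth *)

Lemma fiber_connected (R : realType) (P : mixed_plane R) : connected (fiber P).
Proof.
apply: convex_connected => x y t [px fx] [py fy] /andP[t0 t1]; split; last first.
  by move=> q Pq; rewrite trpairDl trpairZl trpairBl fx // fy // subrr mulr0 addr0.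
have [->|tn0] := eqVneq t 0; first by rewrite scale0r addr0.
have [->|tn1] := eqVneq t 1; first by rewrite scale1r addrC subrK.
have tp : 0 < t by rewrite lt_neqAle eq_sym tn0.
have tq : 0 < 1 - t by rewrite subr_gt0 lt_neqAle tn1.
have -> : x + t *: (y - x) = (1 - t) *: x + t *: y.
  by rewrite scalerBr scalerBl scale1r addrA addrAC.
by apply: pos_coneD; exact: pos_coneZ.
Qed.

(** Unique lifting is used twice: over [X], where [L] composed with the center map and the identity
    both lift that map and agree at [x0]; then along the convex fiber of [x], starting from its
    center. *)
Lemma section_fiber (R : realType) (X : topologicalType)
    (u : X -> mixed_plane R) (L : 'rV[R]_4 -> X) (x0 x : X) (h : 'rV[R]_4) :
  hausdorff_space X -> locally_injective (dev_graph u) -> connected [set: X] ->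
  continuous (fun x => geo_center (u x)) ->
  is_section (dev_graph u) pos_cone L -> L (geo_center (u x0)) = x0 ->
  fiber (u x) h -> L h = x.
Proof.
move=> hX iE cX cc sL L0 fh.
have cf y : fiber (u y) (geo_center (u y)) by have [] := centerP _ (u y).
have cpos y : pos_cone (geo_center (u y)) by have [] := cf y.
have Lc : L (geo_center (u x)) = x.
  apply: (lift_unique _ _ _ _ [set: X] (fun x => geo_center (u x))
    (fun x => L (geo_center (u x))) id x0 hX iE) => //.
  - exact: continuous_subspaceT.
  - apply: continuous_subspaceT => y; apply: continuous_comp; first exact: cc.
    by have [_] := sL _ (cpos y).
  - by apply: continuous_subspaceT => ?; exact: cvg_id.
  - by move=> y _; have [] := sL _ (cpos y).
  - by move=> y _; exact: cf.
suff H k : fiber (u x) k -> L k = (fun=> x) k by exact: (H h fh).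
move: k; apply: (lift_unique _ _ _ _ (fiber (u x)) id L (fun=> x)
  (geo_center (u x)) hX iE) => //.
- exact: fiber_connected.
- by apply: continuous_subspaceT => ?; exact: cvg_id.
- by apply: is_section_within sL => k [].
- by apply: continuous_subspaceT; exact: cst_continuous.
- by move=> k [pk _]; have [e _] := sL _ pk; exact: e.
Qed.

(** The chain adds growing multiples of [h1] to [h0]. The intervals being scale invariant, the
    multiples can grow geometrically, so the length is logarithmic in [Lam]. [tau 0] is small enough
    for the first addition to be a short step, and the condition on [M] amounts to
    [Lam <= e * tau M], which makes the final removal of [h0] short as well. A multiple of [h1] is a
    sufficient end point because fibers are cones. *)
Lemma cone_chain (R : realType) (e Lam : R) (h0 h1 : 'rV[R]_4) (M : nat) :
  0 < e < 1 -> 0 < Lam -> pos_cone h0 -> pos_cone h1 ->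
  clt h1 (Lam *: h0) -> clt h0 (Lam *: h1) ->
  2 * Lam ^+ 2 <= e ^+ 2 * (1 + e / 2) ^+ M ->
  exists c : nat -> 'rV[R]_4, [/\ c 0 = h0, exists2 t, 0 < t & c M.+2 = t *: h1,
    forall i, pos_cone (c i) & forall i, cnear e (c i) (c i.+1)].
Proof.
move=> /andP[e0 e1] L0 p0 p1 h10 h01 hM.
pose tau j : R := e / (2 * Lam) * (1 + e / 2) ^+ j.
have k0 : 0 < 1 + e / 2 by rewrite addr_gt0 // divr_gt0.
have tau0 j : 0 < tau j by rewrite mulr_gt0 ?exprn_gt0 // divr_gt0 // mulr_gt0.
have tauS j : tau j.+1 = (1 + e / 2) * tau j by rewrite /tau exprS mulrCA.
pose m j := h0 + tau j *: h1.
have pm j : pos_cone (m j) by apply: pos_coneD => //; exact: pos_coneZ.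
(* [h0] has index [0], [m j] has index [j + 1] for [j <= M], and from [M + 2] on the chain is
   constant. *)
pose c i := if i is j.+1 then (if (j <= M)%N then m j else tau M *: h1) else h0.
have pt : pos_cone (tau M *: h1) by exact: pos_coneZ.
have near_up (h k : 'rV[R]_4) : pos_cone h -> pos_cone k -> clt k (e *: h) ->
    cnear e h (h + k).
  move=> ph pk kh; split.
    apply: (clt_trans _ _ h).
      rewrite -[X in clt _ X]scale1r; apply: clt_scale => //; lra.
    by rewrite /clt addrC addKr.
  by rewrite scalerDl scale1r /clt opprD addrACA subrr add0r.
exists c; split=> //; first by exists (tau M); rewrite //= ltnn.
  by case=> [//|j] /=; case: ifP.
case=> [|j].
  rewrite /=; apply: near_up => //; first exact: pos_coneZ.
  have t0 := tau0 0%N; have := cltZ _ _ _ _ t0 h10; rewrite scalerA => h.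
  apply: (clt_trans _ _ _ _ h); apply: clt_scale => //.
  rewrite /tau expr0 mulr1.
  have -> : e / (2 * Lam) * Lam = e / 2 by field; rewrite gt_eqF.
  lra.
rewrite /c; case: (leqP j.+1 M) => jM.
  rewrite (ltnW jM).
  have -> : m j.+1 = m j + (e / 2 * tau j) *: h1.
    by rewrite /m tauS mulrDl mul1r scalerDl addrA.
  apply: near_up => //.
    by apply: pos_coneZ => //; rewrite mulr_gt0 // divr_gt0.
  rewrite /m scalerDr scalerA.
  apply: (@clt_trans _ _ ((e * tau j) *: h1)).
    by apply: clt_scale => //; rewrite ltr_pM2r //; lra.
  by rewrite /clt addrK; exact: pos_coneZ.
case: (leqP j M) => jM'; last exact: cnear_refl.
have {jM jM'}-> : j = M by apply/eqP; rewrite eqn_leq jM'.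
split.
  have tM : Lam <= e * tau M.
    have -> : e * tau M = e ^+ 2 * (1 + e / 2) ^+ M / (2 * Lam).
      by rewrite /tau; field; rewrite gt_eqF.
    rewrite ler_pdivlMr ?mulr_gt0 //; apply: le_trans hM.
    by rewrite expr2; lra.
  have hh : clt ((1 - e) *: h0) ((e * tau M) *: h1).
    apply: (clt_trans _ _ h0).
      by rewrite -[X in clt _ X]scale1r; apply: clt_scale => //; lra.
    have [<-//|ne] := eqVneq Lam (e * tau M).
    apply: (clt_trans _ _ _ _ h01); apply: clt_scale => //.
    by rewrite lt_neqAle ne.
  rewrite /m scalerDr scalerA.
  have -> : tau M *: h1 = (e * tau M) *: h1 + ((1 - e) * tau M) *: h1.
    by rewrite -scalerDl; congr (_ *: _); ring.
  by rewrite /clt opprD addrACA subrr addr0.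
apply: (clt_trans _ _ (m M)).
  by rewrite /clt /m addrK.
by rewrite -[X in clt X _]scale1r; apply: clt_scale => //; lra.
Qed.

(** * The determinant form and the hyperbolic distance *)

Lemma hform_orth (R : realType) (k x : 'rV[R]_4) :
  pos_cone k -> hform k x = 0 -> hdet x <= 0.
Proof.
move=> pk kx; rewrite leNgt; apply/negP => dx.
have x0n : x 0 0 != 0.
  apply: contraTneq dx => e; rewrite /hdet e mul0r -leNgt.
  by have := sqr_ge0 (x 0 1); have := sqr_ge0 (x 0 2); lra.
have [x0|x0] := ltP 0 (x 0 0).
  have px : pos_cone x by split.
  by have := hform_gt0 _ _ _ pk px; rewrite kx ltxx.
have px : pos_cone (- x).
  split; last by rewrite -scaleN1r hdetZ sqrrN expr1n mul1r.
  by rewrite mxE oppr_gt0 lt_neqAle x0n.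
have := hform_gt0 _ _ _ pk px.
by rewrite hformC -scaleN1r hformZl hformC kx mulr0 ltxx.
Qed.

(** The reverse Cauchy-Schwarz inequality: the part of [l] orthogonal to [k] has nonpositive
    determinant [1 - hform k l ^+ 2]. *)
Lemma hform_ge1 (R : realType) (k l : 'rV[R]_4) :
  pos_cone k -> pos_cone l -> hdet k = 1 -> hdet l = 1 -> 1 <= hform k l.
Proof.
move=> pk pl dk dl; have f := hform_gt0 _ _ _ pk pl.
have e : hform k (l - hform k l *: k) = 0.
  by rewrite hformC hformBl hformZl hform_hdet dk mulr1 hformC subrr.
have := hform_orth _ _ _ pk e.
have -> : hdet (l - hform k l *: k) = 1 - hform k l ^+ 2.
  have -> : hdet (l - hform k l *: k) =
      hdet l - 2 * hform k l * hform k l + hform k l ^+ 2 * hdet k.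
    by rewrite /hdet /hform !mxE; field.
  by rewrite dk dl; ring.
rewrite subr_le0 => h; rewrite leNgt; apply/negP => h'.
by have : hform k l ^+ 2 < 1 by [rewrite expr2; nra]; lra.
Qed.

Lemma hform_act (R : realType) (m : 'M[complex R]_2) (k l : 'rV[R]_4) :
  \det m = 1 -> hform (herm_act m k) (herm_act m l) = hform k l.
Proof.
move=> dm; have := hdet_add _ (herm_act m k) (herm_act m l).
have := herm_act_linear _ m 1 k l; rewrite !scale1r => <-.
rewrite (herm_act_hdet _ m (k + l) dm) (herm_act_hdet _ m k dm).
rewrite (herm_act_hdet _ m l dm) (hdet_add _ k l) => /addrI /mulfI e.
by apply/esym/e; rewrite pnatr_eq0.
Qed.

Lemma herm_hadj (R : realType) (k : 'rV[R]_4) :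
  hdet k = 1 -> invmx (herm k) = herm (hadj k).
Proof.
move=> dk; have [h00 h01 h10 h11] := herm_entries _ k.
have [a00 a01 a10 a11] := herm_entries _ (hadj k).
have [e0 e1 e2 e3] := hadjE _ k; rewrite e0 e1 e2 e3 in a00 a01 a10 a11.
have e : herm k *m herm (hadj k) = 1%:M.
  have E (M N : 'M[complex R]_2) i j :
    (M *m N) i j = M i 0 * N 0 j + M i 1 * N 1 j by rewrite mxE sum2.
  have D := dk; rewrite /hdet in D.
  apply: matrix2P; rewrite E ?h00 ?h01 ?h10 ?h11 ?a00 ?a01 ?a10 ?a11
    [RHS]mxE; simpc; congr (_ +i* _)%C; lra.
have [uk _] := mulmx1_unit e.
by rewrite -[RHS]mul1mx -(mulVmx uk) -mulmxA e mulmx1.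
Qed.

Lemma hyp_dist_hform (R : realType) (k l : 'rV[R]_4) :
  hdet k = 1 -> hyp_dist (herm k) (herm l) =
  ln (hform k l + Num.sqrt (hform k l ^+ 2 - 1)).
Proof.
move=> dk; rewrite /hyp_dist herm_hadj // trpair_tr trpair_hadj /=.
by have -> : 2 * hform k l / 2 = hform k l by field.
Qed.

(** With [c = hform k l] the distance is [ln (c + sqrt (c^2 - 1))], and the argument of the
    logarithm lies between [c] and [2 c]. *)
Lemma hyp_dist_bounds (R : realType) (k l : 'rV[R]_4) :
  pos_cone k -> pos_cone l -> hdet k = 1 -> hdet l = 1 ->
  0 <= ln (hform k l) <= hyp_dist (herm k) (herm l) /\
  hyp_dist (herm k) (herm l) <= ln 2 + ln (hform k l).
Proof.
move=> pk pl dk dl; have c1 := hform_ge1 _ _ _ pk pl dk dl.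
rewrite hyp_dist_hform //; set c := hform k l in c1 *.
have s0 := sqrtr_ge0 (c ^+ 2 - 1).
have s1 : Num.sqrt (c ^+ 2 - 1) <= c.
  rewrite -[leRHS]ger0_norm -?sqrtr_sqr; last lra.
  by apply: ler_wsqrtr; lra.
have c0 : 0 < c by lra.
split; last by rewrite -lnM ?posrE // ler_ln ?posrE; lra.
by rewrite ln_ge0 // ler_ln ?posrE; lra.
Qed.

(** * Comparison of word length with hyperbolic displacement *)

Lemma word_growth (R : realType) (Gamma : groupType) (c : Gamma -> R)
    (F : seq Gamma) :
  c 1%g = 1 -> (forall g, 0 < c g) -> (forall g, c g^-1%g = c g) ->
  (forall g h, c (g * h)%g <= 4 * c g * c h) ->
  exists2 Q : R, 2 <= Q & forall g w, words F g w -> c g <= Q ^+ size w.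
Proof.
move=> c1 c0 cV cM.
(* [Q] absorbs the factor [4] once per letter, and [2 <= Q] ensures that [ln Q] is positive. *)
have [Q Q2 hQ] : exists2 Q : R, 2 <= Q & forall a, a \in F -> 4 * c a <= Q.
  elim: F => [|a F [Q Q2 IH]]; first by exists 2.
  exists (Num.max Q (4 * c a)); first by rewrite le_max Q2.
  move=> b; rewrite inE le_max => /orP[/eqP ->|/IH ->//].
  by rewrite lexx orbT.
exists Q => // g w; elim: w g => [|a w IH] g [wF <-].
  by rewrite big_nil c1 expr0.
rewrite big_cons; apply: (le_trans (cM _ _)).
rewrite [size _]/= exprS; apply: ler_pM => //.
- by rewrite mulr_ge0 // ltW.
- exact: ltW.
- by case: (wF a (mem_head _ _)) => /hQ; rewrite ?cV.
- by apply: IH; split=> // b bw; apply: wF; rewrite inE bw orbT.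
Qed.

(** On each interval of the chain, [L] coincides with a local section whose image lies in one
    translate of [K]. The chain has [M + 2] steps and ends on the fiber of [act gamma x0], which
    [gamma^-1] brings back to [x0] in [K]; [chain_word] adds one letter. *)
Lemma fundamental_words (R : realType) (X : topologicalType)
    (Gamma : groupType) (act : Gamma -> X -> X)
    (rho : Gamma -> 'M[complex R]_2) (u : X -> mixed_plane R)
    (K : set X) (F : seq Gamma) (x0 : X) (e : R) :
  hausdorff_space X -> connected [set: X] -> locally_injective (dev_graph u) ->
  continuous (fun x => geo_center (u x)) ->
  (forall x, act 1%g x = x) ->
  (forall g d x, act (g * d)%g x = act g (act d x)) ->
  SL2_representation rho -> equivariant act rho u ->
  K x0 -> (forall g x, K x -> K (act g x) -> g \in F) ->
  0 < e < 1 ->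
  (forall x h, fiber (u x) h ->
    exists s : 'rV[R]_4 -> X, exists g, s h = x /\
      forall k, cnear e h k -> [/\ K (act g (s k)), fiber (u (s k)) k &
        {for k, continuous s}]) ->
  let h0 := geo_center (u x0) in
  forall (gamma : Gamma) (Lam : R) (M : nat), 0 < Lam ->
  clt (herm_act (rho gamma) h0) (Lam *: h0) ->
  clt h0 (Lam *: herm_act (rho gamma) h0) ->
  2 * Lam ^+ 2 <= e ^+ 2 * (1 + e / 2) ^+ M ->
  exists2 w, words F gamma w & (size w <= M.+3)%N.
Proof.
move=> hX cX iE cc act1 actM hrho eqv Kx0 hF e01 sec h0 gamma Lam M L0 up low hM.
have f0 : fiber (u x0) h0 by have [] := centerP _ (u x0).
have [e0 e1] := andP e01.
have [L sL Lh0] := global_section _ _ u e x0 h0 hX iE e01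
  (fun x h fh => let: ex_intro s (ex_intro g (conj a b)) := sec x h fh in
     ex_intro _ s (conj a (fun k hk => let: And3 _ p q := b k hk in conj p q))) f0.
have Lfib x h : fiber (u x) h -> L h = x.
  exact: section_fiber hX iE cX cc sL Lh0.
have step h k : pos_cone h -> cnear e h k ->
    exists g, K (act g (L h)) /\ K (act g (L k)).
  move=> ph hk; have [fLh _] := sL _ ph.
  have [s [g [sh hs]]] := sec _ _ fLh; rewrite /= in sh.
  have hh := cnear_refl _ _ _ e0 ph.
  have S1 : is_section (dev_graph u) (cnear e h) L.
    by move=> l hl; apply: sL; exact: (cnear_pos _ e h).
  have S2 : is_section (dev_graph u) (cnear e h) s.
    by move=> l /hs[_ fl cl].
  have eq : L k = s k.
    apply: (section_unique _ _ _ (cnear e h) (cnear e h) L s h hX iE S1 S2) => //.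
    exact: clt_itv_connected.
  exists g; rewrite eq -sh; split.
    by have [Ks _ _] := hs _ hh.
  by have [Ks _ _] := hs _ hk.
have fg := fiber_act _ _ _ _ _ _ gamma _ _ hrho eqv f0.
have [p0 _] := f0; have [pg _] := fg.
have [c [c0 [t t0 cM] cpos cnr]] := cone_chain _ _ _ _ _ _ e01 L0 p0 pg up low hM.
have [w wF sw] : exists2 w, words F ((gamma^-1)^-1)%g w & (size w <= M.+3)%N.
  apply: (chain_word _ _ act K F x0 (L \o c) M.+2) => //.
  - by rewrite /= c0.
  - by move=> i; exact: step.
  - rewrite /= cM (Lfib _ _ (fiberZ _ _ _ _ t0 fg)) -actM mulVg act1.
    exact: Kx0.
by exists w => //; rewrite -[gamma]invgK.
Qed.

(** The conclusion concerns every base point, whereas the words are counted from [h0] only. The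
    estimates are made at an arbitrary [k], which [al] and [be] compare with [h0] in the order. *)
Lemma quasi_fuchsian_of_words (R : realType) (Gamma : groupType)
    (rho : Gamma -> 'M[complex R]_2) (F : seq Gamma) (h0 : 'rV[R]_4) (e : R) :
  SL2_representation rho -> pos_cone h0 -> 0 < e ->
  (forall (gamma : Gamma) (Lam : R) (M : nat), 0 < Lam ->
    clt (herm_act (rho gamma) h0) (Lam *: h0) ->
    clt h0 (Lam *: herm_act (rho gamma) h0) ->
    2 * Lam ^+ 2 <= e ^+ 2 * (1 + e / 2) ^+ M ->
    exists2 w, words F gamma w & (size w <= M.+3)%N) ->
  quasi_fuchsian rho.
Proof.
move=> [drho rho1 rhoM] p0 e0 hw.
suff main (k : 'rV[R]_4) : pos_cone k -> hdet k = 1 ->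
    exists A B Q : R, [/\ 0 <= A, 0 < B, 2 <= Q,
      (forall g w, words F g w ->
         hform k (herm_act (rho g) k) <= Q ^+ size w) &
      (forall g, exists2 w, words F g w &
         (size w)%:R <= B * ln (hform k (herm_act (rho g) k)) + A)].
  have one : @pos_cone R unit_form /\ hdet (@unit_form R) = 1.
    by have d := (unit_formE _ (0 : 'rV[R]_4)).2; split=> //; split; rewrite ?mxE ?d.
  (* Generation has to be shown before a base point is given; that of [unit_form] is used. *)
  have [A1 [B1 [Q1 [_ _ _ _ gen]]]] := main _ one.1 one.2.
  have ne g : words F g !=set0 by have [w wF _] := gen g; exists w.
  exists F; split; first exact: ne.
  move=> o [po do1].
  have [k pk oE] := pos_def_cone _ _ po.
  have dk : hdet k = 1.
    by move: do1; rewrite oE hdet_det => -[].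
  have [A [B [Q [A0 B0 Q2 upw low]]]] := main _ pk dk.
  have [c cE] : exists c : Gamma -> R, forall g,
    c g = hform k (herm_act (rho g) k) by eexists.
  have pg g : pos_cone (herm_act (rho g) k) by exact: herm_act_pos.
  have dg g : hdet (herm_act (rho g) k) = 1 by rewrite (herm_act_hdet _ _ _ (drho g)).
  have c1 g : 1 <= c g by rewrite cE; exact: hform_ge1.
  have distE g d : hyp_dist (H3_act (rho g) o) (H3_act (rho d) o) =
      hyp_dist (herm k) (herm (herm_act (rho (g^-1 * d)%g) k)).
    rewrite oE -!herm_actE (hyp_dist_hform _ _ _ (dg g)) (hyp_dist_hform _ _ _ dk).
    have -> : herm_act (rho d) k =
        herm_act (rho g) (herm_act (rho (g^-1 * d)%g) k).
      by rewrite -herm_actM -rhoM mulKVg.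
    by rewrite (hform_act _ _ _ _ (drho g)).
  have lnQ : 0 < ln Q by rewrite ln_gt0 //; lra.
  have ln20 : 0 <= ln (2 : R) by rewrite ln_ge0 //; lra.
  (* [B] bounds word length by distance and [ln Q] distance by word length; [ln 2] is the gap
     between the distance and the logarithm of [hform]. *)
  pose Kc := 1 + B + ln Q.
  have Kc1 : 1 <= Kc by rewrite /Kc; lra.
  exists Kc, (A + ln 2); split=> //; first by rewrite addr_ge0.
  move=> g d; rewrite distE; set a := (g^-1 * d)%g.
  have [/andP[l0 l1] l2] := hyp_dist_bounds _ _ _ pk (pg a) dk (dg a).
  set D := hyp_dist _ _ in l1 l2 *; rewrite -cE in l0 l1 l2.
  pose W : set R := [set (size w)%:R | w in words F a].
  have WD : word_dist R F g d = inf W by [].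
  have lbW : has_lbound W by exists 0 => _ [w _ <-].
  have neW : W !=set0 by have [w ww] := ne a; exists (size w)%:R; exists w.
  rewrite WD; apply/andP; split.
    have [w ww sw] := low a; rewrite -cE in sw.
    have h1 : inf W <= (size w)%:R by apply: ge_inf => //; exists w.
    have D0 : 0 <= D by lra.
    have h2 : inf W <= Kc * D + A.
      apply: (le_trans h1); apply: (le_trans sw); rewrite lerD2r.
      apply: (@le_trans _ _ (B * D)); first by rewrite ler_pM2l.
      by rewrite ler_wpM2r // /Kc; lra.
    rewrite lerBlDr mulrC ler_pdivrMr; last lra.
    apply: (le_trans h2); rewrite [leRHS]mulrC mulrDr lerD2l.
    by rewrite -[leLHS]mul1r; apply: ler_pM => //; lra.
  have h3 : (D - ln 2) / ln Q <= inf W.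
    apply: lb_le_inf => // _ [w ww <-]; rewrite ler_pdivrMr // mulr_natl.
    rewrite -lnXn; last lra.
    have : ln (c a) <= ln (Q ^+ size w).
      by rewrite ler_ln ?posrE ?exprn_gt0 //; [rewrite cE; exact: upw|have := c1 a; lra|lra].
    lra.
  rewrite ler_pdivrMr // in h3.
  have i0 : 0 <= inf W by apply: lb_le_inf => // _ [w _ <-].
  have : inf W * ln Q <= Kc * inf W by rewrite mulrC ler_wpM2r // /Kc; lra.
  lra.
move=> pk dk.
have [c cE] : exists c : Gamma -> R, forall g,
  c g = hform k (herm_act (rho g) k) by eexists.
have pg g : pos_cone (herm_act (rho g) k) by exact: herm_act_pos.
have dg g : hdet (herm_act (rho g) k) = 1 by rewrite (herm_act_hdet _ _ _ (drho g)).
have c1 g : 1 <= c g by rewrite cE; exact: hform_ge1.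
have c0 g : 0 < c g by have := c1 g; lra.
have cup g : clt (herm_act (rho g) k) ((2 * c g) *: k).
  by have := clt_hform _ _ _ pk (pg g); rewrite dk divr1 -cE.
have clow g : clt k ((2 * c g) *: herm_act (rho g) k).
  have := clt_hform _ _ _ (pg g) pk; rewrite dg divr1.
  by rewrite (hformC _ (herm_act (rho g) k)) -cE.
(* Applying [cup] twice gives [rho (g h) k < 4 c(g) c(h) k] in the order; pairing with [k] gives the
   inequality between numbers. *)
have cM g h : c (g * h)%g <= 4 * c g * c h.
  have h1 := herm_act_clt _ _ _ _ (drho g) (cup h); rewrite herm_actZ in h1.
  have h20 : 0 < 2 * c h by rewrite mulr_gt0.
  have h2 := cltZ _ _ _ _ h20 (cup g); rewrite scalerA in h2.
  have h3 := hform_gt0 _ _ _ pk (clt_trans _ _ _ _ h1 h2).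
  rewrite hformC hformBl hformZl hform_hdet dk mulr1 in h3.
  rewrite -herm_actM -rhoM (hformC _ (herm_act _ _)) -cE in h3.
  by move: h3; move: (c _) (c g) (c h) => z x y; lra.
have cV g : c g^-1%g = c g.
  have ek : herm_act (rho g) (herm_act (rho g^-1%g) k) = k.
    by rewrite -herm_actM -rhoM mulgV rho1 herm_act1.
  rewrite !cE -(hform_act _ (rho g) k (herm_act (rho g^-1%g) k) (drho g)) ek.
  exact: hformC.
have cc1 : c 1%g = 1 by rewrite cE rho1 herm_act1 hform_hdet.
have [Q Q2 hQ] := word_growth _ _ c F cc1 c0 cV cM.
have a1 := clt_hform _ _ _ p0 pk; have b1 := clt_hform _ _ _ pk p0.
set al := _ / _ in a1; set be := _ / _ in b1.
have al0 : 0 < al by rewrite divr_gt0 ?mulr_gt0 ?hform_gt0 //; case: p0.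
have be0 : 0 < be by rewrite divr_gt0 ?mulr_gt0 ?hform_gt0 // dk.
move: al al0 a1 be be0 b1 => al al0 a1 be be0 b1.
pose Bc := 2 * al * be; have Bc0 : 0 < Bc by apply: mulr_gt0 => //; exact: mulr_gt0.
pose om := ln (1 + e / 2).
have k0 : 0 < 1 + e / 2 by rewrite addr_gt0 // divr_gt0.
have om0 : 0 < om by rewrite /om ln_gt0 //; lra.
have e20 : 0 < e ^+ 2 by rewrite exprn_gt0.
pose A0 := `|ln (2 * Bc ^+ 2 / e ^+ 2)|.
have A00 : 0 <= A0 by exact: normr_ge0.
exists (A0 / om + 4), (2 / om), Q; split=> //.
- by rewrite addr_ge0 // divr_ge0 // ltW.
- by rewrite divr_gt0.
- by move=> g w /hQ; rewrite cE.
move=> g; rewrite -cE; pose Lam := Bc * c g; have L0 : 0 < Lam by rewrite mulr_gt0.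
(* [Y] bounds [ln (2 * Lam ^+ 2 / e ^+ 2)], so any [M] above [Y / om] satisfies the growth
   condition. The choice of [M] as the integer part plus one gives words of length at most
   [Y / om + 4]. *)
pose Y := A0 + 2 * ln (c g).
have lc0 : 0 <= ln (c g) by rewrite ln_ge0.
have Y0 : 0 <= Y / om by rewrite divr_ge0 ?addr_ge0 ?mulr_ge0 // ltW.
pose M := (Num.truncn (Y / om)).+1.
have [|||w wF sw] := hw g Lam M L0.
- (* [g h0 < be (g k) < be (2 c) k < be (2 c) al h0] *)
  have h1 := herm_act_clt _ _ _ _ (drho g) b1; rewrite herm_actZ in h1.
  have h2 := cltZ _ _ _ _ be0 (cup g); rewrite scalerA in h2.
  have t0 : 0 < be * (2 * c g) by rewrite !mulr_gt0.
  have h3 := cltZ _ _ _ _ t0 a1; rewrite scalerA in h3.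
  have := clt_trans _ _ _ _ (clt_trans _ _ _ _ h1 h2) h3.
  by congr (clt _ (_ *: _)); rewrite /Lam /Bc; ring.
- have h1 := cltZ _ _ _ _ be0 (clow g); rewrite scalerA in h1.
  have h2 := herm_act_clt _ _ _ _ (drho g) a1; rewrite herm_actZ in h2.
  have t0 : 0 < be * (2 * c g) by rewrite !mulr_gt0.
  have h3 := cltZ _ _ _ _ t0 h2; rewrite scalerA in h3.
  have := clt_trans _ _ _ _ (clt_trans _ _ _ _ b1 h1) h3.
  by congr (clt _ (_ *: _)); rewrite /Lam /Bc; ring.
- rewrite [leRHS]mulrC -ler_pdivrMr //.
  have pL : 0 < 2 * Lam ^+ 2 / e ^+ 2 by rewrite divr_gt0 // mulr_gt0 // exprn_gt0.
  have pM : 0 < (1 + e / 2) ^+ M by rewrite exprn_gt0.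
  have pB : 0 < 2 * Bc ^+ 2 / e ^+ 2 by rewrite divr_gt0 // mulr_gt0 // exprn_gt0.
  rewrite -ler_ln ?posrE // lnXn // -/om.
  have -> : 2 * Lam ^+ 2 / e ^+ 2 = (2 * Bc ^+ 2 / e ^+ 2) * c g ^+ 2.
    by rewrite /Lam; field; rewrite gt_eqF.
  rewrite lnM ?posrE ?exprn_gt0 // lnXn // -[_ *+ M]mulr_natl.
  have hMY : Y / om < M%:R by exact: truncnS_gt.
  rewrite ltr_pdivrMr // in hMY.
  have hA : ln (2 * Bc ^+ 2 / e ^+ 2) <= A0 by exact: ler_norm.
  apply: ltW; apply: le_lt_trans hMY.
  by rewrite -[ln (c g) *+ 2]mulr_natl /Y lerD2r.
exists w => //.
have MY : (Num.truncn (Y / om))%:R <= Y / om by rewrite truncn_le.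
have : (size w)%:R <= (Num.truncn (Y / om) + 4)%N%:R :> R by rewrite ler_nat addn4.
rewrite natrD => h.
have -> : 2 / om * ln (c g) + (A0 / om + 4) = Y / om + 4.
  by rewrite /Y; field; rewrite gt_eqF.
by apply: (le_trans h); rewrite lerD2r.
Qed.

Theorem theorem1p1 (R : realType) (g : nat) (hg : (2 <= g)%N)
    (S : topologicalType) (A : set (chart R S))
    (hS : closed_oriented_surface g A)
    (X : topologicalType) (p : X -> S) (hp : universal_cover R p) (x0 : X)
    (Gamma : groupType) (cls : (R -> S) -> Gamma)
    (hGamma : is_fundamental_group (p x0) cls)
    (act : Gamma -> X -> X) (hact : deck_action p x0 cls act)
    (rho : Gamma -> 'M[complex R]_2) (hrho : SL2_representation rho) :
  (exists u : X -> mixed_plane R,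
     fitting_immersion (lifted_atlas p A) u /\ equivariant act rho u) ->
  quasi_fuchsian rho.
Proof.
move=> [u [[[sm _] ft] eqv]].
have [hausS cS _ hA _] := hS.
have [covp sc] := hp.
have hX := covering_hausdorff _ _ _ covp hausS.
have [act1 actM actc _ _] := hact.
have cov x : exists2 phi, lifted_atlas p A phi & chart_dom phi x.
  exact: lifted_chart_at.
have fit : chart_fitting (lifted_atlas p A) u.
  by move=> phi Aphi; split; [exact: sm|move=> y iy w; exact: ft].
have iE := dev_loc_inj _ _ _ _ cov fit.
have cc := center_continuous _ _ _ _ cov fit.
have [K [cK Kx0 KS]] := compact_lift _ _ _ _ _ x0 cS hA covp.
have [F hF] := deck_proper _ _ _ _ _ _ _ _ _ _ hausS hA hp hGamma hact cK.
have trans x x' : p x = p x' -> exists gamma, act gamma x = x'.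
  exact: deck_transitive hausS hp hact.
have [e e01 sec] := uniform_sections _ _ _ _ _ _ _ _ _ _ cS covp KS act1 actM
  actc trans hrho eqv cov fit.
have cX := simply_connected_connected _ _ sc.
have [[p0 _] _] := centerP _ (u x0).
apply: (quasi_fuchsian_of_words _ _ _ F (geo_center (u x0)) e hrho p0).
  by case/andP: e01.
exact: (fundamental_words _ _ _ act rho u K F x0 e hX cX iE cc act1 actM
  hrho eqv Kx0 hF e01 sec).
Qed.
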